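(* Let $f\ge 5$ be a prime such that $|\operatorname{PSL}(2,2^f)|$ has exactly four prime divisors, and let $G$ be a strictly $\operatorname{PSL}(2,2^f)$-solvable group. Then $\overline{\Gamma}(G)$ has no edge between any $z\in\pi(\operatorname{PSL}(2,2^f))$ and any $n\in\pi(G)\setminus\pi(\operatorname{Aut}(\operatorname{PSL}(2,2^f)))$.
   Context: All groups are finite. $\pi(G)$ is the set of prime divisors of $|G|$. $\overline{\Gamma}(G)$ (the prime graph complement) is the graph with vertex set $\pi(G)$ in which two distinct primes $p,q$ are adjacent if and only if $G$ has no element of order $pq$. For a nonabelian simple group $T$, a group is $T$-solvable if each of its composition factors is either cyclic or isomorphic to $T$, and strictly $T$-solvable if moreover at least one composition factor is isomorphic to $T$. *)

(* Defs.v *)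
From HB Require Import structures.
From mathcomp Require Import all_boot all_order all_algebra.
From mathcomp Require Import all_fingroup all_solvable all_field.

Set Implicit Arguments.
Unset Strict Implicit.
Unset Printing Implicit Defensive.

Import GRing.Theory.

Local Open Scope group_scope.

(* [{'GL_n[F]}] is made of matrices of size [n.-1.+1], so [SL n F] is the usual
   special linear group only for [0 < n]. *)
Section SpecialLinear.

Variables (n : nat) (F : finFieldType).

Definition SL : {set {'GL_n[F]}} := [set u : {'GL_n[F]} | (\det u == 1)%R].

Lemma SL_group_set : group_set SL.
Proof.
apply/group_setP; split=> [|u v]; first by rewrite inE GL_1E det1.
by rewrite !inE GL_MxE det_mulmx => /eqP-> /eqP->; rewrite mulr1.
Qed.

Canonical SL_group := Group SL_group_set.

Definition PSL : {set coset_of 'Z(SL)} := SL / 'Z(SL).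

Canonical PSL_group := Eval hnf in [group of PSL].

End SpecialLinear.

Section CompositionFactors.

Variables (gT rT : finGroupType) (T : {group rT}) (G : {group gT}).

(* By the Jordan-Hoelder theorem, the choice of the composition series [s] does
   not affect the isomorphism types of the factors. *)
Definition composition_factor (X : section gT) : Prop :=
  exists2 s : seq {group gT}, comps G s & X \in pairmap (@mkSec gT) G s.

Definition rel_solvable : Prop :=
  forall X, composition_factor X -> cyclic X \/ X \isog T.

Definition strictly_rel_solvable : Prop :=
  rel_solvable /\ exists2 X, composition_factor X & X \isog T.

End CompositionFactors.

(* Adjacency in the prime graph complement of [G]; its vertices are the elements
   of [\pi(G)], seen as natural numbers. *)
Definition prime_graph_compl (gT : finGroupType) (G : {group gT}) : rel nat :=
  fun p q => [&& p \in \pi(G), q \in \pi(G), p != q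
                & ~~ [exists x in G, #[x] == (p * q)%N]].

(* Main.v *)
From HB Require Import structures.
Require Import Defs.
From mathcomp Require Import all_boot all_order all_algebra.
From mathcomp Require Import all_fingroup all_solvable all_field all_character.
From mathcomp Require Import zify ring.

(** Write [q = 2 ^ f].  In characteristic [2] the group [SL(2, q)] has trivial
    center, so it is [PSL(2, q)]; call it [T].  An element of [G] of order
    [z * n] has to be found.

    Take a minimal normal subgroup [N] of [G] and argue by induction on [|G|].
    If [N] is not solvable, it is a direct product of copies of [T]
    ([nonsolvable_minnormal_order]).  An element [x] of order [n] that
    normalizes such a copy centralizes it, because [n] does not divide
    [|Aut T|]; otherwise the conjugates of the copy by the powers of [x]
    commute, and [x] can be corrected by an element of order [z] of the copy.
    If [N] is solvable it is an elementary abelian [p]-group.  Either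
    [n] divides [|G / N|], and an element of [G / N] can be lifted, or
    [p = n] and [n] does not divide [|G / N|] ([solvable_normal_order]).  In
    the latter case the Schur-Zassenhaus theorem provides an [n']-subgroup [L] of
    [G] with a morphism onto [T], and the point is that some element of order
    [z] of [L] centralizes a nontrivial element of [N].  After an extension of
    scalars this follows from [extension_fixed_vector]:

      if [L] maps onto [T] and [|L|] is invertible in the algebraically closed
      field [F], then in every nonzero representation of [L] over [F] some
      element of order [z] has a nonzero fixed vector.

    Suppose that this fails.  One may assume that the representation is
    irreducible and faithful and that no proper subgroup of [L] maps onto [T];
    let [K] be the kernel of [L -> T].
    - A noncyclic abelian group always contains a nontrivial element with a
      fixed vector, so the Sylow [z]-subgroups are cyclic and [z] is odd
      ([prime_odd], [zgroup_cyclic]).  By the Frattini argument the Sylow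
      subgroups of [K] are normal in [L], and [z] does not divide [|K|]
      ([ker_z'], from the inversion of a torus by the Weyl element).
    - [K] is central ([ker_central]).  Otherwise some normal [p]-subgroup [D] of
      [L] inside [K] is minimal subject to not being central.  An element [x]
      of order [z] centralizes the abelian subgroups of [D] that it normalizes,
      since Frobenius complements have fixed vectors; so the commutator subgroup
      of [D] and [x] is extraspecial.
      Comparing dimensions inside the matrix algebra gives
      [|D : C_D(x)| <= (z - 1) ^ 2] ([leq_index_center]), which forces
      [p = 2] and [z = 3].  In [T] an element of prime order dividing [q - 1]
      is a product of two elements of order [3], so a lift of it centralizes a
      subgroup of index at most [16] of [D], while the order of [2] modulo that
      prime is [f >= 5].
    - [K] is trivial ([injective_phi]).  A Sylow [2]-subgroup over the unipotent
      group [U] of [T] is abelian, as [f] is odd, hence contains an isomorphic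
      lift of [U]; with a lift of the torus it satisfies the relations of the
      Bruhat decomposition, and generates a complement of [K].
    - So [L] is isomorphic to [T].  When [z] divides [q - 1], the elements of
      order [z] act on [U] as Frobenius complements.  When [z] divides [q + 1],
      computations in the group algebra, based on the Bruhat decomposition, show
      that the sum of the elements of a Borel subgroup acts both as zero and not
      as zero ([BN_fixed_vector]). *)

Set Implicit Arguments.
Unset Strict Implicit.
Unset Printing Implicit Defensive.

Import GRing.Theory.

Local Open Scope group_scope.

(** * Coprime action *)

Lemma coprime_comm_cent_prod (gT : finGroupType) (A G : {group gT}) :
  A \subset 'N(G) -> coprime #|G| #|A| -> solvable G -> [~: G, A] * 'C_G(A) = G.
Proof.
move=> nGA coGA solG; have sRG: [~: G, A] \subset G by rewrite commg_subl.
have nRG: G \subset 'N([~: G, A]) := commg_norml G A.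
have nRA: A \subset 'N([~: G, A]) := commg_normr A G.
apply/eqP; rewrite eqEsubset mul_subG ?subsetIl //= -quotientSK //.
by rewrite coprime_quotient_cent // subsetI subxx quotient_cents2r.
Qed.

Lemma coprime_commGG (gT : finGroupType) (A G : {group gT}) :
  A \subset 'N(G) -> coprime #|G| #|A| -> solvable G -> [~: [~: G, A], A] = [~: G, A].
Proof.
move=> nGA coGA solG; rewrite -{2}(coprime_comm_cent_prod nGA coGA solG).
have cA: [~: 'C_G(A), A] = 1 by apply/commG1P; apply: subsetIr.
rewrite commMG ?cA ?mulg1 // normsR //.
  by apply: subset_trans (commg_norml G A); apply: subsetIl.
exact: subset_trans (subsetIr _ _) (cent_sub _).
Qed.

(** * Elements with nonzero fixed vectors *)

Section FixedVectors.

Variables (F : fieldType) (gT : finGroupType) (G : {group gT}) (d : nat).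
Variable rG : mx_representation F G d.

Lemma sum_reprMr (X : {group gT}) x : X \subset G -> x \in X ->
  ((\sum_(y in X) rG y) *m rG x = \sum_(y in X) rG y)%R.
Proof.
move=> sXG Xx; rewrite mulmx_suml (reindex_inj (mulIg x^-1)) /=.
apply: eq_big => y; first by rewrite groupMr ?groupV.
by rewrite groupMr ?groupV // => Xy; rewrite -repr_mxM ?mulgKV ?groupM ?groupV ?(subsetP sXG).
Qed.

Lemma sum_reprMl (X : {group gT}) x : X \subset G -> x \in X ->
  (rG x *m (\sum_(y in X) rG y) = \sum_(y in X) rG y)%R.
Proof.
move=> sXG Xx; rewrite mulmx_sumr (reindex_inj (mulgI x^-1)) /=.
apply: eq_big => y; first by rewrite groupMl ?groupV.
by rewrite groupMl ?groupV // => Xy; rewrite -repr_mxM ?mulKVg ?groupM ?groupV ?(subsetP sXG).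
Qed.

(** The rows of this sum are fixed by [x].  All arguments below by sums in the
    group algebra start from this relation. *)
Lemma sum_cycle_repr_eq0 x : x \in G -> ~~ eigenvalue (rG x) 1%R ->
  (\sum_(y in <[x]>) rG y = 0)%R.
Proof.
move=> Gx /eigenvalueP nofix; apply/row_matrixP=> i; rewrite row0.
apply/eqP/negPn/negP=> nz; case: nofix.
exists (row i (\sum_(y in <[x]>) rG y)%R) => //.
by rewrite scale1r -row_mul sum_reprMr ?cycle_id // cycle_subG.
Qed.

Lemma row_repr_fixed x (v : 'rV[F]_d) :
  (v *m rG x = v)%R -> (v != 0)%R -> eigenvalue (rG x) 1%R.
Proof. by move=> fixv nzv; apply/eigenvalueP; exists v; rewrite // scale1r. Qed.

Lemma eigenvalue1_expg x k : x \in G -> eigenvalue (rG x) 1%R ->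
  eigenvalue (rG (x ^+ k)) 1%R.
Proof.
move=> Gx /eigenvalueP[v]; rewrite scale1r => fixv nzv.
apply: row_repr_fixed nzv; elim: k => [|k IHk]; first by rewrite repr_mx1 mulmx1.
by rewrite expgS repr_mxM ?groupX // mulmxA fixv.
Qed.

Lemma card_pcharf_neq0 (X : {group gT}) : X \subset G -> [pchar F]%R^'.-group G ->
  (#|X|%:R != 0 :> F)%R.
Proof. by move=> sXG cG; rewrite natf_neq0_pchar; apply: pgroupS sXG cG. Qed.

(** The complement [<[x]>] of a Frobenius group with kernel [A] has a nonzero
    fixed vector unless [A] acts trivially.  If [x] has none, the sum
    [EX = 1 + x + ...] over [<[x]>] vanishes.  Adding up the conjugates of [EX]
    by the elements [b] of [A] gives [|A| + (EX - 1) EA = 0], where [EA] is the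
    sum over [A], because [y ^ b] runs through the coset [y A] when [y] is a
    nontrivial power of [x].  So [EA = |A|], and [EA] absorbs [A]. *)
Lemma Frobenius_kernel_trivial (A : {group gT}) x :
    [pchar F]%R^'.-group G -> A \subset G -> x \in G -> x \in 'N(A) ->
    prime #[x] -> 'C_A[x] = 1 -> ~~ eigenvalue (rG x) 1%R ->
  {in A, forall a, rG a = 1%:M%R}.
Proof.
move=> cG sAG Gx nAx pr_x regx nofix a Aa; pose X := <[x]>%G.
have sXG: X \subset G by rewrite cycle_subG.
have nAX: X \subset 'N(A) by rewrite cycle_subG.
have sumX: (\sum_(y in X) rG y = 0)%R by apply: sum_cycle_repr_eq0.
pose EA := (\sum_(b in A) rG b)%R.
have regX y: y \in X^# -> (\sum_(b in A) rG (y ^ b)%g = rG y *m EA)%R.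
  case/setD1P=> nty Xy; have Gy: y \in G by rewrite (subsetP sXG).
  have nAy: y \in 'N(A) by rewrite (subsetP nAX).
  have defX: <[y]> = <[x]>.
    apply/eqP; rewrite eqEcard cycle_subG Xy /=.
    have /(prime_nt_dvdP pr_x): #[y] != 1%N by rewrite order_eq1.
    by move/(_ (order_dvdG Xy)) => oy; rewrite -!orderE oy.
  have injy: {in A &, injective (fun b => y^-1 * y ^ b)}.
    move=> b c Ab Ac /= /mulgI eq_yb; apply/eqP; rewrite eq_mulgV1 -in_set1 -[[set 1]]regx.
    rewrite inE groupM ?groupV //= -(cent_cycle x) -defX cent_cycle.
    apply/cent1P; apply: commute_sym; apply/commgP/conjg_fixP.
    by rewrite conjgM eq_yb conjgK.
  have memA b: b \in A -> y^-1 * y ^ b \in A.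
    by move=> Ab; rewrite -/(commg y b) commgEr groupM // memJ_norm ?groupV.
  rewrite /EA mulmx_sumr; have defA: (fun b => y^-1 * y ^ b) @: A = A.
    by apply/eqP; rewrite eqEcard card_in_imset // leqnn andbT; apply/subsetP=> _ /imsetP[b Ab ->]; apply: memA.
  rewrite -[in RHS]defA big_imset //=; apply: eq_bigr => b Ab.
  rewrite -repr_mxM ?mulKVg // ?(subsetP sAG) //; exact: memA.
have: (\sum_(b in A) \sum_(y in X) rG (y ^ b)%g = 0)%R.
  apply: big1 => b Ab; have Gb := subsetP sAG b Ab.
  transitivity (rG (b^-1)%g *m (\sum_(y in X) rG y) *m rG b)%R; last by rewrite sumX mulmx0 mul0mx.
  rewrite mulmx_sumr mulmx_suml; apply: eq_bigr => y Xy; have Gy := subsetP sXG y Xy.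
  by rewrite -!repr_mxM ?groupM ?groupV // -mulgA.
rewrite exchange_big /= (big_setD1 1) //=.
have ->: (\sum_(b in A) rG (1 ^ b)%g = #|A|%:R%:M)%R.
  under eq_bigr do rewrite conj1g repr_mx1.
  by rewrite sumr_const -raddfMn.
under eq_bigr => y Xy do rewrite regX //.
rewrite -mulmx_suml; have: (\sum_(y in X) rG y = 0)%R by [].
rewrite (big_setD1 1) //= repr_mx1 => /eqP; rewrite addrC addr_eq0 => /eqP->.
rewrite mulNmx mul1mx => /eqP; rewrite subr_eq0 => /eqP defEA.
have := sum_reprMr sAG Aa; rewrite -/EA -defEA -{2}[(#|A|%:R%:M)%R]mulmx1 => /eqP.
rewrite -subr_eq0 -mulmxBr mul_scalar_mx scaler_eq0 (negPf (card_pcharf_neq0 sAG cG)) /=.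
by rewrite subr_eq0 => /eqP.
Qed.

End FixedVectors.

Section AbelianFixedVectors.

Variables (F : fieldType) (gT : finGroupType) (G : {group gT}) (d : nat).
Variable rG : mx_representation F G d.

(** A faithful irreducible representation of an abelian group forces it to be
    cyclic, so the kernel of [A] on a simple submodule is not trivial. *)
Lemma abelian_noncyclic_fixed (A : {group gT}) :
    0 < d -> A \subset G -> abelian A -> ~~ cyclic A ->
  [exists x in A^#, eigenvalue (rG x) 1%R].
Proof.
move=> d_gt0 sAG cAA ncA; pose rA := subg_repr rG sAG.
have nz1: (1%:M != 0 :> 'M[F]_d)%R by rewrite -mxrank_eq0 mxrank1 -lt0n.
apply: (mxsimple_exists (mxmodule1 rA) nz1) => -[V simV _].
pose rV := submod_repr (mxsimple_module simV).
have irrV: mx_irreducible rV by apply/submod_mx_irr.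
have /trivgPn[x]: rker rV != 1.
  by apply: contra ncA => kV; apply: mx_faithful_irr_abelian_cyclic irrV cAA; rewrite /mx_faithful (eqP kV).
have kV: rker rV = rstab rA V := rker_submod _.
rewrite -[rker_group rV : {set gT}]/(rker rV) kV inE => /andP[Ax /eqP fixV] ntx.
apply/exists_inP; exists x; first by rewrite !inE ntx.
have nzV: (nz_row V != 0)%R by rewrite nz_row_eq0; have /mxsimpleP[] := simV.
apply: row_repr_fixed nzV; have /submxP[D ->] := nz_row_sub V.
by rewrite -mulmxA; congr (_ *m _)%R.
Qed.

End AbelianFixedVectors.

(** * Dimension counts in matrix algebras *)

Section DimensionBounds.

Variables (K : fieldType) (vT wT : vectType K) (I : finType).

(** Each map cuts down the dimension of the common kernel by at most
    [\dim C]. *)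
Lemma leq_dim_separating (f : I -> 'Hom(vT, wT)) (P : {set I})
    (W : {vspace vT}) (C : {vspace wT}) :
    (forall i, i \in P -> (f i @: W <= C)%VS) ->
    (forall y, y \in W -> (forall i, i \in P -> f i y = 0%R) -> y = 0%R) ->
  \dim W <= #|P| * \dim C.
Proof.
move=> sfC sep; pose L s := foldr (fun i V => (V :&: lker (f i))%VS) W s.
have sub s: {subset s <= P} -> \dim W <= size s * \dim C + \dim (L s) /\ (L s <= W)%VS.
  elim: s => [|i s IHs] sP /=; first by rewrite subvv.
  have [|leW sLW] := IHs; first by move=> j sj; rewrite sP // inE sj orbT.
  split; last exact: subv_trans (capvSl _ _) sLW.
  apply: leq_trans leW _; rewrite mulSn -addnA addnCA leq_add2l.
  rewrite -(limg_ker_dim (f i) (L s)) addnC leq_add2r dimvS //.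
  by apply: subv_trans (limgS _ sLW) (sfC i _); rewrite sP ?mem_head.
have [|leW sLW] := sub (enum P); first by move=> i; rewrite mem_enum.
rewrite -cardE in leW; apply: leq_trans leW _; rewrite -[leqRHS]addn0 leq_add2l leqn0 dimv_eq0.
rewrite -subv0; apply/subvP=> y Ly; rewrite memv0; apply/eqP/sep; first exact: (subvP sLW).
move=> i; rewrite -mem_enum; move: Ly; elim: (enum P) => //= j s IHs.
case/memv_capP=> Ly; rewrite memv_ker => /eqP fy0; rewrite inE => /predU1P[-> //|].
exact: IHs.
Qed.

(** The maps [t i] detect the summand [m i @: C], so these copies of [C] are in
    direct sum. *)
Lemma geq_dim_independent (m : I -> 'Hom(wT, vT)) (t : I -> 'Hom(vT, wT))
    (P : {set I}) (W : {vspace vT}) (C : {vspace wT}) :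
    (forall i, i \in P -> (m i @: C <= W)%VS) ->
    (forall i j c, i \in P -> j \in P -> c \in C -> i != j -> t i (m j c) = 0%R) ->
    (forall i c, i \in P -> c \in C -> t i (m i c) = 0%R -> c = 0%R) ->
  #|P| * \dim C <= \dim W.
Proof.
move=> smW ortho inj; pose S s := foldr (fun i V => (m i @: C + V)%VS) 0%VS s.
have memS s i y: i \in P -> i \notin s -> {subset s <= P} -> y \in S s -> t i y = 0%R.
  move=> Pi; elim: s y => [|j s IHs] y /=; first by rewrite memv0 => _ _ /eqP->; rewrite linear0.
  rewrite inE negb_or => /andP[neq_ij s'i] sP.
  case/memv_addP=> _ /memv_imgP[c Cc ->] [v Sv ->].
  rewrite linearD /= (ortho i j c Pi (sP _ (mem_head _ _)) Cc neq_ij) add0r IHs // => k sk.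
  by rewrite sP // inE sk orbT.
have dimS s: uniq s -> {subset s <= P} -> \dim (S s) = (size s * \dim C)%N /\ (S s <= W)%VS.
  elim: s => [|i s IHs] /= => [_ _|/andP[s'i Us] sP]; first by rewrite dimv0 sub0v.
  have sP': {subset s <= P} by move=> j sj; rewrite sP // inE sj orbT.
  have Pi: i \in P by rewrite sP ?mem_head.
  have [dS sSW] := IHs Us sP'.
  split; last by rewrite subv_add smW.
  have capK: (C :&: lker (m i) = 0)%VS.
    apply/eqP; rewrite -subv0; apply/subvP=> c /memv_capP[Cc].
    rewrite memv_ker memv0 => /eqP mc0.
    by apply/eqP/(inj i c Pi Cc); rewrite mc0 linear0.
  have capS: ((m i @: C) :&: S s = 0)%VS.
    apply/eqP; rewrite -subv0; apply/subvP=> y /memv_capP[/memv_imgP[c Cc ->] Sc].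
    by rewrite (inj i c Pi Cc) ?linear0 ?mem0v // (memS s).
  by rewrite dimv_disjoint_sum // limg_dim_eq // dS mulSn.
have [] := dimS (enum P) (enum_uniq _); first by move=> i; rewrite mem_enum.
by rewrite -cardE => <- /dimvS.
Qed.

End DimensionBounds.

(** The Cauchy-Schwarz inequality for the sizes of the fibers of [c]. *)
Lemma leq_sqr_card_collisions (I J : finType) (c : I -> J) (P : {set J}) :
  (forall i, c i \in P) ->
  (#|I| ^ 2 <= #|P| * #|[set ij : I * I | c ij.1 == c ij.2]|)%N.
Proof.
move=> cP; pose m j := #|[set i | c i == j]|.
have sumI (g : I -> nat) : (\sum_i g i = \sum_(j in P) \sum_(i | c i == j) g i)%N.
  by rewrite (partition_big c (mem P)) //= => i _; apply: cP.
have cardI: #|I| = (\sum_(j in P) m j)%N.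
  by rewrite -sum1_card sumI; apply: eq_bigr => j _; rewrite sum1dep_card.
have ->: #|[set ij : I * I | c ij.1 == c ij.2]| = (\sum_(j in P) m j ^ 2)%N.
  rewrite -sum1_card (eq_bigl (fun ij : I * I => true && (c ij.1 == c ij.2))); last first.
    by move=> ij; rewrite inE.
  rewrite -(pair_big_dep xpredT (fun i k => c i == c k) (fun _ _ => 1%N)) /=.
  rewrite sumI; apply: eq_bigr => j _.
  rewrite (eq_bigr (fun=> m j)) => [|i /eqP <-]; last first.
    by rewrite sum1dep_card; apply: eq_card => k; rewrite !inE eq_sym.
  by rewrite sum_nat_const mulnC; congr (_ * _)%N; rewrite -cardsE.
rewrite cardI -mulnn big_distrlr /= -leq_double -!mul2n big_distrr /=.
under eq_bigr do rewrite big_distrr /=.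
apply: (@leq_trans (\sum_(i in P) \sum_(j in P) (m i ^ 2 + m j ^ 2))%N).
  by apply: leq_sum => i _; apply: leq_sum => j _; apply: nat_Cauchy.
under eq_bigr do rewrite big_split /= sum_nat_const.
by rewrite big_split /= sum_nat_const -big_distrr /= mul2n addnn.
Qed.

(** ['X^z - 1] is separable because [z] is invertible. *)
Lemma diagonalizable_order (F : closedFieldType) n (A : 'M[F]_n.+1) z :
  (z%:R != 0 :> F)%R -> (A ^+ z = 1)%R -> diagonalizable A.
Proof.
move=> nz_z Az1; apply/diagonalizableP.
have [|z_gt0] := posnP z; first by move=> z0; rewrite z0 eqxx in nz_z.
have [rs def_rs] := closed_field_poly_normal ('X^z - 1 : {poly F})%R.
rewrite (monicP (monicXnsubC 1%R z_gt0)) scale1r in def_rs.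
exists rs; last by rewrite -def_rs; apply/mxminpoly_minP; rewrite rmorphB rmorphXn /= horner_mx_X rmorph1 Az1 subrr.
rewrite -separable_prod_XsubC -def_rs unlock.
apply/Bezout_coprimepP; exists ((- z%:R)%:P, 'X)%R => /=.
rewrite derivB derivXn derivC subr0 mulrnAr -exprS prednK //.
have ->: ((- z%:R)%:P * ('X^z - 1) + 'X^z *+ z = z%:R%:P :> {poly F})%R.
  by rewrite polyCN mulNr mulrBr mulr1 opprB mul_polyC scaler_nat subrK.
by rewrite -size_poly_eq1 size_polyC nz_z.
Qed.

Definition lrmul (F : fieldType) n (A B : 'M[F]_n) : 'End('M[F]_n) :=
  linfun (mulmxr B \o mulmx A)%FUN.

Lemma lrmulE (F : fieldType) n (A B Y : 'M[F]_n) : lrmul A B Y = (A *m Y *m B)%R.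
Proof. by rewrite lfunE. Qed.

(** In a basis of eigenvectors the centralizer of [A] is a product of matrix
    algebras, one for each eigenvalue.  There are at most [z.-1] eigenvalues, as
    they are [z]-th roots of unity other than [1], so the sum of the squares of
    their multiplicities is at least [n.+1 ^ 2 / z.-1]. *)
Lemma centralizer_dim_ge (F : closedFieldType) n (A : 'M[F]_n.+1) z
    (W : {vspace 'M[F]_n.+1}) :
    (z%:R != 0 :> F)%R -> (A ^+ z = 1)%R -> ~~ eigenvalue A 1%R ->
    (forall Y : 'M[F]_n.+1, A *m Y = Y *m A -> Y \in W)%R ->
  n.+1 ^ 2 <= z.-1 * \dim W.
Proof.
move=> nz_z Az1 no1 cW.
have z_gt0: 0 < z by rewrite lt0n; apply: contraNneq nz_z => ->.
have [P Pu /diagonalizable_forPex[D /(simmxP Pu) PA]] := diagonalizable_order nz_z Az1.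
have eigP i: (row i P *m A = D 0 i *: row i P)%R.
  by rewrite -row_mul PA row_mul row_diag_mx -scalemxAl -rowE.
have nzP i: (row i P != 0)%R.
  apply: contraTneq Pu => Pi0; rewrite unitmxE (expand_det_row _ i) big1 ?unitr0 // => j _.
  by have := congr1 (fun v : 'rV_n.+1 => v 0%R j) Pi0; rewrite !mxE => ->; rewrite mul0r.
have Dz i: (D 0 i ^+ z = 1)%R.
  have eigk k: (row i P *m A ^+ k = D 0 i ^+ k *: row i P)%R.
    elim: k => [|k IHk]; first by rewrite mulmx1 scale1r.
    by rewrite exprSr mulmxA IHk -scalemxAl eigP scalerA exprSr.
  apply/eqP; rewrite eq_sym -subr_eq0; have := eigk z; rewrite Az1 mulmx1 => /eqP.
  by rewrite -[X in X == _]scale1r -subr_eq0 -scalerBl scaler_eq0 (negPf (nzP i)) orbF.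
have D1 i: (D 0 i != 1)%R.
  apply: contraNneq no1 => Di1; apply/eigenvalueP; exists (row i P); rewrite ?nzP //.
  by rewrite eigP Di1.
pose rs := undup [seq D 0%R i | i : 'I_n.+1].
have mem_rs i: D 0%R i \in rs by rewrite mem_undup map_f ?mem_enum.
have szrs: size rs <= z.-1.
  rewrite -ltnS prednK // -[_.+1]/(size (1%R :: rs)) max_unity_roots //=.
    rewrite unity_rootE expr1n eqxx; apply/allP=> r; rewrite mem_undup => /mapP[i _ ->].
    by rewrite unity_rootE Dz.
  rewrite undup_uniq andbT mem_undup; apply/mapP=> -[i _] /eqP.
  by rewrite eq_sym (negPf (D1 i)).
have lt_rs i: index (D 0%R i) rs < size rs by rewrite index_mem.
pose c i := Ordinal (lt_rs i).
have eq_c i j: (c i == c j) = (D 0%R i == D 0%R j).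
  apply/eqP/eqP=> [[eq_ij]|eqD]; last by apply: val_inj; rewrite /= eqD.
  by rewrite -(nth_index 0%R (mem_rs i)) eq_ij nth_index.
have := leq_sqr_card_collisions (fun i => in_setT (c i)).
rewrite cardsT !card_ord => /leq_trans-> //; rewrite leq_mul //.
(* [m ij] sends the all-ones matrix [one] to the matrix unit at [ij] in the basis
   of eigenvectors, and [t ij] reads the coefficient of that matrix unit. *)
pose m (ij : 'I_n.+1 * 'I_n.+1) := lrmul (invmx P *m delta_mx ij.1 ij.1)%R (delta_mx ij.2 ij.2 *m P)%R.
pose t (ij : 'I_n.+1 * 'I_n.+1) := lrmul (delta_mx ij.1 ij.1 *m P)%R (invmx P *m delta_mx ij.2 ij.2)%R.
have dd (i j : 'I_n.+1) (Y : 'M[F]_n.+1) :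
    (delta_mx i i *m Y *m delta_mx j j = Y i j *: delta_mx i j)%R.
  apply/matrixP=> a b; rewrite mxE (bigD1 j) //= big1 ?addr0 => [|e ne_e]; last first.
    by rewrite !mxE (negPf ne_e) mulr0.
  rewrite !mxE (bigD1 i) //= big1 ?addr0 => [|e ne_e]; last first.
    by rewrite !mxE (negPf ne_e) andbF mul0r.
  by rewrite !mxE !eqxx andbT /=; case: (a == i); case: (b == j); rewrite ?mul1r ?mulr1 ?mulr0 ?mul0r.
have mE ij Y : m ij Y = (Y ij.1 ij.2 *: (invmx P *m delta_mx ij.1 ij.2 *m P))%R.
  by rewrite lrmulE scalemxAl scalemxAr -dd !mulmxA.
have tm ij kl Y : t ij (m kl Y) = if ij == kl then (Y ij.1 ij.2 *: delta_mx ij.1 ij.2)%R else 0%R.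
  rewrite mE linearZ /= lrmulE !mulmxA mulmxK // mulmxK // dd mxE.
  case: ij kl => [i j] [k l]; rewrite xpair_eqE /=.
  by case: eqP => [->|_]; case: eqP => [->|_] /=; rewrite ?scale1r ?scale0r ?scaler0.
pose one : 'M[F]_n.+1 := const_mx 1%R.
have nz1: one != 0%R by apply/eqP=> /matrixP/(_ 0 0)%R/eqP; rewrite !mxE oner_eq0.
have := @geq_dim_independent F _ _ _ m t [set ij | c ij.1 == c ij.2] W <[one]>%VS.
rewrite dim_vline nz1 muln1; apply.
- move=> ij; rewrite inE eq_c => /eqP eqD; apply/subvP=> _ /memv_imgP[Y _ ->].
  rewrite mE memvZ ?cW // !mulmxA -(mulmxA _ P) PA.
  have ->: (A *m invmx P = invmx P *m diag_mx D)%R.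
    by rewrite -[LHS](mulKmx Pu) (mulmxA P) PA mulmxK.
  rewrite !mulmxA; congr (_ *m _)%R; rewrite -!mulmxA; congr (_ *m _)%R.
  rewrite mul_diag_mx mul_mx_diag; apply/matrixP=> a b; rewrite !mxE.
  by case: eqP => [->|]; case: eqP => [->|] //=; rewrite ?mulr0 ?mul0r // eqD mulr1 mul1r.
- by move=> ij kl Y _ _ _ /negPf; rewrite tm => ->.
- move=> ij _ _ /vlineP[k ->]; rewrite tm eqxx !mxE mulr1 => /eqP.
  rewrite scaler_eq0 => /orP[/eqP->|]; first by rewrite scale0r.
  by move/eqP/matrixP/(_ ij.1 ij.2)/eqP; rewrite !mxE !eqxx oner_eq0.
Qed.

(** * The bound on extraspecial subgroups *)

(** With [k.+1 = |V|] and [y.+1 = z] this combines [|V| <= (z - 1) r] with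
    [z r <= z + |V| - 1], where [r] is a number of orbits of a group of order
    [z] on [V]. *)
Lemma orbit_count_leq y k : y.+1 * k.+1 <= y * (y.+1 + k) -> k.+1 <= y ^ 2.
Proof. by rewrite -mulnn; nia. Qed.

(** The subgroup [S] acts so that its center is scalar and that the commutators
    with a noncentral element include a nontrivial scalar, as an extraspecial
    group does in a faithful irreducible representation.  Then the
    matrices [rG v], for [v] in a transversal of ['Z(S)], form a basis of the
    matrix algebra over the centralizer algebra of [S].  The operator [conj_sum]
    is [|S|] times the projection onto this centralizer, so it reads the
    coordinates in that basis. *)
Section ExtraspecialBound.

Variables (F : closedFieldType) (gT : finGroupType) (G : {group gT}) (d : nat).
Variable rG : mx_representation F G d.
Variables (S : {group gT}) (x : gT).

Hypotheses (pcharG : [pchar F]%R^'.-group G) (sSG : S \subset G) (Gx : x \in G).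
Hypothesis (nSx : x \in 'N(S)).
Hypothesis scalZ : forall c, c \in 'Z(S) -> is_scalar_mx (rG c).
Hypothesis sepZ : forall g, g \in S :\: 'Z(S) ->
  exists2 y, y \in S & [~ g, y] \in 'Z(S) /\ rG [~ g, y] != 1%:M%R.

Let GS y (Sy : y \in S) : y \in G := subsetP sSG y Sy.

Definition conj_sum (Y : 'M[F]_d) : 'M[F]_d := (\sum_(w in S) rG w^-1%g *m Y *m rG w)%R.

Lemma conj_sum_is_linear : linear conj_sum.
Proof.
move=> k Y Z; rewrite /conj_sum scaler_sumr -big_split /=; apply: eq_bigr => w _.
by rewrite mulmxDr mulmxDl -scalemxAr -scalemxAl.
Qed.

HB.instance Definition _ :=
  GRing.isLinear.Build F 'M[F]_d 'M[F]_d *:%R conj_sum conj_sum_is_linear.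

Lemma conj_sum_comm Y y : y \in S -> (conj_sum Y *m rG y = rG y *m conj_sum Y)%R.
Proof.
move=> Sy; rewrite mulmx_suml mulmx_sumr (reindex_inj (mulIg y^-1)) /=.
apply: eq_big => w; rewrite groupMr ?groupV // => Sw.
rewrite invMg invgK repr_mxM ?GS ?groupV // -!mulmxA; do 3!congr (_ *m _)%R.
by rewrite -repr_mxM ?GS ?groupM ?groupV // mulgKV.
Qed.

Lemma conj_sumMl A Y : (forall y, y \in S -> A *m rG y = rG y *m A)%R ->
  (conj_sum (A *m Y) = A *m conj_sum Y)%R.
Proof.
move=> cA; rewrite mulmx_sumr; apply: eq_bigr => w Sw.
by rewrite !mulmxA cA ?groupV.
Qed.

Lemma conj_sum_comm_val A : (forall y, y \in S -> A *m rG y = rG y *m A)%R ->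
  (conj_sum A = #|S|%:R *: A)%R.
Proof.
move=> cA; rewrite /conj_sum scaler_nat -sumr_const; apply: eq_bigr => w Sw.
by rewrite -mulmxA cA // mulmxA -repr_mxM ?GS ?groupV // mulVg repr_mx1 mul1mx.
Qed.

(** Translating the summation by [y] multiplies the sum by the scalar
    [rG [~ g, y]], which is not [1]. *)
Lemma sum_conj_noncentral g : g \in S :\: 'Z(S) ->
  (\sum_(w in S) rG (w^-1 * g * w)%g = 0)%R.
Proof.
move=> SZg; have [y Sy [Zgy ne1]] := sepZ SZg.
have Sg: g \in S by case/setDP: SZg.
have /is_scalar_mxP[a ra] := scalZ Zgy.
have: (\sum_(w in S) rG (w^-1 * g * w)%g = a *: \sum_(w in S) rG (w^-1 * g * w)%g)%R.
  rewrite [LHS](reindex_inj (mulgI y)) /= scaler_sumr; apply: eq_big => w.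
    by rewrite groupMl.
  rewrite groupMl // => Sw; have cw: commute [~ g, y] w by case/centerP: Zgy => _; apply.
  have ->: (y * w)^-1 * g * (y * w) = w^-1 * g * w * [~ g, y].
    rewrite -(mulgA _ w) -cw.
    by rewrite commgEl conjgE invMg !mulgA mulgK.
  by rewrite repr_mxM ?GS ?groupM ?groupV ?groupR // ra mul_mx_scalar.
move/eqP; rewrite -subr_eq0 -[X in (X - _)%R]scale1r -scalerBl scaler_eq0 subr_eq0.
by case/orP=> [/eqP a1|/eqP//]; rewrite ra -a1 eqxx in ne1.
Qed.

(** Adding up [conj_sum (Y *m rG v^-1) *m rG v] over [v] isolates the terms
    [w^-1 * v^-1 * w * v] with [w] central, each of which returns [Y]. *)
Lemma conj_sum_separating Y :
  (forall v, v \in S -> conj_sum (Y *m rG v^-1%g) = 0)%R -> (Y = 0)%R.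
Proof.
move=> tau0; have: (\sum_(v in S) conj_sum (Y *m rG v^-1%g) *m rG v = 0)%R.
  by apply: big1 => v Sv; rewrite tau0 // mul0mx.
under eq_bigr do rewrite mulmx_suml.
rewrite exchange_big /= (bigID (fun w => w \in 'Z(S))) /= [X in (_ + X)%R]big1.
  rewrite addr0 (eq_bigr (fun=> #|S|%:R *: Y))%R => [|w /andP[Sw Zw]].
    rewrite sumr_const => /eqP; rewrite -scaler_nat !scaler_eq0.
    rewrite (negPf (card_pcharf_neq0 sSG pcharG)) /=.
    have ->: #|[pred w | w \in S & w \in 'Z(S)]| = #|'Z(S)|.
      by apply: eq_card => w; rewrite !inE; case: (w \in S).
    rewrite (negPf (card_pcharf_neq0 (subset_trans (center_sub S) sSG) pcharG)) /=.
    by move/eqP.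
  rewrite scaler_nat -sumr_const; apply: eq_bigr => v Sv.
  have /is_scalar_mxP[a ra] := scalZ Zw.
  have cwv: commute w v by case/centerP: Zw => _; apply.
  rewrite -!mulmxA -!repr_mxM ?GS ?groupM ?groupV // (_ : v^-1 * (w * v) = w).
    rewrite ra mul_mx_scalar -scalemxAr -mul_scalar_mx -ra mulmxA -repr_mxM ?GS ?groupV //.
    by rewrite mulgV repr_mx1 mul1mx.
  by rewrite cwv mulKg.
move=> w /andP[Sw Z'w].
transitivity (rG w^-1%g *m Y *m (\sum_(v in S) rG (v^-1 * w * v)%g))%R.
  rewrite mulmx_sumr; apply: eq_bigr => v Sv.
  by rewrite -!mulmxA -!repr_mxM ?GS ?groupM ?groupV // !mulgA.
by rewrite sum_conj_noncentral ?mulmx0 // inE Z'w.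
Qed.

(** The coordinates of a matrix that commutes with [x] are determined by one
    coordinate in each orbit of [x]. *)
Lemma conj_sum_equivariant Y v : (rG x *m Y = Y *m rG x)%R -> v \in S ->
  (conj_sum (Y *m rG (v ^ x)^-1%g) = rG x^-1%g *m conj_sum (Y *m rG v^-1%g) *m rG x)%R.
Proof.
move=> cYx Sv; rewrite mulmx_sumr mulmx_suml [LHS](reindex_inj (conjg_inj x)) /=.
apply: eq_big => w; first by rewrite memJ_norm.
rewrite memJ_norm // => Sw; have Gv := GS Sv; have Gw := GS Sw.
rewrite -!conjVg !conjgE !repr_mxM ?groupM ?groupV // !mulmxA.
have xV: (rG x *m rG x^-1%g = 1%:M)%R by rewrite -repr_mxM ?groupV // mulgV repr_mx1.
by rewrite -(mulmxA _ (rG x) Y) cYx !mulmxA -!(mulmxA _ (rG x) (rG x^-1%g)) xV !mulmx1.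
Qed.

Lemma conj_sum_cycle Y v i : (rG x *m Y = Y *m rG x)%R -> v \in S ->
  (conj_sum (Y *m rG v^-1%g) = 0)%R -> (conj_sum (Y *m rG (v ^ (x ^+ i))^-1%g) = 0)%R.
Proof.
move=> cYx Sv tau0; elim: i => [|i IHi]; first by rewrite conjg1.
rewrite expgSr conjgM conj_sum_equivariant ?IHi ?mulmx0 ?mul0mx //.
by rewrite memJ_norm ?groupX.
Qed.

(** Let [E] be the matrix algebra, [C] the centralizer of [S] in it, and
    [V = S / 'Z(S)].  Then [|V| * \dim C <= \dim E] since the elements of [V]
    are independent over [C], while the centralizer [W] of [x] has dimension
    at least [\dim E / (z - 1)].  A matrix of [W] is determined by one
    coordinate in [C] for each orbit of [x] on [V], and all orbits but one
    have length [z]. *)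
Lemma leq_index_center :
    0 < d -> prime #[x] -> coprime #|S| #[x] -> solvable S -> 'C_S[x] = 'Z(S) ->
  ~~ eigenvalue (rG x) 1%R -> #|S : 'Z(S)| <= #[x].-1 ^ 2.
Proof.
move=> d_gt0 pr_x coSx solS cSx nofix; set z := #[x] in pr_x coSx *.
have z_gt1 := prime_gt1 pr_x; pose Z := 'Z(S); pose X := (<[x]> / Z)%G.
have nZX: <[x]> \subset 'N(Z) by rewrite cycle_subG (subsetP _ x nSx) ?gFnorms.
have nZS: S \subset 'N(Z) by apply: gFnorm.
rewrite -card_quotient //; pose V := (S / Z)%G; change (#|V| <= z.-1 ^ 2).
have nVX: X \subset 'N(V) by rewrite quotient_norms // cycle_subG.
have cVX: 'C_V(X) = 1.
  by rewrite -coprime_quotient_cent ?center_sub // cent_cycle cSx trivg_quotient.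
pose orbs := orbit 'J X @: V; pose P := [set repr T | T in orbs].
have actsXV: [acts X, on V | 'J] by rewrite astabsJ.
have repr_orb T : T \in orbs -> repr T \in T.
  by case/imsetP=> A _ ->; apply: mem_repr (orbit_refl _ _ _).
have orb_sub T : T \in orbs -> T \subset V by case/imsetP=> A VA ->; rewrite acts_sub_orbit.
have sPV: P \subset V.
  by apply/subsetP=> _ /imsetP[T oT ->]; apply: (subsetP (orb_sub T oT)); apply: repr_orb.
have P_cover A : A \in V -> exists2 B, B \in P & exists2 y, y \in X & A = B ^ y.
  move=> VA; have oA: orbit 'J X A \in orbs by apply: imset_f.
  exists (repr (orbit 'J X A)); first exact: imset_f.
  by have := repr_orb _ oA; rewrite orbit_sym => /orbitP[y Xy defA]; exists y.
have [V1 | ntV] := eqsVneq V 1.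
  by rewrite V1 cards1 expn_gt0 -ltnS prednK ?z_gt1 // ltnW.
have oX: #|X| = z.
  apply/(prime_nt_dvdP pr_x); last exact: dvdn_quotient.
  apply: contraNneq ntV => X1; apply/eqP; rewrite -cVX.
  by apply/esym/setIidPl; rewrite (card1_trivg X1) cents1.
have prX: prime #|X| by rewrite oX.
(* Only the trivial coset is fixed by [x], since [x] acts without fixed points
   on [V]. *)
have card_P : z * #|P| <= z + #|V|.-1.
  have o1: orbit 'J X 1 \in orbs by apply: imset_f.
  have -> : #|V| = (1 + z * #|orbs|.-1)%N.
    have ->: #|orbs|.-1 = #|orbs :\ orbit 'J X 1| by rewrite (cardsD1 (orbit 'J X 1) orbs) o1.
    rewrite -(acts_sum_card_orbit actsXV) (big_setD1 _ o1) /=.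
    congr (_ + _)%N.
      by rewrite card_orbit astab1J cent11T setIT indexgg.
    rewrite (eq_bigr (fun=> z)); first by rewrite sum_nat_const mulnC.
    move=> T /setD1P[ne1 /imsetP[A VA defT]].
    rewrite defT card_orbit astab1J prime_TIg ?indexg1 //; apply: contra ne1 => cAX.
    have: A \in 'C_V(X) by rewrite inE VA -sub_cent1.
    by rewrite cVX inE defT => /eqP->.
  rewrite add1n /= -mulnS prednK ?leq_mul ?leq_imset_card //.
  by apply/card_gt0P; exists (orbit 'J X 1).
have Sr A : A \in V -> repr A \in S.
  move=> VA; have /morphimP[v nZv Sv defA] := VA.
  have: repr A \in Z :* v by rewrite -(val_coset nZv) -defA mem_repr_coset.
  by case/rcosetP=> c /(subsetP (center_sub S)) Sc ->; rewrite groupM.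
have nzS: (#|S|%:R != 0 :> F)%R by apply: card_pcharf_neq0 sSG pcharG.
pose sigma := linfun conj_sum; pose C := limg sigma.
have commC c : c \in C -> forall y, y \in S -> (c *m rG y = rG y *m c)%R.
  by case/memv_imgP=> Y _ -> y Sy; rewrite lfunE /= conj_sum_comm.
pose W := lker (lrmul (rG x) 1%:M - lrmul 1%:M (rG x))%R.
have memW Y : (Y \in W) = (rG x *m Y == Y *m rG x)%R.
  by apply/eqlfunP/eqP; rewrite !lrmulE mul1mx mulmx1.
have lowW: d ^ 2 <= z.-1 * \dim W.
  case: (d) rG nofix d_gt0 W memW => // d' rG' nofix' _ W' memW'.
  apply: (@centralizer_dim_ge _ _ (rG' x) z W') => //.
  - have := card_pcharf_neq0 (_ : <[x]> \subset G) pcharG; rewrite cycle_subG -orderE; exact.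
  - by rewrite -repr_mxX // expg_order repr_mx1.
  - by move=> Y eqY; rewrite memW'; apply/eqP.
have highW: \dim W <= #|P| * \dim C.
  pose f (A : coset_of Z) := (sigma \o lrmul 1%:M (rG (repr A)^-1%g))%VF.
  have fE A Y: f A Y = conj_sum (Y *m rG (repr A)^-1%g)%R.
    by rewrite comp_lfunE lfunE /= lrmulE mul1mx.
  apply: (@leq_dim_separating _ _ _ _ f) => [A _|Y].
    by apply/subvP=> _ /memv_imgP[Y _ ->]; rewrite comp_lfunE memv_img ?memvf.
  rewrite memW => /eqP cYx fY0; apply: conj_sum_separating => v Sv.
  have [B PB [_ /morphimP[y nZy Xy ->]]] := P_cover _ (mem_quotient Z Sv).
  have VB := subsetP sPV B PB; have SB := Sr B VB; have := fY0 B PB; rewrite fE => tauB.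
  have nZv: v \in 'N(Z) by apply: subsetP nZS v Sv.
  have nZB: repr B \in 'N(Z) by apply: subsetP nZS _ SB.
  rewrite -[B]coset_reprK -morphJ // => eq_v.
  have /(rcoset_kercosetP nZv (groupJ nZB nZy))/rcosetP[c Zc ->] := eq_v.
  have /cycleP[i def_y] := Xy; have SBy: repr B ^ y \in S by rewrite memJ_norm // def_y groupX.
  have /is_scalar_mxP[k rk] := scalZ (groupVr Zc).
  have Sc: c \in S by apply: subsetP (center_sub S) c Zc.
  rewrite invMg repr_mxM ?GS ?groupV // rk mul_mx_scalar -scalemxAr linearZ /=.
  by rewrite def_y conj_sum_cycle ?scaler0.
have indep: #|V| * \dim C <= d ^ 2.
  pose m (A : coset_of Z) := lrmul 1%:M (rG (repr A)).
  pose t (A : coset_of Z) := (sigma \o lrmul 1%:M (rG (repr A)^-1%g))%VF.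
  have tm A B c : A \in V -> B \in V -> c \in C ->
      t A (m B c) = (c *m conj_sum (rG (repr B * (repr A)^-1)%g))%R.
    move=> VA VB Cc; rewrite comp_lfunE lfunE /= !lrmulE !mul1mx -mulmxA -repr_mxM ?GS ?groupV ?Sr //.
    by rewrite conj_sumMl //; apply: commC.
  rewrite -mulnn -[(d * d)%N](dimvf 'M[F]_d).
  apply: (@geq_dim_independent _ _ _ _ m t) => [A _|A B c VA VB Cc neAB|A c VA Cc].
  - exact: subvf.
  - rewrite tm // {1}/conj_sum; under eq_bigr => w Sw.
      rewrite -!repr_mxM ?GS ?groupM ?groupV ?Sr //; over.
    rewrite sum_conj_noncentral ?mulmx0 //; apply/setDP.
    split; first by rewrite groupM ?groupV ?Sr.
    apply: contra neAB => ZBA; rewrite -(coset_reprK A) -(coset_reprK B).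
    apply/eqP/val_inj; rewrite /= !val_coset ?(subsetP nZS) ?Sr //.
    by apply/esym/rcoset_eqP/rcosetP; exists (repr B * (repr A)^-1); rewrite ?mulgKV.
  - rewrite tm // mulgV repr_mx1 conj_sum_comm_val => [|y _]; last by rewrite mulmx1 mul1mx.
    move/eqP; rewrite -scalemxAr mulmx1 scaler_eq0 (negPf nzS) => /eqP. exact.
have C_gt0: 0 < \dim C.
  rewrite lt0n; apply: contraTneq lowW => C0; move: highW; rewrite C0 muln0 leqn0 => /eqP->.
  by rewrite muln0 leqn0 expn_eq0 negb_and -lt0n d_gt0.
have leV: #|V| <= z.-1 * #|P|.
  rewrite -(leq_pmul2r C_gt0) (leq_trans indep) // (leq_trans lowW) //.
  by rewrite -mulnA leq_mul2l highW orbT.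
have V_gt0: 0 < #|V| by apply: cardG_gt0.
have:= leq_mul (leqnn z) leV; rewrite mulnCA => /leq_trans/(_ (leq_mul (leqnn _) card_P)).
move: (#|V|) (z) V_gt0 z_gt1 => [//|k] [//|y] _ _ /=.
exact: orbit_count_leq.
Qed.

End ExtraspecialBound.

(** * Split BN-pairs of rank one in characteristic two *)

(** These are the relations of [SL(2, q)], [q] even, with [U] the upper
    unipotent matrices, [H] the diagonal ones, [w] the antidiagonal matrix and [u]
    a transvection.  Regularity of [H] on [U^#] is expressed by the orders
    together with transitivity. *)
Record split_BN_pair (gT : finGroupType) (T U H : {group gT}) (w u : gT) : Prop :=
  SplitBNPair {
    bn_sUT : U \subset T;
    bn_sHT : H \subset T;
    bn_Tw : w \in T;
    bn_Uu : u \in U^#;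
    bn_nUH : H \subset 'N(U);
    bn_cycH : cyclic H;
    bn_oU : #|U| = #|H|.+1;
    bn_expU : {in U, forall y, y * y = 1};
    bn_w2 : w * w = 1;
    bn_invH : {in H, forall h, h ^ w = h^-1};
    bn_wE : w = u * u ^ w * u;
    bn_trans : {in U^#, forall y, exists2 h, h \in H & y = u ^ h};
    bn_bruhat : {in T, forall g, g \notin U * H ->
                   exists2 b, b \in U * H & exists2 y, y \in U & g = b * w * y};
    bn_TI : {in U, forall y, y ^ w \in U * H -> y = 1}
  }.

Section SplitBNPair.

Variables (gT : finGroupType) (T U H : {group gT}) (w u : gT).
Hypothesis bnT : split_BN_pair T U H w u.

Let sUT := bn_sUT bnT.
Let sHT := bn_sHT bnT.
Let Tw := bn_Tw bnT.
Let nUH := bn_nUH bnT.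
Let Uu : u \in U. Proof. by case/setD1P: (bn_Uu bnT). Qed.
Let ntu : u != 1. Proof. by case/setD1P: (bn_Uu bnT). Qed.
Let w2 := bn_w2 bnT.
Let u2 : u * u = 1. Proof. exact: bn_expU bnT _ Uu. Qed.

Lemma bn_wV : w^-1 = w.
Proof. by apply/eqP; rewrite eq_invg_mul w2. Qed.

Lemma bn_uV : u^-1 = u.
Proof. by apply/eqP; rewrite eq_invg_mul u2. Qed.

Lemma bn_uw : u ^ w = u * w * u.
Proof.
have ulK y : u * (u * y) = y by rewrite -{1}bn_uV mulKg.
have urK y : y * (u * u) = y by rewrite -{2}bn_uV mulgV mulg1.
by rewrite [in RHS](bn_wE bnT) -!mulgA ulK urK.
Qed.

Lemma bn_abelianU : abelian U.
Proof.
apply/centsP=> y Uy v Uv; have inv t : t \in U -> t^-1 = t.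
  by move=> Ut; apply/eqP; rewrite eq_invg_mul (bn_expU bnT).
by rewrite /commute -[LHS]inv ?groupM // invMg !inv.
Qed.

Lemma bn_w_conj : w = u ^ (w * u).
Proof. rewrite conjgM [RHS]conjgE bn_uV mulgA; exact: bn_wE bnT. Qed.

Lemma bn_conjUH : [set u ^ h | h in H] = U^#.
Proof.
apply/eqP; rewrite eqEsubset; apply/andP; split; apply/subsetP=> y.
  by case/imsetP=> h Hh ->; rewrite !inE conjg_eq1 ntu memJ_norm // (subsetP nUH).
by case/(bn_trans bnT)=> h Hh ->; apply: imset_f.
Qed.

Lemma bn_inj_conj : {in H &, injective (fun h => u ^ h)}.
Proof.
by apply/imset_injP; rewrite bn_conjUH -[#|H|]/(#|H|.+1.-1) -(bn_oU bnT) (cardsD1 1 U) group1.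
Qed.

Lemma bn_joing : U <*> H = U * H.
Proof. exact: norm_joinEr. Qed.

Lemma bn_w_notinB : w \notin U * H.
Proof.
rewrite -bn_joing; apply: contra ntu => Bw; apply/eqP/(bn_TI bnT Uu).
by rewrite -bn_joing groupJ // mem_gen // inE Uu.
Qed.

Lemma bn_tiUH : odd #|H| -> U :&: H = 1.
Proof.
move=> oddH; apply: coprime_TIg; rewrite coprime_sym coprime_has_primes ?cardG_gt0 //.
apply/hasPn=> p; rewrite !mem_primes !cardG_gt0 /= => /andP[p_pr pU].
have [y Uy oy] := Cauchy p_pr pU.
have: y ^+ 2 == 1 by rewrite expgS expg1 (bn_expU bnT).
rewrite -order_dvdn oy => /(prime_nt_dvdP (isT : prime 2)) p2.
rewrite p_pr /= p2 ?dvdn2 ?oddH //.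
by case: eqP p_pr => // ->.
Qed.

End SplitBNPair.

(** * Fixed vectors of nonsplit tori *)

(** Suppose that [x] has no fixed vector.  The sum of the
    involutions [w * y], for [y] in [<[x]>], is zero, so the sum of the conjugates
    of [u] vanishes ([sum_conj_u_eq0]).  This implies that [EU] is not zero
    ([sum_U_neq0]) and then, along the Bruhat decomposition, that [EB] is not
    zero ([EB_neq0]).  On the other hand [BN_fixed_vector] expands [EB] times the
    vanishing sum over [<[x]>] along the same decomposition, and finds that
    [EB = 0]. *)
Section FixedVectorBNPair.

Variables (gT : finGroupType) (T U H : {group gT}) (w u : gT).
Hypothesis bnT : split_BN_pair T U H w u.
Hypothesis oddH : odd #|H|.

Let sUT := bn_sUT bnT.
Let sHT := bn_sHT bnT.
Let Tw := bn_Tw bnT.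
Let nUH := bn_nUH bnT.
Let Uu : u \in U. Proof. by case/setD1P: (bn_Uu bnT). Qed.
Let Tu := subsetP sUT u Uu.
Variable B : {group gT}.
Hypothesis defB : U * H = B.
Let sBT : B \subset T. Proof. by rewrite -defB mul_subG. Qed.
Let tiUH := bn_tiUH bnT oddH.

Variables (F : fieldType) (d : nat) (rT : mx_representation F T d) (x : gT).
Hypotheses (pcharT : [pchar F]%R^'.-group T) (d_gt0 : 0 < d) (Tx : x \in T).
Hypotheses (odd_x : odd #[x]) (xw : x ^ w = x^-1) (tiXB : <[x]> :&: B = 1).
Hypothesis x_small : #[x] <= #|U|.

Let TU y (Uy : y \in U) : y \in T := subsetP sUT y Uy.
Let TH h (Hh : h \in H) : h \in T := subsetP sHT h Hh.
Let nUh h (Hh : h \in H) : h \in 'N(U) := subsetP nUH h Hh.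
Let X := <[x]>%G.
Let sXT : X \subset T. Proof. by rewrite cycle_subG. Qed.
Let natT (K : {group gT}) (sKT : K \subset T) := card_pcharf_neq0 sKT pcharT.
Let EU := (\sum_(y in U) rT y)%R.
Let EB := (\sum_(b in B) rT b)%R.

Lemma sum_B_prod (E : gT -> 'M[F]_d) :
  (\sum_(b in B) E b = \sum_(h in H) \sum_(y in U) E (y * h)%g)%R.
Proof.
have injUH: {in setX U H &, injective mulgm}.
  move=> [y1 h1] [y2 h2] /setXP[/= Uy1 Hh1] /setXP[/= Uy2 Hh2] eq12.
  have: y2^-1 * y1 \in U :&: H.
    rewrite inE groupM ?groupV //= (_ : _ * _ = h2 * h1^-1) ?groupM ?groupV //.
    by apply: (mulgI y2); apply: (mulIg h1); rewrite mulKVg mulgA mulgKV.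
  rewrite tiUH => /set1gP/(congr1 (mulg y2)); rewrite mulKVg mulg1 => eqy.
  by move: eq12; rewrite /= eqy => /mulgI->.
rewrite -defB -imset_mulgm big_imset //= exchange_big pair_big_dep /=.
by apply: eq_big => [p|[y h]//]; rewrite inE.
Qed.

Lemma EB_E : (EB = EU *m (\sum_(h in H) rT h))%R.
Proof.
rewrite /EB sum_B_prod mulmx_sumr; apply: eq_bigr => h Hh; rewrite /EU.
rewrite mulmx_suml; apply: eq_bigr => y Uy.
by rewrite (repr_mxM _ (TU Uy) (TH Hh)).
Qed.

Lemma EU_commH h : h \in H -> (EU *m rT h = rT h *m EU)%R.
Proof.
move=> Hh; rewrite mulmx_suml mulmx_sumr [LHS](reindex_inj (conjg_inj h^-1)) /=.
apply: eq_big => y; first by rewrite memJ_norm ?groupV ?nUh.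
rewrite memJ_norm ?groupV ?nUh // => Uy; have [Ty Th] := (TU Uy, TH Hh).
by rewrite -!repr_mxM ?groupJ ?groupV // conjgE invgK mulgA mulgKV.
Qed.

(** The conjugates of [w] by the powers of [x] are the elements of the coset
    [w * <[x]>], because squaring is bijective on [<[x]>]. *)
Lemma sum_conj_w_eq0 : ~~ eigenvalue (rT x) 1%R -> (\sum_(g in T) rT (w ^ g)%g = 0)%R.
Proof.
move=> nofix; have invX y : y \in X -> y ^ w = y^-1.
  by case/cycleP=> i ->; rewrite conjXg xw expgVn.
have sumwX: (\sum_(y in X) rT (w ^ y)%g = 0)%R.
  transitivity (rT w *m \sum_(y in X) rT y)%R; last by rewrite sum_cycle_repr_eq0 ?mulmx0.
  have sqX: [set y ^+ 2 | y in X] = X.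
    apply/eqP; rewrite eqEcard card_in_imset ?leqnn ?andbT.
      by apply/subsetP=> _ /imsetP[y Xy ->]; rewrite groupX.
    move=> y1 y2 Xy1 Xy2 /= eq12.
    have co2: coprime #|X| 2 by rewrite coprimen2 -orderE.
    by rewrite -(expgK co2 Xy1) eq12 (expgK co2 Xy2).
  rewrite mulmx_sumr -[in RHS]sqX big_imset /= => [|y1 y2 Xy1 Xy2 eq12]; last first.
    have co2: coprime #|X| 2 by rewrite coprimen2 -orderE.
    by rewrite -(expgK co2 Xy1) eq12 (expgK co2 Xy2).
  apply: eq_bigr => y Xy; have Ty := subsetP sXT y Xy.
  rewrite -repr_mxM ?groupX //; congr (rT _); rewrite expgS expg1.
  by rewrite [LHS]conjgE mulgA (conjgC y^-1 w) conjVg invX // invgK mulgA.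
have /eqP: (#|X|%:R *: (\sum_(g in T) rT (w ^ g)%g) = 0)%R.
  rewrite scaler_nat -sumr_const.
  rewrite (eq_bigr (fun y => \sum_(g in T) rT (w ^ (y * g))%g)%R) => [|y Xy].
    rewrite exchange_big big1 //= => g Tg.
    transitivity (rT g^-1%g *m (\sum_(y in X) rT (w ^ y)%g) *m rT g)%R.
      rewrite mulmx_sumr mulmx_suml; apply: eq_bigr => y Xy; have Ty := subsetP sXT y Xy.
      by rewrite -!repr_mxM ?groupM ?groupV ?groupJ // conjgM conjgE mulgA.
    by rewrite sumwX mulmx0 mul0mx.
  have Ty := subsetP sXT y Xy; rewrite [LHS](reindex_inj (mulgI y)) /=.
  by apply: eq_bigl => g; rewrite groupMl.
by rewrite scaler_eq0 (negPf (natT sXT)) => /eqP.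
Qed.

Lemma sum_conj_u_eq0 : ~~ eigenvalue (rT x) 1%R -> (\sum_(g in T) rT (u ^ g)%g = 0)%R.
Proof.
move=> nofix; transitivity (\sum_(g in T) rT (w ^ g)%g)%R; last exact: sum_conj_w_eq0.
rewrite (reindex_inj (mulgI (w * u))) /=; apply: eq_big => g.
  by rewrite groupMl ?groupM.
by move=> Tg; rewrite conjgM -(bn_w_conj bnT).
Qed.

(** If [EU = 0] then the sum of the elements of [U^#], which are the conjugates of
    [u] by [H], is [-1]; averaging over [T] gives [-|T|] instead of [0]. *)
Lemma sum_U_neq0 : (\sum_(g in T) rT (u ^ g)%g = 0)%R -> EU != 0%R.
Proof.
move=> I0; apply/eqP=> EU0.
have sumH: (\sum_(h in H) rT (u ^ h)%g = - 1%:M)%R.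
  rewrite -(big_imset (h := fun h => u ^ h)) /=; last exact: bn_inj_conj bnT.
  rewrite (bn_conjUH bnT); apply/eqP; rewrite -addr_eq0 addrC -(repr_mx1 rT).
  by rewrite -big_setD1 // -/EU EU0.
have: (\sum_(h in H) \sum_(g in T) rT (u ^ (h * g))%g = 0)%R.
  apply: big1 => h Hh; have Th := TH Hh.
  rewrite -[RHS]I0 [RHS](reindex_inj (mulgI h)) /=.
  by apply: eq_bigl => g; rewrite groupMl.
rewrite exchange_big (eq_bigr (fun=> - 1%:M)%R) /= => [|g Tg].
  rewrite sumr_const => /eqP; rewrite -scaler_nat scaler_eq0 (negPf (natT (subxx T))) oppr_eq0.
  by rewrite -mxrank_eq0 mxrank1 -leqn0 leqNgt d_gt0.
transitivity (rT g^-1%g *m (\sum_(h in H) rT (u ^ h)%g) *m rT g)%R.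
  rewrite mulmx_sumr mulmx_suml; apply: eq_bigr => h Hh; have Th := TH Hh.
  by rewrite -!repr_mxM ?groupM ?groupV ?groupJ // conjgM conjgE mulgA.
by rewrite sumH mulmxN mulNmx mulmx1 -repr_mxM ?groupV // mulVg repr_mx1.
Qed.

Let EUU : (EU *m EU = #|U|%:R *: EU)%R.
Proof.
rewrite {2}/EU mulmx_sumr scaler_nat -sumr_const.
by apply: eq_bigr => y Uy; rewrite sum_reprMr.
Qed.

Let sUB : U \subset B. Proof. by rewrite -defB mulG_subl. Qed.
Let sHB : H \subset B. Proof. by rewrite -defB mulG_subr. Qed.

Lemma sum_big_cell (E : gT -> 'M[F]_d) :
  (\sum_(g in T :\: B) E g = \sum_(b in B) \sum_(y in U) E (b * w * y)%g)%R.
Proof.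
rewrite pair_big_dep /= (eq_bigl (fun p => p \in setX B U)) => [|p]; last by rewrite !inE.
pose cell (p : gT * gT) := p.1 * w * p.2.
have inj_cell: {in setX B U &, injective cell}.
  move=> [b1 y1] [b2 y2] /setXP[/= Bb1 Uy1] /setXP[/= Bb2 Uy2]; rewrite /cell /= => eq12.
  have: (y1 * y2^-1) ^ w \in B.
    have := congr1 (fun g => b1^-1 * (g * y2^-1 * w^-1)) eq12.
    rewrite /= !mulgK => eqB; have ->: (y1 * y2^-1) ^ w = b1^-1 * b2.
      by rewrite -[w in LHS](bn_wV bnT) conjgE invgK -eqB -!mulgA mulKg.
    by rewrite groupM ?groupV.
  rewrite -defB => /(bn_TI bnT (groupM Uy1 (groupVr Uy2)))/eqP; rewrite -eq_mulgV1 => /eqP eqy.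
  by move: eq12; rewrite eqy => /mulIg/mulIg->.
rewrite -(big_imset (h := cell)) //=; apply: eq_bigl => g.
apply/setDP/imsetP=> [[Tg]|].
  rewrite -defB => /(bn_bruhat bnT Tg)[b Bb [y Uy ->]].
  by exists (b, y); rewrite ?inE -?defB ?Bb.
case=> [[b y] /setXP[/= Bb Uy] ->].
have Tb := subsetP sBT b Bb; have Ty := TU Uy; rewrite /cell /=; split; first by rewrite !groupM.
by rewrite (groupMr _ (subsetP sUB y Uy)) groupMl // -defB (bn_w_notinB bnT).
Qed.

(** Multiply the vanishing sum by [EU].  The elements of [B] contribute
    [|B| EU], and the big cell contributes a multiple of the sum of the
    [EU (u ^ h) ^ w EU], for [h] in [H].  The latter is [EB w EU], as
    [u ^ w = u * w * u] turns its terms into [h ^+ 2 EU w EU]; it vanishes with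
    [EB], and then so does [EU]. *)
Lemma EB_neq0 : (\sum_(g in T) rT (u ^ g)%g = 0)%R -> EU != 0%R -> EB != 0%R.
Proof.
move=> I0 nzEU; apply: contraNneq nzEU => EB0.
have fixEU b : b \in B -> (EU *m rT (u ^ b)%g = EU)%R.
  rewrite -defB => /mulsgP[y h Uy Hh ->]; rewrite sum_reprMr // conjgM memJ_norm ?nUh //.
  exact: groupJ.
pose Q := (EU *m rT w *m EU)%R.
have cellE h : h \in H -> (EU *m rT ((u ^ h) ^ w)%g *m EU = rT (h ^+ 2)%g *m Q)%R.
  move=> Hh; have Th := TH Hh; have cEh := EU_commH Hh.
  have ->: (u ^ h) ^ w = h * (u * w * u) * h^-1.
    by rewrite conjJg (bn_invH bnT Hh) (bn_uw bnT) conjgE invgK mulgA.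
  have fixr: (rT u *m EU = EU)%R by rewrite sum_reprMl.
  have wh: (rT w *m rT h^-1%g = rT h *m rT w)%R.
    rewrite -!repr_mxM ?groupV // -(bn_invH bnT Hh) conjgE (bn_wV bnT) !mulgA.
    by rewrite -{1}(bn_wV bnT) mulVg mul1g.
  rewrite !repr_mxM ?groupM ?groupV // !mulmxA cEh -(mulmxA _ EU (rT u)) sum_reprMr //.
  rewrite -(mulmxA _ _ EU) -(EU_commH (groupVr Hh)) !mulmxA -(mulmxA _ (rT u) EU) fixr.
  rewrite -(mulmxA _ EU (rT _)) (EU_commH (groupVr Hh)) mulmxA -(mulmxA _ (rT w)) wh.
  by rewrite /Q !mulmxA -(mulmxA _ EU (rT h)) cEh !mulmxA.
have sumBh (E : gT -> 'M[F]_d) :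
    (\sum_(b in B) E (u ^ b)%g = #|U|%:R *: \sum_(h in H) E (u ^ h)%g)%R.
  rewrite sum_B_prod scaler_sumr; apply: eq_bigr => h Hh; rewrite scaler_nat -sumr_const.
  apply: eq_bigr => y Uy; rewrite conjgM; congr (E (_ ^ h)).
  apply/conjg_fixP/commgP; exact: (centsP (bn_abelianU bnT)).
have: (EU *m (\sum_(g in T) rT (u ^ g)%g) = 0)%R by rewrite I0 mulmx0.
rewrite mulmx_sumr (big_setID B) /= (setIidPr sBT) sum_big_cell.
rewrite (eq_bigr (fun=> EU)) // sumr_const (eq_bigr (fun b => EU *m rT ((u ^ b) ^ w)%g *m EU)%R).
  rewrite (sumBh (fun c => EU *m rT (c ^ w)%g *m EU)%R).
  have ->: (\sum_(h in H) EU *m rT ((u ^ h) ^ w)%g *m EU = 0)%R.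
    rewrite (eq_bigr _ cellE) -mulmx_suml.
    have co2: coprime #|H| 2 by rewrite coprimen2.
    have inj2: {in H &, injective (fun h => h ^+ 2)}.
      by move=> h1 h2 Hh1 Hh2 /= eq12; rewrite -(expgK co2 Hh1) eq12 (expgK co2 Hh2).
    have sqH: [set h ^+ 2 | h in H] = H.
      apply/eqP; rewrite eqEcard card_in_imset // leqnn andbT.
      by apply/subsetP=> _ /imsetP[h Hh ->]; rewrite groupX.
    rewrite -(big_imset (fun h => rT h) inj2) sqH /Q !mulmxA.
    have <-: (EU *m \sum_(h in H) rT h = (\sum_(h in H) rT h) *m EU)%R.
      by rewrite mulmx_sumr mulmx_suml; apply: eq_bigr => h /EU_commH.
    by rewrite -EB_E EB0 !mul0mx.
  rewrite scaler0 addr0 => /eqP; rewrite -scaler_nat scaler_eq0 (negPf (natT sBT)) => /eqP //.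
move=> b Bb; have Tb := subsetP sBT b Bb.
rewrite [RHS]mulmx_sumr; apply: eq_bigr => y Uy; have Ty := TU Uy.
rewrite 2!conjgM (conjgE _ y) -mulgA !repr_mxM ?groupM ?groupV ?groupJ //.
by rewrite !mulmxA sum_reprMr ?groupV.
Qed.

(** If all the cosets [<[x]> * (v * w)], for [v] in [U], met [B], then choosing an
    element [y] with [y * (v * w)] in [B] would embed [U] in [<[x]>^#]. *)
Lemma torus_coset_disjoint : exists2 g, g \in T & forall y, y \in X -> y * g \notin B.
Proof.
case: (pickP [pred g in T | [forall y in X, y * g \notin B]]) => [g /andP[Tg /forall_inP]|noG].
  by exists g.
have {noG} noG v : v \in U -> exists y, (y \in X) && (y * (v * w) \in B).
  move=> Uv; have := noG (v * w); rewrite /= (groupM (TU Uv) Tw) /= => /negbT/forall_inPn[y Xy].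
  by rewrite negbK => By; exists y; rewrite Xy.
pose c v := odflt 1 [pick y in X | y * (v * w) \in B].
have cP v : v \in U -> c v \in X /\ c v * (v * w) \in B.
  move=> Uv; rewrite /c; case: pickP => [y /andP[]//|no] /=.
  by have [y Py] := noG v Uv; have := no y; rewrite /= Py.
have inj_c: {in U &, injective c}.
  move=> v1 v2 Uv1 Uv2 eq_c; have [[_ B1] [_ B2]] := (cP _ Uv1, cP _ Uv2).
  have: (v1^-1 * v2) ^ w \in U * H.
    have := groupM (groupVr B1) B2; rewrite eq_c defB invMg -mulgA mulKg.
    by rewrite invMg conjgE !mulgA.
  move/(bn_TI bnT (groupM (groupVr Uv1) Uv2))/eqP.
  by rewrite -eq_invg_mul invgK => /eqP.
have: #|c @: U| < #|X|.
  rewrite (cardsD1 1 X) group1 ltnS subset_leq_card //; apply/subsetP=> _ /imsetP[v Uv ->].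
  have [Xc Bc] := cP v Uv; rewrite !inE Xc andbT; apply: contraTneq Bc => ->.
  by rewrite mul1g (groupMl _ (subsetP sUB v Uv)) -defB (bn_w_notinB bnT).
by rewrite card_in_imset // ltnNge [#|X|]/(#[x]) x_small.
Qed.

(** By the Bruhat decomposition [EB * g * EU] has the same value [Q] for all [g]
    outside [B].  A coset of [<[x]>] disjoint from [B] shows that [Q = 0], and
    [<[x]>] itself, which meets [B] in [1], shows that [EB * EU], a nonzero
    multiple of [EB], vanishes. *)
Theorem BN_fixed_vector : eigenvalue (rT x) 1%R.
Proof.
apply: contraT => nofix; have I0 := sum_conj_u_eq0 nofix.
have /eqP[] := EB_neq0 I0 (sum_U_neq0 I0); pose Q := (EB *m rT w *m EU)%R.
have sumX: (\sum_(y in X) rT y = 0)%R by apply: sum_cycle_repr_eq0.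
have cell g : g \in T -> g \notin B -> (EB *m rT g *m EU = Q)%R.
  rewrite -{1}defB => Tg /(bn_bruhat bnT Tg)[b]; rewrite defB => Bb [y Uy ->].
  have [Tb Ty] := (subsetP sBT b Bb, TU Uy).
  by rewrite !repr_mxM ?groupM // !mulmxA sum_reprMr // -(mulmxA _ (rT y)) sum_reprMl.
have Q0: (Q = 0)%R.
  have [g Tg nBg] := torus_coset_disjoint.
  have sumXg: (\sum_(y in X) rT (y * g)%g = 0)%R.
    transitivity ((\sum_(y in X) rT y) *m rT g)%R; last by rewrite sumX mul0mx.
    rewrite mulmx_suml; apply: eq_bigr => y Xy.
    by rewrite repr_mxM // (subsetP sXT).
  have: (\sum_(y in X) EB *m rT (y * g)%g *m EU = 0)%R.
    by rewrite -mulmx_suml -mulmx_sumr sumXg mulmx0 mul0mx.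
  rewrite (eq_bigr (fun=> Q)) => [|y Xy]; last first.
    by have Ty := subsetP sXT y Xy; exact: cell (groupM Ty Tg) (nBg y Xy).
  rewrite sumr_const => /eqP; rewrite -scaler_nat scaler_eq0 => /orP[n0|/eqP//].
  by have /negP[] := natT sXT.
have: (\sum_(y in X) EB *m rT y *m EU = 0)%R.
  by rewrite -mulmx_suml -mulmx_sumr sumX mulmx0 mul0mx.
rewrite (big_setD1 1) //= repr_mx1 mulmx1 big1 => [|y].
  rewrite addr0 => /eqP; have EBu y : y \in U -> (EB *m rT y = EB)%R.
    by move=> Uy; rewrite sum_reprMr // (subsetP sUB).
  rewrite mulmx_sumr (eq_bigr _ EBu) sumr_const -scaler_nat scaler_eq0.
  by rewrite (negPf (natT sUT)) => /eqP.
case/setD1P=> nty Xy; have Ty := subsetP sXT y Xy; rewrite cell //.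
apply: contra nty => By; rewrite -in_set1 -[[set 1]]tiXB.
by rewrite inE By andbT.
Qed.

End FixedVectorBNPair.

(** * Groups that behave like SL(2, 2 ^ f) *)

(** The order of [k] modulo [p] divides [gcdn a b = 1]. *)
Lemma dvdn_pred_exp_coprime p k a b : 0 < k -> 0 < a -> coprime a b ->
  p %| k ^ a - 1 -> p %| k ^ b - 1 -> p %| k - 1.
Proof.
move=> k_gt0 a_gt0 /(coprimeP _ a_gt0)[[c e] /= ce1] pa pb.
have exp1 i m : p %| k ^ i - 1 -> k ^ (m * i) = 1 %[mod p].
  rewrite -eqn_mod_dvd ?expn_gt0 ?k_gt0 // => /eqP eq1.
  by rewrite mulnC expnM -modnXm eq1 modnXm exp1n.
have def_ca: (c * a = (e * b).+1)%N by rewrite -add1n -ce1 subnK // ltnW // -subn_gt0 ce1.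
have := exp1 a c pa; rewrite def_ca expnS -modnMmr exp1 // modnMmr muln1 => /eqP.
by rewrite eqn_mod_dvd.
Qed.

(** The properties of [SL(2, 2 ^ f)], [f >= 5] prime, on which the representation
    theoretic argument rests.  The element [x] of [sl_torus] lies in a nonsplit
    torus. *)
Record sl2_like (tT : finGroupType) (T U H : {group tT}) (w u : tT) (f : nat) : Prop :=
  SL2Like {
    sl_bn : split_BN_pair T U H w u;
    sl_simple : simple T;
    sl_f_prime : prime f;
    sl_f_ge5 : 4 < f;
    sl_oU : #|U| = (2 ^ f)%N;
    sl_pi : forall z, z \in \pi(T) -> [\/ z = 2, z %| 2 ^ f - 1 | z %| 2 ^ f + 1]%N;
    sl_torus : forall z, prime z -> z %| (2 ^ f + 1)%N ->
      exists x, [/\ x \in T, #[x] = z, x ^ w = x^-1 & <[x]> :&: (U * H) = 1];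
    sl_prod3 : forall h, h \in H^# -> exists x1, exists x2,
      [/\ x1 \in T, x2 \in T, #[x1] = 3, #[x2] = 3 & h = x1 * x2]
  }.

Section SL2Like.

Variables (tT : finGroupType) (T U H : {group tT}) (w u : tT) (f : nat).
Hypothesis slT : sl2_like T U H w u f.

Let bnT := sl_bn slT.

Lemma sl_oH : #|H| = (2 ^ f - 1)%N.
Proof. by have := bn_oU bnT; rewrite (sl_oU slT) subn1 => ->. Qed.

Lemma sl_f_odd : odd f.
Proof.
case: (even_prime (sl_f_prime slT)) => // f2.
by have := sl_f_ge5 slT; rewrite f2.
Qed.

Lemma sl_oddH : odd #|H|.
Proof. by rewrite sl_oH oddB ?expn_gt0 // oddX /= orbF addbT; case: f (sl_f_ge5 slT). Qed.

Lemma sl_2group_U : 2.-group U.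
Proof. by rewrite /pgroup (sl_oU slT) pnatX. Qed.

(** [H] is regular on [U^#]. *)
Lemma sl_CU h : h \in H^# -> 'C_U[h] = 1.
Proof.
case/setD1P=> nth Hh; apply/trivgP/subsetP=> y /setIP[Uy /cent1P chy].
apply: contraR nth; rewrite inE => nty.
have [|k Hk def_y] := bn_trans bnT (_ : y \in U^#); first by rewrite !inE nty.
have: u ^ k = u ^ (k * h).
  by rewrite conjgM -def_y; apply/esym/conjg_fixP/commgP.
move/(bn_inj_conj bnT Hk (groupM Hk Hh))/eqP; rewrite -[X in X == _]mulg1.
by rewrite (inj_eq (mulgI k)) eq_sym.
Qed.

Lemma sl_nonabelian : ~~ abelian T.
Proof.
apply/negP=> cTT; have /(bn_TI bnT) : u \in U by case/setD1P: (bn_Uu bnT).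
have Tu: u \in T by apply: subsetP (bn_sUT bnT) u _; case/setD1P: (bn_Uu bnT).
have -> : u ^ w = u by apply/conjg_fixP/commgP; apply: (centsP cTT) => //; apply: bn_Tw bnT.
rewrite -[u in u \in _]mulg1 mem_mulg //; last by case/setD1P: (bn_Uu bnT).
by move=> /(_ isT) u1; have := bn_Uu bnT; rewrite u1 !inE eqxx.
Qed.

(** The order of [2] modulo [p] is the prime [f], so an element of order [p] acts
    trivially on groups of order smaller than [2 ^ f]. *)
Lemma sl_small_2power p j : prime p -> p %| (2 ^ f - 1)%N -> j < f -> p %| (2 ^ j - 1)%N -> j = 0%N.
Proof.
move=> p_pr pf lt_jf pj; apply/eqP; rewrite eqn0Ngt; apply/negP=> j_gt0.
have co_jf: coprime j f by rewrite coprime_sym prime_coprime ?(sl_f_prime slT) // gtnNdvd.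
by have := dvdn_pred_exp_coprime (isT : 0 < 2) j_gt0 co_jf pj pf; rewrite dvdn1 => /eqP p1; have := p_pr; rewrite p1.
Qed.

Lemma sl_dvd3 : 3 %| (2 ^ f + 1)%N.
Proof.
rewrite -(odd_double_half f) sl_f_odd add1n expnS -mul2n expnM /dvdn.
by rewrite -modnDml -modnMmr -modnXm exp1n.
Qed.

(** Modulo [z] the order of [4] divides both [m] and the prime [f].  If [f] does
    not divide [m] this order is [1], and [z = 3]; otherwise [2 ^ f + 1 <= z],
    so [z] equals [2 ^ f + 1], which is a multiple of [3]. *)
Lemma sl_Fermat_prime m z : 0 < m -> prime z -> odd z -> z = (2 ^ m + 1)%N ->
  z %| (2 ^ f - 1)%N \/ z %| (2 ^ f + 1)%N -> z = 3 /\ m = 1%N.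
Proof.
move=> m_gt0 pr_z odd_z def_z dvz.
have dvz4 a : z %| (2 ^ a - 1)%N \/ z %| (2 ^ a + 1)%N -> z %| (4 ^ a - 1)%N.
  have ->: (4 ^ a - 1 = (2 ^ a - 1) * (2 ^ a + 1))%N.
    by rewrite -subn_sqr exp1n -expnM mulnC expnM.
  by case=> ?; [apply: dvdn_mulr | apply: dvdn_mull].
have z4m: z %| (4 ^ m - 1)%N by apply: dvz4; right; rewrite def_z.
have f_pr := sl_f_prime slT; have f_ge5 := sl_f_ge5 slT.
suffices z3: z = 3.
  split=> //; apply/eqP; rewrite eqn_leq m_gt0 andbT -(leq_exp2l _ _ (ltnSn 1)).
  by rewrite -(leq_add2r 1) -def_z z3.
have [co_mf | ] := boolP (coprime m f).
  have := dvdn_pred_exp_coprime (isT : 0 < 4) m_gt0 co_mf z4m (dvz4 f dvz).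
  by move/(prime_nt_dvdP (isT : prime 3)); apply; rewrite neq_ltn prime_gt1 ?orbT.
rewrite coprime_sym prime_coprime // negbK => /(dvdn_leq m_gt0) le_fm.
have le_z: 2 ^ f + 1 <= z by rewrite def_z leq_add2r leq_exp2l.
case: dvz => dvz.
  have := dvdn_leq _ dvz; rewrite subn_gt0 (ltn_exp2l 0) ?prime_gt0 // => /(_ isT).
  move/(leq_trans le_z); by rewrite leqNgt => /negP[]; rewrite addn1 ltnS leq_subr.
have def_z': z = (2 ^ f + 1)%N.
  by apply/eqP; rewrite eqn_leq le_z andbT dvdn_leq // addn1.
have dv3z: 3 %| z by rewrite def_z' sl_dvd3.
by have /(prime_nt_dvdP pr_z) -> := dv3z.
Qed.

End SL2Like.

(** * Minimal extensions without fixed vectors: Sylow subgroups of the kernel *)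

(** All of this part is a proof by contradiction, which ends with
    [minimal_extension_absurd]. *)
Section MinimalExtension.

Variables (tT : finGroupType) (T U H : {group tT}) (w u : tT) (f : nat).
Hypothesis slT : sl2_like T U H w u f.

Variables (gT : finGroupType) (L : {group gT}) (phi : {morphism L >-> tT}).
Hypothesis phiL : phi @* L = T.
Hypothesis minL : forall M : {group gT}, M \subset L -> phi @* M = T -> M :=: L.

Variables (F : closedFieldType) (d : nat) (rL : mx_representation F L d).
Hypotheses (pcharL : [pchar F]%R^'.-group L) (irrL : mx_irreducible rL).
Hypothesis faithL : mx_faithful rL.

Variable z : nat.
Hypotheses (pr_z : prime z) (zT : z \in \pi(T)).
Hypothesis nofix : forall x, x \in L -> #[x] = z -> ~~ eigenvalue (rL x) 1%R.

Let bnT := sl_bn slT.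
Let K := ('ker phi)%G.
Let d_gt0 : 0 < d. Proof. by case/mx_irrP: irrL. Qed.
Let sKL : K \subset L := subsetIl _ _.
Let nsKL : K <| L := ker_normal phi.

(** [T] is simple and no proper subgroup of [L] maps onto it. *)
Lemma min_normal_dichotomy (N : {group gT}) : N <| L -> N \subset K \/ N :=: L.
Proof.
move=> nsNL; have sNL := normal_sub nsNL.
have nsN: phi @* N <| T by rewrite -phiL morphim_normal.
have [_ simT] := simpleP _ (sl_simple slT).
have [N1 | NT] := simT _ nsN; last by right; apply: minL.
by left; rewrite /= kerE -sub_morphim_pre // N1.
Qed.

Lemma min_centralizes (A : {group gT}) x : A <| L -> x \in L -> x \notin K ->
  x \in 'C(A) -> A \subset 'Z(L).
Proof.
move=> nsAL Lx K'x cAx; have [sAL nAL] := andP nsAL.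
have nsC: 'C_L(A) <| L by rewrite -{2}(setIidPl nAL) subcent_normal.
have [sCK | defC] := min_normal_dichotomy nsC.
  by case/negP: K'x; rewrite (subsetP sCK) // inE Lx.
by rewrite subsetI sAL centsC; apply/setIidPl.
Qed.

Lemma morphim_Sylow_preim (p : nat) (A : {group tT}) (S : {group gT}) :
  A \subset T -> p.-group A -> p.-Sylow(phi @*^-1 A) S -> phi @* S = A.
Proof.
move=> sAT pA sylS; have sSA := pHall_sub sylS.
have phiA: phi @* (phi @*^-1 A) = A by rewrite morphpreK // phiL.
have sylA: p.-Sylow(A) (phi @* S).
  by rewrite -[X in pHall _ X]phiA morphim_pHall ?(subset_trans sSA) ?subsetIl.
have := sylA; rewrite pHallE => /andP[sSA' /eqP oS]; apply/eqP.
by rewrite eqEcard sSA' oS part_pnat_id ?leqnn.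
Qed.

(** If [z = 2] then every involution acts as [-1], so there is only one, and a
    Sylow [2]-subgroup of the preimage of [U] is cyclic or quaternion.  Its image
    [U] is then a product of two cyclic groups of exponent [2], but has order
    [2 ^ f > 4]. *)
Lemma prime_odd : odd z.
Proof.
have [z2 | //] := even_prime pr_z; exfalso.
have invol t : t \in L -> #[t] = 2 -> rL t = (- 1%:M)%R.
  move=> Lt ot; have nt1: 1 \notin [set t] by rewrite inE eq_sym -order_gt1 ot.
  have nofixt: ~~ eigenvalue (rL t) 1%R by apply: nofix; rewrite ?z2.
  have /eqP := sum_cycle_repr_eq0 Lt nofixt.
  by rewrite (cycle2g ot) (big_setU1 _ nt1) big_set1 /= repr_mx1 addrC addr_eq0 => /eqP.
have [S sylS] := Sylow_exists 2 (phi @*^-1 U).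
have sSU := pHall_sub sylS; have sSL: S \subset L := subset_trans sSU (subsetIl _ _).
have s2: 2.-group S := pHall_pgroup sylS.
have phiS: phi @* S = U := morphim_Sylow_preim (bn_sUT bnT) (sl_2group_U slT) sylS.
have ntS: S :!=: 1.
  apply: contra_eqN phiS => /eqP->; rewrite morphim1 eq_sym -cardG_gt1 (sl_oU slT).
  by rewrite (@ltn_exp2l 2 0) // prime_gt0 // (sl_f_prime slT).
have oS1: #|'Ohm_1(S)| = 2.
  have [_ dv2 _] := pgroup_pdiv s2 ntS; have [t St ot] := Cauchy (isT : prime 2) dv2.
  have Lt := subsetP sSL t St.
  suffices ->: 'Ohm_1(S) = <[t]> by rewrite -orderE.
  apply/eqP; rewrite eqEsubset cycle_subG (OhmE 1 s2) expn1 gen_subG mem_gen ?andbT; last first.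
    by rewrite !inE St; have := expg_order t; rewrite ot => ->; rewrite eqxx.
  apply/subsetP=> v /LdivP[Sv v2]; have Lv := subsetP sSL v Sv.
  have [-> | ntv] := eqVneq v 1; first exact: group1.
  have ov: #[v] = 2 by apply: nt_prime_order.
  by rewrite (mx_faithful_inj faithL Lv Lt) ?cycle_id // !invol.
have cyc2 (C : {group gT}) : C \subset S -> cyclic C -> #|phi @* C| <= 2.
  move=> sCS /cyclicP[c defC]; have Sc: c \in S by rewrite -cycle_subG -defC.
  have Lc := subsetP sSL c Sc; rewrite defC morphim_cycle // -orderE dvdn_leq //.
  rewrite order_dvdn expgS expg1 (bn_expU bnT) // -phiS; exact: mem_morphim.
have leU: #|U| <= 4.
  case/(prime_Ohm1P s2 ntS)/orP: oS1 => [cycS | /andP[_ /eqP/quaternion_classP[n n_gt2 isoS]]].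
    by rewrite -phiS (leq_trans (cyc2 S _ _)).
  have [[a b] genS _] := generators_quaternion n_gt2 isoS.
  have [_ _ _ defS _] := extremal_generators_facts (isT : prime 2) genS.
  have [_ Sa _ /setDP[Sb _]] := genS; have sab: (<[a]> \subset S) * (<[b]> \subset S) by rewrite !cycle_subG.
  rewrite -phiS -defS morphimMl ?(subset_trans _ sSL) ?sab //.
  have := mul_cardG (phi @* <[a]>)%G (phi @* <[b]>)%G => /= eq_card.
  apply: (@leq_trans (#|phi @* <[a]>| * #|phi @* <[b]>|)).
    by rewrite eq_card leq_pmulr ?cardG_gt0.
  by rewrite (@leq_mul _ _ 2 2) ?cyc2 ?sab ?cycle_cyclic.
by move: leU; rewrite (sl_oU slT) (leq_exp2l f 2) // leqNgt (ltn_trans _ (sl_f_ge5 slT)).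
Qed.

Lemma zgroup_cyclic (P : {group gT}) : P \subset L -> z.-group P -> cyclic P.
Proof.
move=> sPL zP; rewrite (odd_pgroup_rank1_cyclic zP); last first.
  by rewrite (odd_pgroup_odd _ zP) // prime_odd.
rewrite leqNgt; apply/negP=> /p_rank_geP[E /pnElemP[sEP abelE dimE]].
have sEL := subset_trans sEP sPL.
have: ~~ cyclic E by rewrite (abelem_cyclic abelE) dimE.
case/(abelian_noncyclic_fixed rL d_gt0 sEL (abelem_abelian abelE))/exists_inP=> x /setD1P[ntx Ex].
by apply/negP/nofix; rewrite ?(subsetP sEL) // (abelem_order_p abelE).
Qed.

(** By the Frattini argument the normalizer of [R] maps onto [T]. *)
Lemma Sylow_ker_normal p (R : {group gT}) : p.-Sylow(K) R -> R <| L.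
Proof.
move=> sylR; have sRL := subset_trans (pHall_sub sylR) sKL.
suffices <-: 'N_L(R) = L by rewrite normalSG.
apply: minL; first exact: subsetIl.
transitivity (phi @* (K * 'N_L(R))); last by rewrite (Frattini_arg nsKL sylR).
by rewrite morphimMl // morphim_ker mul1g.
Qed.

Lemma exists_inverted : exists x, [/\ x \in T, #[x] = z & x ^ w = x^-1].
Proof.
case: (sl_pi slT zT) => [z2|z_dvd|z_dvd].
- by have := prime_odd; rewrite z2.
- have [|x Hx ox] := @Cauchy _ z H pr_z; first by rewrite (sl_oH slT).
  by exists x; rewrite (subsetP (bn_sHT bnT)) // (bn_invH bnT).
by have [x [Tx ox xw _]] := sl_torus slT pr_z z_dvd; exists x.
Qed.

(** A Sylow [z]-subgroup [S0] of [K] is cyclic and normal in [L].  It is central,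
    as [L / C_L(S0)] is abelian and [T] is not.  Some element [x] of order [z] of
    [T] is inverted by an involution; a Sylow [z]-subgroup [S2] of the preimage of
    [<[x]>] is cyclic, contains [S0], and is normalized by an element [g] that
    induces the inversion on its quotient of order [z].  So [g] raises the
    elements of [S2] to a power [m] with [m = -1] modulo [z]; as [z] is odd, it
    does not centralize [S0]. *)
Lemma ker_z' : z^'.-group K.
Proof.
rewrite -[_.-group _]negbK; apply/negP=> z_K; have [S0 sylS0] := Sylow_exists z K.
have nsS0 := Sylow_ker_normal sylS0; have [sS0L nS0L] := andP nsS0.
have zS0 := pHall_pgroup sylS0.
have ntS0: S0 :!=: 1.
  by apply: contraNneq z_K => S01; rewrite -partG_eq1 -(card_Hall sylS0) S01 cards1.
have cycS0 := zgroup_cyclic sS0L zS0.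
have cS0L: L \subset 'C(S0).
  have nsC: 'C_L(S0) <| L by rewrite -{2}(setIidPl nS0L) subcent_normal.
  have [sCK | defC] := min_normal_dichotomy nsC; last exact/setIidPl.
  case/negP: (sl_nonabelian slT); rewrite -phiL.
  have sL'C: L^`(1) \subset 'C(S0).
    have sDN: L^`(1) \subset 'N(S0) := subset_trans (der_sub 1 L) nS0L.
    have autD1: conj_aut S0 @* L^`(1) = 1.
      rewrite morphim_der //; apply/derG1P.
      by apply: abelianS (Aut_conj_aut _ _) (Aut_cyclic_abelian cycS0).
    apply/subsetP=> v Dv; have nv := subsetP sDN v Dv; rewrite -ker_conj_aut.
    by apply/kerP=> //; apply/set1gP; rewrite -autD1; apply: mem_morphim.
  have: phi @* L^`(1) = 1.
    by apply/trivgP; rewrite -(morphim_ker phi) morphimS // (subset_trans _ sCK) // subsetI der_sub.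
  by rewrite morphim_der // => /derG1P.
have [x [Tx ox xw]] := exists_inverted.
have [wt Lwt phi_wt]: exists2 y, y \in L & phi y = w.
  by have := bn_Tw bnT; rewrite -phiL => /morphimP[y Ly _ ->]; exists y.
pose X := (phi @*^-1 <[x]>)%G; have sXL: X \subset L := subsetIl _ _.
have [S2 sylS2] := Sylow_exists z X; have sS2X := pHall_sub sylS2.
have sS2L := subset_trans sS2X sXL.
have sKX: K \subset X by rewrite /= kerE morphpreS ?sub1G.
have sS02: S0 \subset S2.
  apply: (normal_sub_max_pgroup (Hall_max sylS2) zS0).
  by rewrite /normal (subset_trans (pHall_sub sylS0)) // (subset_trans sXL).
have nXw: X :^ wt = X.
  rewrite -morphpreJ // phi_wt; congr (phi @*^-1 _).
  by rewrite -cycleJ xw cycleV.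
have [y Xy defS2w]: exists2 y, y \in X & S2 :^ wt = S2 :^ y.
  by apply: (Sylow_trans sylS2); rewrite -nXw pHallJ2.
pose g := wt * y^-1; have Ly := subsetP sXL y Xy.
have Lg: g \in L by rewrite groupM ?groupV.
have nS2g: g \in 'N(S2) by rewrite inE conjsgM defS2w conjsgK.
have /cyclicP[c defS2] := zgroup_cyclic sS2L (pHall_pgroup sylS2).
have S2c: c \in S2 by rewrite defS2 cycle_id.
have Lc := subsetP sS2L c S2c.
have phiS2: phi @* S2 = <[x]>.
  by apply: morphim_Sylow_preim sylS2; rewrite ?cycle_subG // /pgroup -orderE ox pnat_id.
have /cycleP[m cg]: c ^ g \in <[c]> by rewrite -defS2 memJ_norm.
have dvd_m: z %| m.+1.
  have: #[phi c] = z by rewrite orderE -morphim_cycle // -defS2 phiS2 -orderE.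
  move <-; rewrite order_dvdn expgS -morphX // -cg morphJ // morphM ?groupV //.
  have /morphpreP[_ /cycleP[j phi_y]] := groupVr Xy.
  have /cycleP[i ->]: phi c \in <[x]> by rewrite -phiS2 mem_morphim.
  rewrite phi_wt phi_y conjgM conjXg xw.
  have -> : (x^-1 ^+ i) ^ (x ^+ j) = x ^- i.
    rewrite -expgVn; apply/conjg_fixP/commgP/commuteX2.
    exact/commute_sym/commuteV/commute_refl.
  by rewrite mulgV.
have [_ dvS0 _] := pgroup_pdiv zS0 ntS0; have [c0 S0c0 oc0] := Cauchy pr_z dvS0.
have /cycleP[k def_c0]: c0 \in <[c]> by rewrite -defS2 (subsetP sS02).
have fix_c0: c0 ^ g = c0 by apply/conjg_fixP/commgP; apply: (centsP _ _ S0c0 _ Lg); rewrite centsC.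
have: c0 ^+ 2 = 1.
  have c0m: c0 ^+ m = c0 by rewrite -[RHS]fix_c0 def_c0 conjXg cg -!expgM mulnC.
  by apply/eqP; rewrite expgS expg1 -{2}c0m -expgS -order_dvdn oc0.
move/eqP; rewrite -order_dvdn oc0 => /(prime_nt_dvdP (isT : prime 2)) z2.
by have := prime_odd; rewrite z2 // neq_ltn prime_gt1 ?orbT.
Qed.

(** * Minimal extensions without fixed vectors: the kernel is central *)

Lemma ker_notin x : x \in L -> #[x] = z -> x \notin K.
Proof.
move=> Lx ox; apply/negP=> Kx; have := mem_p_elt ker_z' Kx.
by rewrite /p_elt ox p'natE // dvdnn.
Qed.

(** [K] has order prime to [z]. *)
Lemma exists_lift y : y \in T -> #[y] = z -> exists x, [/\ x \in L, #[x] = z & phi x = y].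
Proof.
rewrite -phiL => /morphimP[v Lv _ ->] oy.
pose x := v.`_z; have Lx: x \in L by rewrite groupX.
have phix: phi x = phi v by rewrite morph_constt // constt_p_elt // /p_elt oy pnat_id.
exists x; split=> //; apply/(prime_nt_dvdP pr_z).
  by rewrite order_eq1; apply: contraTneq (pr_z) => x1; rewrite -oy -phix x1 morph1 order1.
have: x ^+ z \in K.
  by apply/kerP; rewrite ?groupX // morphX // phix -oy expg_order.
move/(mem_p_elt ker_z')=> z'xz; rewrite order_dvdn -order_eq1.
have: z.-elt (x ^+ z) by rewrite p_eltX // p_elt_constt.
by move/pnat_1 => /(_ z'xz) ->.
Qed.

(** Otherwise [x] would generate the complement of a Frobenius group with kernel
    [[~: A, <[x]>]], and have a nonzero fixed vector. *)
Lemma cent_abelian (A : {group gT}) x : A \subset L -> x \in L -> #[x] = z ->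
  abelian A -> x \in 'N(A) -> coprime #|A| z -> x \in 'C(A).
Proof.
move=> sAL Lx ox cAA nAx coAz; pose X := <[x]>%G.
have nAX: X \subset 'N(A) by rewrite cycle_subG.
have coAX: coprime #|A| #|X| by rewrite -orderE ox.
pose A0 := [~: A, X]%G; have sA0: A0 \subset A by rewrite commg_subl.
have sA0L := subset_trans sA0 sAL.
have A0_1: A0 :=: 1.
  apply/trivgP/subsetP=> a A0a; rewrite inE; apply/eqP.
  apply: (mx_faithful_inj faithL) (subsetP sA0L a A0a) (group1 L) _; rewrite repr_mx1.
  apply: (Frobenius_kernel_trivial pcharL sA0L Lx _ _ _ (nofix Lx ox) A0a); rewrite ?ox //.
    by rewrite -cycle_subG commg_normr.
  by rewrite -cent_cycle; apply: coprime_abel_cent_TI.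
by rewrite -cycle_subG centsC; apply/commG1P.
Qed.

Section NoncentralNormalSubgroup.

Variables (p : nat) (D : {group gT}).
Hypotheses (pr_p : prime p) (pD : p.-group D) (sDK : D \subset K) (nsDL : D <| L).
Hypothesis ncD : ~~ (D \subset 'Z(L)).
Hypothesis minD : forall N : {group gT}, N \proper D -> N <| L -> N \subset 'Z(L).

Let sDL : D \subset L := normal_sub nsDL.
Let z'D : z^'.-group D := pgroupS sDK ker_z'.
Let coDz : coprime #|D| z. Proof. by rewrite coprime_sym prime_coprime // -p'natE. Qed.
Let ntD : D :!=: 1. Proof. by apply: contraNneq ncD => ->; apply: sub1G. Qed.

Lemma der1_minD : D^`(1) \subset 'Z(L).
Proof.
apply: minD; first exact: sol_der1_proper (pgroup_sol pD) _ ntD.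
exact: char_normal_trans (der_char 1 D) nsDL.
Qed.

Lemma notcent_minD x : x \in L -> #[x] = z -> x \notin 'C(D).
Proof.
move=> Lx ox; apply: contra ncD => cDx.
exact: min_centralizes nsDL Lx (ker_notin Lx ox) cDx.
Qed.

(** [x] centralizes the characteristic abelian subgroups of [D0], so that [D0] is
    special with center ['C_D0(x)].  This center is the derived group of
    [D0]; by the minimality of [D] it lies in ['Z(L)], which is cyclic. *)
Lemma commutator_extraspecial x (D0 := [~: D, <[x]>]%G) : x \in L -> #[x] = z ->
  [/\ D0 \subset D, x \in 'N(D0), extraspecial D0 & 'C_D0[x] = 'Z(D0)].
Proof.
move=> Lx ox; pose X := <[x]>%G.
have nDX: X \subset 'N(D) by rewrite cycle_subG (subsetP (normal_norm nsDL)).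
have coDX: coprime #|D| #|X| by rewrite -orderE ox.
have sD0: D0 \subset D by rewrite commg_subl.
have pD0 := pgroupS sD0 pD; have sD0L := subset_trans sD0 sDL.
have nD0X: X \subset 'N(D0) by rewrite commg_normr.
have nD0x: x \in 'N(D0) by rewrite -cycle_subG.
have coD0X: coprime #|D0| #|X| := coprimeSg sD0 coDX.
have ntD0: D0 :!=: 1.
  apply: contra (notcent_minD Lx ox) => /eqP/commG1P.
  by rewrite centsC cycle_subG.
have D0X: [~: D0, X] = D0 by rewrite /= coprime_commGG ?(pgroup_sol pD).
have [| spD0 cD0X] := abelian_charsimple_special pD0 coD0X D0X.
  apply/bigcupsP=> A /andP[chA cAA]; have sA := char_sub chA.
  rewrite centsC cycle_subG cent_abelian ?(subset_trans sA) //.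
    by rewrite -cycle_subG (char_norm_trans chA).
  by rewrite -ox; apply: coprimeSg sA coD0X.
have [_ defD0'] := spD0.
split=> //; last by rewrite -cent_cycle.
split=> //.
have sZ: 'Z(D0) \subset 'Z(L) by rewrite -defD0' (subset_trans (dergS 1 sD0)) ?der1_minD.
have cycZ: cyclic 'Z(D0) := cyclicS sZ (mx_faithful_irr_center_cyclic faithL irrL).
rewrite (cyclic_abelem_prime (center_special_abelem pD0 spD0) cycZ) //.
by apply: contraNneq ntD0 => /(trivg_center_pgroup pD0) ->.
Qed.

Lemma commutator_index x : x \in L -> #[x] = z ->
  #|D : 'C_D[x]| <= z.-1 ^ 2 /\ (exists2 m, 0 < m & #|D : 'C_D[x]| = (p ^ m.*2)%N).
Proof.
move=> Lx ox; have [sD0 nD0x esD0 cD0x] := commutator_extraspecial Lx ox.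
set D0 := [~: D, <[x]>]%G in sD0 nD0x esD0 cD0x; have [spD0 prZ] := esD0.
have [_ defD0'] := spD0; have pD0 := pgroupS sD0 pD; have sD0L := subset_trans sD0 sDL.
have sZ: 'Z(D0) \subset 'Z(L) by rewrite -defD0' (subset_trans (dergS 1 sD0)) ?der1_minD.
have nDX: <[x]> \subset 'N(D) by rewrite cycle_subG (subsetP (normal_norm nsDL)).
have ->: #|D : 'C_D[x]| = #|D0 : 'Z(D0)|.
  have defD: D0 * 'C_D(<[x]>) = D.
    by rewrite coprime_comm_cent_prod ?(pgroup_sol pD) // -orderE ox.
  rewrite cent_cycle in defD.
  have tiDC: D0 :&: 'C_D[x] = 'Z(D0) by rewrite -cD0x setIA (setIidPl sD0).
  have sCN: 'C_D[x] \subset 'N(D0) := subset_trans (subsetIl _ _) (commg_norml _ _).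
  have <-: #|'C_D[x] * D0 : 'C_D[x]| = #|D : 'C_D[x]| by rewrite (normC sCN) defD.
  by rewrite indexMg -indexgI tiDC.
split.
  rewrite -ox; apply: (leq_index_center (rG := rL) pcharL sD0L Lx nD0x); rewrite ?ox //.
  - move=> c /(subsetP sZ)/centerP[Lc cLc]; have absL := @group_closure_closed_field F gT L d rL irrL.
    apply: (mx_abs_irr_cent_scalar absL).
    by apply/centgmxP=> y Ly; rewrite -!repr_mxM // cLc.
  - move=> g /setDP[D0g Z'g].
    have /subsetPn[y D0y] : ~~ (D0 \subset 'C[g]).
      by apply: contra Z'g => cD0g; rewrite inE D0g -sub_cent1.
    rewrite -cent1C => Cgy; have D0gy: [~ g, y] \in 'Z(D0) by rewrite -defD0' mem_commg.
    exists y => //; split=> //; apply: contra Cgy => /eqP r1; apply/cent1P/commgP.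
    have Lgy: [~ g, y] \in L by rewrite (subsetP sD0L) // groupR.
    by rewrite -in_set1; apply/set1gP/(mx_faithful_inj faithL Lgy (group1 L)); rewrite repr_mx1.
  - exact: coprimeSg sD0 coDz.
  - exact: solvableS sD0 (pgroup_sol pD).
  - exact: nofix.
have [m m_gt0 oD0] := card_extraspecial pD0 esD0; exists m => //.
rewrite -divgS ?center_sub // oD0 (card_center_extraspecial pD0 esD0).
by rewrite expnS mulKn ?prime_gt0.
Qed.

Lemma card_cent_mod (q : nat) x : x \in L -> q.-elt x -> prime q ->
  #|D| = #|'C_D[x]| %[mod q].
Proof.
move=> Lx qx pr_q; have nDx: <[x]> \subset 'N(D) by rewrite cycle_subG (subsetP (normal_norm nsDL)).
rewrite (pgroup_fix_mod (to := 'J) (G := <[x]>%G) (p := q)) ?astabsJ //.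
by rewrite afixJ cent_cycle.
Qed.

(** Since [|D|] and [|'C_D[x]|] are congruent modulo [z], the prime [z] divides
    [p ^ m.*2 - 1]; as [p ^ m.*2 <= z.-1 ^ 2] this leaves [z = p ^ m + 1].  Then
    [p = 2] by parity, and [sl_Fermat_prime] applies. *)
Lemma minD_prime3 : p = 2 /\ z = 3.
Proof.
have dvT: z %| #|T| by have := zT; rewrite mem_primes => /and3P[].
have [y Ty oy] := Cauchy pr_z dvT.
have [x [Lx ox _]] := exists_lift Ty oy.
have [le_z [m m_gt0 iD]] := commutator_index Lx ox; rewrite iD in le_z.
have zx: z.-elt x by rewrite /p_elt ox pnat_id.
have dv_z: z %| (p ^ m.*2 - 1)%N.
  have oD: #|D| = (#|'C_D[x]| * p ^ m.*2)%N by rewrite -iD Lagrange ?subsetIl.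
  have := card_cent_mod Lx zx pr_z => /eqP; rewrite oD eqn_mod_dvd ?leq_pmulr ?expn_gt0 ?prime_gt0 //.
  rewrite -[X in (_ - X)%N]muln1 -mulnBr Gauss_dvdr // coprime_sym.
  by apply: coprimeSg (subsetIl _ _) coDz.
have z_gt1 := prime_gt1 pr_z; have p_gt1 := prime_gt1 pr_p.
have lt_pm: p ^ m < z.
  by rewrite -[z]prednK ?(ltnW z_gt1) // ltnS -leq_sqr -expnM muln2.
have pm_gt1: 1 < p ^ m by rewrite (ltn_exp2l 0).
have def_z: z = (p ^ m + 1)%N.
  move: dv_z; rewrite -muln2 expnM -(exp1n 2) subn_sqr Euclid_dvdM // => /orP[] dvz.
    have := dvdn_leq _ dvz; rewrite subn_gt0 => /(_ pm_gt1).
    by rewrite leqNgt (leq_ltn_trans _ lt_pm) ?leq_subr.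
  have le_z': z <= p ^ m + 1 by rewrite dvdn_leq // addn1.
  by apply/eqP; rewrite eqn_leq le_z' addn1 lt_pm.
have p2: p = 2.
  have [// | odd_p] := even_prime pr_p.
  by have := prime_odd; rewrite def_z oddD oddX odd_p orbT.
have def_z2: z = (2 ^ m + 1)%N by rewrite -p2.
have dvz: z %| (2 ^ f - 1)%N \/ z %| (2 ^ f + 1)%N.
  by case: (sl_pi slT zT) => [z2|?|?]; [have := prime_odd; rewrite z2 | left | right].
by have [] := sl_Fermat_prime slT m_gt0 pr_z prime_odd def_z2 dvz.
Qed.

Lemma card_cent_prime3 x : x \in L -> #[x] = z -> #|D| <= 4 * #|'C_D[x]|.
Proof.
move=> Lx ox; have [le_z _] := commutator_index Lx ox.
rewrite -(Lagrange (subsetIl D 'C[x])) mulnC leq_mul2r; apply/orP; right.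
by have [_ z3] := minD_prime3; rewrite z3 in le_z.
Qed.

(** An element of [H] of prime order [q] is a product of two elements of order
    [z = 3], whose centralizers in [D] have index at most [4].  A lift [g] of
    [q]-power order then centralizes a subgroup of index [2 ^ (a - b)] of [D],
    where [a - b <= 4 < f]; but [q] divides [2 ^ (a - b) - 1]. *)
Lemma noncentral_normal_absurd : False.
Proof.
have [p2 z3] := minD_prime3; have [pr_f f_ge5] := (sl_f_prime slT, sl_f_ge5 slT).
pose q := pdiv (2 ^ f - 1).
have gt1: 1 < 2 ^ f - 1.
  by rewrite ltn_subRL addn1 (@ltn_exp2l 2 1) // ltnW // (ltn_trans _ f_ge5).
have pr_q: prime q by apply: pdiv_prime.
have dv_q: q %| (2 ^ f - 1)%N by apply: pdiv_dvd.
have [|h Hh oh] := @Cauchy _ q H pr_q; first by rewrite (sl_oH slT).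
have [|y1 [y2 [Ty1 Ty2 oy1 oy2 def_h]]] := sl_prod3 slT (_ : h \in H^#).
  by rewrite !inE Hh -order_gt1 oh prime_gt1.
rewrite -z3 in oy1 oy2.
have [x1 [Lx1 ox1 phix1]] := exists_lift Ty1 oy1.
have [x2 [Lx2 ox2 phix2]] := exists_lift Ty2 oy2.
pose g := (x1 * x2).`_q; have Lg: g \in L by rewrite groupX ?groupM.
have phig: phi g = h.
  rewrite morph_constt ?groupM // morphM // phix1 phix2 -def_h constt_p_elt //.
  by rewrite /p_elt oh pnat_id.
have K'g: g \notin K.
  apply: contraTN (pr_q) => /mker; rewrite phig => h1.
  by rewrite -oh h1 order1.
pose C := 'C_D[x1] :&: 'C_D[x2].
have sCg: C \subset 'C_D[g].
  rewrite subsetI (subset_trans (subsetIl _ _)) ?subsetIl //=.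
  apply/subsetP=> c /setIP[/setIP[_ c1] /setIP[_ c2]].
  by rewrite cent1C groupX // groupM // cent1C.
have leC: #|D| <= 16 * #|C|.
  have le1 := card_cent_prime3 Lx1 ox1; have le2 := card_cent_prime3 Lx2 ox2.
  have := mul_cardG 'C_D[x1]%G 'C_D[x2]%G => /= cardM.
  have leM: #|'C_D[x1] * 'C_D[x2]| <= #|D|.
    by rewrite subset_leq_card // mul_subG ?subsetIl.
  rewrite -(leq_pmul2l (cardG_gt0 D)); apply: leq_trans (leq_mul le1 le2) _.
  by rewrite mulnACA cardM [leqRHS]mulnCA leq_mul2l leq_mul2r leM orbT.
have [a oD] := p_natP pD; have [b oC] := p_natP (pgroupS (subsetIl D 'C[g]) pD).
rewrite p2 in oD oC.
have ltC: #|'C_D[g]| < #|D|.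
  rewrite proper_card // properE subsetIl subsetI subxx /=; apply: contra ncD => cDg.
  by apply: min_centralizes nsDL Lg K'g _; rewrite -sub_cent1.
rewrite oD oC ltn_exp2l // in ltC.
have leDC: a <= b + 4.
  rewrite -(leq_exp2l _ _ (ltnSn 1)) -oD (leq_trans leC) // expnD -oC mulnC leq_mul2r.
  by rewrite subset_leq_card ?orbT.
have /eqP := card_cent_mod Lg (p_elt_constt q _) pr_q.
rewrite oD oC eqn_mod_dvd ?leq_exp2l ?(ltnW ltC) //.
rewrite -{1}(subnKC (ltnW ltC)) expnD -[X in (_ - X)%N]muln1 -mulnBr.
rewrite Gauss_dvdr.
  move=> dvq; have /eqP: (a - b)%N = 0%N.
    by apply: (sl_small_2power slT pr_q dv_q _ dvq); rewrite (leq_ltn_trans _ f_ge5) // leq_subLR.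
  by rewrite subn_eq0 leqNgt ltC.
rewrite coprimeXr // prime_coprime //; apply: contraTN dv_q => /(prime_nt_dvdP (isT : prime 2)) -> //.
  by rewrite dvdn2 oddB ?expn_gt0 // oddX /= orbF addbT negbK; case: f f_ge5.
by rewrite neq_ltn prime_gt1 ?orbT.
Qed.

End NoncentralNormalSubgroup.

(** It suffices to consider the Sylow subgroups of [K], which are normal in
    [L]; a normal subgroup inside one of them that is minimal subject to not
    being central contradicts [noncentral_normal_absurd]. *)
Lemma ker_central : K \subset 'Z(L).
Proof.
rewrite -[gval K]Sylow_gen gen_subG; apply/bigcupsP=> R /SylowP[p pr_p sylR].
apply: contraT => ncR; have nsR := Sylow_ker_normal sylR.
pose P (N : {group gT}) := [&& N \subset R, N <| L & ~~ (N \subset 'Z(L))].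
have [|D /mingroupP[/and3P[sDR nsD ncD] minD] _] := @mingroup_exists _ P R.
  by apply/and3P.
case: (noncentral_normal_absurd pr_p (pgroupS sDR (pHall_pgroup sylR)) (subset_trans sDR (pHall_sub sylR)) nsD ncD).
move=> N /andP[sND ltND] nsN; apply: contraR ltND => ncN.
by rewrite (minD N) //; apply/and3P; rewrite (subset_trans sND).
Qed.

(** * Minimal extensions without fixed vectors: the kernel is trivial *)

(** Two lifts of the same element of [T] differ by a central element, so the
    relations between conjugates that hold in [T] may be checked for any
    convenient lift. *)
Lemma central_conj x y : x \in L -> y \in L -> phi x = phi y -> forall g, g \in L -> g ^ x = g ^ y.
Proof.
move=> Lx Ly eq_xy g Lg.
have: x * y^-1 \in K.
  by apply/kerP; rewrite ?groupM ?groupV // morphM ?groupV // morphV // eq_xy mulgV.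
case/(subsetP ker_central)/centerP=> _ cxy; rewrite -[x](mulgKV y) conjgM; congr (_ ^ y).
by apply/conjg_fixP/commgP/commute_sym/cxy.
Qed.

Let Ut := (phi @*^-1 U)%G.
Let Ht := (phi @*^-1 H)%G.
Let P := 'O_2(Ut)%G.
Let sUtL : Ut \subset L := subsetIl _ _.
Let sHtL : Ht \subset L := subsetIl _ _.
Let sPUt : P \subset Ut := pcore_sub _ _.
Let sPL : P \subset L := subset_trans sPUt sUtL.
Let pP : 2.-group P := pcore_pgroup _ _.
Let phiHt : phi @* Ht = H. Proof. by rewrite morphpreK // phiL (bn_sHT bnT). Qed.

Lemma nilpotent_preU : nilpotent Ut.
Proof.
rewrite -quotient_center_nil; apply/abelian_nil/sub_der1_abelian.
have: Ut^`(1) \subset K.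
  rewrite /= kerE -sub_morphim_pre ?(subset_trans (der_sub _ _)) //.
  rewrite morphim_der // morphpreK ?phiL ?(bn_sUT bnT) //.
  by rewrite (derG1P (bn_abelianU bnT)).
move=> sUK; rewrite subsetI der_sub; apply: subset_trans sUK _.
apply: subset_trans ker_central _; apply: subset_trans (subsetIr _ _) _.
exact: centS.
Qed.

Lemma morphim_P : phi @* P = U.
Proof.
apply: morphim_Sylow_preim (bn_sUT bnT) (sl_2group_U slT) _.
exact: nilpotent_pcore_Hall nilpotent_preU.
Qed.

Lemma abelian_preH : abelian Ht.
Proof.
have sKHt: K \subset Ht by rewrite /= kerE morphpreS ?sub1G.
apply: (@cyclic_factor_abelian _ K).
  rewrite subsetI sKHt (subset_trans ker_central) // (subset_trans (subsetIr _ _)) //.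
  exact: centS.
have := first_isog_loc phi sHtL; rewrite phiHt => /isog_cyclic.
by rewrite (bn_cycH bnT) /= (setIidPr sKHt).
Qed.

Lemma preH_norm_P : Ht \subset 'N(P).
Proof. by apply: gFnorm_trans; apply: morphpre_norms (bn_nUH bnT). Qed.

Section LiftUnipotent.

Variable h : gT.
Hypotheses (Hth : h \in Ht) (odd_h : 2^'.-elt h).
Hypothesis irrU : forall A : {group tT}, A \subset U -> phi h \in 'N(A) -> A :=: 1 \/ A :=: U.
Hypothesis ntph : phi h != 1.

Let X := <[h]>%G.
Let nPX : X \subset 'N(P).
Proof. by rewrite cycle_subG (subsetP preH_norm_P). Qed.
Let coPX : coprime #|P| #|X|. Proof. exact: pnat_coprime pP odd_h. Qed.
Let Lh : h \in L. Proof. exact: subsetP sHtL h Hth. Qed.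
Let Q := [~: P, X]%G.
Let sQP : Q \subset P. Proof. by rewrite commg_subl. Qed.
Let sQL : Q \subset L := subset_trans sQP sPL.

(** The fixed points of [phi h] on [U] are trivial. *)
Lemma cent_h_ker : 'C_P[h] \subset K.
Proof.
apply/subsetP=> y /setIP[Py /cent1P chy]; have Ly := subsetP sPL y Py.
apply/kerP=> //; apply/set1gP; rewrite -(sl_CU slT (_ : phi h \in H^#)); last first.
  by rewrite !inE ntph -phiHt mem_morphim.
rewrite inE -morphim_P mem_morphim //=; apply/cent1P.
by rewrite /commute -!morphM // chy.
Qed.

Lemma morphim_Q : phi @* Q = U.
Proof.
rewrite -morphim_P -[in RHS](coprime_comm_cent_prod nPX coPX (pgroup_sol pP)).
rewrite morphimMl // cent_cycle (_ : phi @* 'C_P[h] = 1) ?mulg1 //.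
by apply/trivgP; rewrite -(morphim_ker phi) morphimS // cent_h_ker.
Qed.

Lemma ker_cent_Q : Q :&: K = 'C_Q[h].
Proof.
apply/eqP; rewrite eqEsubset; apply/andP; split; apply/subsetP=> y /setIP[Qy].
  case/(subsetP ker_central)/centerP=> Ly cy; rewrite inE Qy.
  exact/cent1P/(cy h Lh).
move=> chy; rewrite inE Qy (subsetP cent_h_ker) // inE chy andbT.
exact: subsetP sQP y Qy.
Qed.

(** The characteristic abelian subgroups of [Q] map to subgroups of [U] that are
    invariant under [phi h], hence to [1] or [U].  The latter makes [P]
    abelian; otherwise [Q] is extraspecial with [|Q / 'Z(Q)| = 2 ^ f], but
    [f] is odd. *)
Lemma abelian_P : abelian P.
Proof.
apply: contraT => ncP.
have p2Q := pgroupS sQP pP; have coQX : coprime #|Q| #|X| := coprimeSg sQP coPX.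
have [| spQ cQX] := abelian_charsimple_special p2Q coQX (coprime_commGG nPX coPX (pgroup_sol pP)).
  apply/bigcupsP=> A /andP[chA cAA]; have sAQ := char_sub chA.
  have sAL := subset_trans sAQ sQL.
  have nAh: h \in 'N(A) by rewrite -cycle_subG (char_norm_trans chA) ?commg_normr.
  have [|| A1 | AU] := @irrU (phi @* A)%G.
  - by rewrite /= -morphim_Q morphimS.
  - by rewrite (subsetP (morphim_norm _ _)) // mem_morphim.
  - have sAK: A \subset K by rewrite /= kerE -sub_morphim_pre // A1.
    rewrite (subset_trans sAK) // (subset_trans ker_central) //.
    by rewrite (subset_trans (subsetIr _ _)) // centS // cycle_subG.
  case/negP: ncP; have sPAK: P \subset K * A by rewrite -morphimSK // morphim_P AU.
  have cKL: L \subset 'C(K) by rewrite centsC (subset_trans ker_central) ?subsetIr.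
  apply: abelianS sPAK _; rewrite abelianM; apply/and3P; split=> //.
    exact: subset_trans sKL cKL.
  exact: subset_trans sAL cKL.
have cQZ: Q :&: K = 'Z(Q) by rewrite ker_cent_Q -cQX cent_cycle.
have ntU: 1 < #|U| by rewrite (sl_oU slT) (@ltn_exp2l 2 0) // prime_gt0 // (sl_f_prime slT).
have oU: #|U| = #|Q : 'Z(Q)|.
  by rewrite -morphim_Q card_morphim (setIidPr sQL) -cQZ indexgI.
have ntZ: 'Z(Q) != 1.
  apply: contraTneq ntU => /(trivg_center_pgroup p2Q) Q1.
  by rewrite -morphim_Q Q1 morphim1 cards1.
have sZ: 'Z(Q) \subset 'Z(L) by rewrite -cQZ (subset_trans (subsetIr _ _)) ?ker_central.
have cycZ: cyclic 'Z(Q) := cyclicS sZ (mx_faithful_irr_center_cyclic faithL irrL).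
have esQ: extraspecial Q.
  by split=> //; rewrite (cyclic_abelem_prime (center_special_abelem p2Q spQ) cycZ).
have [n _ oQ] := card_extraspecial p2Q esQ.
have: (2 ^ f = 2 ^ n.*2)%N.
  rewrite -(sl_oU slT) oU -divgS ?center_sub // oQ (card_center_extraspecial p2Q esQ).
  by rewrite expnS mulKn.
by move/(expnI (ltnSn 1)) => def_f; have := sl_f_odd slT; rewrite def_f odd_double.
Qed.

Lemma tiQK : Q :&: K = 1.
Proof.
by rewrite ker_cent_Q -cent_cycle; apply: coprime_abel_cent_TI coPX abelian_P.
Qed.

Lemma inj_Q : {in Q &, injective phi}.
Proof.
move=> a b Qa Qb eq_ab; have [La Lb] := (subsetP sQL a Qa, subsetP sQL b Qb).
apply/eqP; rewrite eq_mulgV1 -in_set1 -[[set 1]]tiQK inE groupM ?groupV //=.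
by apply/kerP; rewrite ?groupM ?groupV // morphM ?groupV // morphV // eq_ab mulgV.
Qed.

Lemma preH_norm_Q : Ht \subset 'N(Q).
Proof.
rewrite normsR ?preH_norm_P // cents_norm // centsC cycle_subG.
exact: subsetP abelian_preH h Hth.
Qed.

End LiftUnipotent.

(** Given an isomorphic lift [Q] of [U] that is normalized by the preimage [Ht] of
    [H], one builds a complement of [K]: the subgroup generated by [Q], by the
    group [H1] of the [(g ^ wt)^-1 * g] for [g] in [Ht], and by
    [wt = v * t * v], where [v] lifts [u] and [t] is conjugate to [v].  As
    [(g ^ wt)^-1 * g] does not change when [g] is multiplied by a central
    element, and lifts the square of the image of [g], the group [H1] is an
    isomorphic lift of [H]. *)
Section LiftBN.

Variable Q : {group gT}.
Hypotheses (sQL : Q \subset L) (phiQ : phi @* Q = U).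
Hypotheses (injQ : {in Q &, injective phi}) (nQHt : Ht \subset 'N(Q)).

Let LQ a (Qa : a \in Q) : a \in L := subsetP sQL a Qa.
Let LH g (Hg : g \in Ht) : g \in L := subsetP sHtL g Hg.
Let cHt : abelian Ht := abelian_preH.

(** The relations of the Bruhat decomposition lift to [Q], [H1] and [wt], so the
    union [S0] of the two cells [Q * H1] and [Q * H1 * wt * Q] is stable
    under right multiplication by the generators.  It contains [L] by minimality,
    and no nontrivial element of [S0] maps to [1]. *)
Lemma trivial_ker : K :=: 1.
Proof.
have phiE g : g \in Ht -> phi g \in H by move=> Hg; rewrite -phiHt mem_morphim ?LH.
have [v Qv phi_v]: exists2 v, v \in Q & phi v = u.
  have: u \in phi @* Q by rewrite phiQ; case/setD1P: (bn_Uu bnT).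
  by case/morphimP=> v _ Qv ->; exists v.
have Q2 a : a \in Q -> a * a = 1.
  move=> Qa; apply: injQ; rewrite ?groupM // morph1 morphM ?LQ // (bn_expU bnT) //.
  by rewrite -phiQ mem_morphim ?LQ.
have [w0 Lw0 phi_w0]: exists2 y, y \in L & phi y = w.
  by have := bn_Tw bnT; rewrite -phiL => /morphimP[y Ly _ ->]; exists y.
have Lv := LQ Qv; pose t := v ^ w0; have Lt: t \in L by rewrite groupJ.
pose wt := v * t * v; have Lwt: wt \in L := groupM (groupM Lv Lt) Lv.
have phi_wt: phi wt = w.
  rewrite (morphM _ (groupM Lv Lt) Lv) (morphM _ Lv Lt) (morphJ _ Lv Lw0) phi_v phi_w0.
  exact/esym/(bn_wE bnT).
have vV: v^-1 = v by apply/eqP; rewrite eq_invg_mul Q2.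
have tV: t^-1 = t by rewrite -conjVg vV.
have wtV: wt^-1 = wt by rewrite /wt 2!invMg vV tV mulgA.
have vw: v ^ wt = v * wt * v.
  have def_t: v^-1 * wt * v^-1 = t by rewrite /wt mulgA mulgK mulKg.
  by rewrite (central_conj Lwt Lw0) ?phi_wt ?phi_w0 // -/t -def_t vV.
have nHw g : g \in Ht -> g ^ wt \in Ht.
  move=> Hg; have Lg := LH Hg; rewrite mem_morphpre ?groupJ // morphJ // phi_wt.
  by rewrite (bn_invH bnT) ?phiE // groupV phiE.
pose delta g := (g ^ wt)^-1 * g.
have Hdelta g : g \in Ht -> delta g \in Ht by move=> Hg; rewrite groupM ?groupV ?nHw.
have deltaM : {in Ht &, {morph delta : a b / a * b}}.
  move=> a b Ha Hb; rewrite /delta conjMg invMg.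
  have cAB := centsP cHt _ (groupVr (nHw b Hb)) _ (groupVr (nHw a Ha)).
  rewrite cAB -!mulgA; congr (_ * _); rewrite !mulgA; congr (_ * _).
  exact: (centsP cHt _ (groupVr (nHw b Hb)) _ Ha).
pose H1 := (Morphism deltaM @* Ht)%G.
have sH1: H1 \subset Ht by apply/subsetP=> _ /morphimP[g _ Hg ->]; apply: Hdelta.
have phi_delta g : g \in Ht -> phi (delta g) = phi g ^+ 2.
  move=> Hg; have Lg := LH Hg; rewrite morphM ?groupV ?groupJ // morphV ?groupJ //.
  by rewrite morphJ // phi_wt (bn_invH bnT) ?phiE // invgK.
have tiH1K : {in H1, forall g, phi g = 1 -> g = 1}.
  move=> _ /morphimP[g _ Hg ->] /=; rewrite phi_delta // => phig2.
  have phig1: phi g = 1.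
    apply/eqP; rewrite -order_eq1 -dvdn1.
    have := sl_oddH slT; rewrite -coprimen2 => /eqP <-; rewrite dvdn_gcd order_dvdG ?phiE //=.
    by rewrite order_dvdn phig2.
  have Kg: g \in K by apply/kerP; rewrite ?LH.
  have /centerP[_ cg] := subsetP ker_central g Kg.
  rewrite /delta (_ : g ^ wt = g) ?mulVg //.
  exact/conjg_fixP/commgP/(cg wt Lwt).
have H1w g : g \in H1 -> g ^ wt \in H1.
  case/morphimP=> k _ Hk ->; rewrite /= (_ : _ ^ wt = delta (k ^ wt)).
    by rewrite -[delta _]/(Morphism deltaM _) mem_morphim // nHw.
  by rewrite /delta conjMg conjVg.
have wtC g : wt * g = g ^ wt * wt by rewrite conjgCV wtV.
have wtK g : g * wt * wt = g by rewrite -{2}wtV mulgK.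
have nQH1: H1 \subset 'N(Q) := subset_trans sH1 nQHt.
pose B1 := (Q <*> H1)%G; have B1E: B1 = Q * H1 :> {set gT} by apply: norm_joinEr.
have sQB: Q \subset B1 by apply: joing_subl.
have sHB: H1 \subset B1 by apply: joing_subr.
pose S0 := B1 :|: (B1 :* wt) * Q.
have cell a y : a \in B1 -> y \in Q -> a * wt * y \in S0.
  by move=> Ba Qy; rewrite inE mem_mulg ?orbT // mem_rcoset mulgK.
(* The relation [u ^ w = u * w * u], conjugated by [H]. *)
have cellw b : b \in Q -> b != 1 -> exists c, exists2 g, c \in Q & g \in H1 /\ b ^ wt = c * g * wt * c.
  move=> Qb ntb; have Ub: phi b \in U^#.
    rewrite !inE -phiQ mem_morphim ?LQ // andbT; apply: contra ntb => /eqP phib1.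
    by apply/eqP/injQ; rewrite ?morph1.
  have [k Hk phib] := bn_trans bnT Ub; move: Hk; rewrite -phiHt => /morphimP[g Lg Hg def_k].
  have def_b: b = v ^ g.
    apply: injQ => //; first by rewrite memJ_norm // (subsetP nQHt).
    by rewrite phib morphJ // phi_v def_k.
  have Hg' := nHw g Hg; exists (v ^ (g ^ wt)); exists ((delta (g ^ wt)) ^ wt).
    by rewrite memJ_norm // (subsetP nQHt).
  split; first by rewrite H1w // -[delta _]/(Morphism deltaM _) mem_morphim.
  have wtJ: wt ^ (g ^ wt) = (delta (g ^ wt)) ^ wt * wt.
    by rewrite -wtC /delta mulgA -conjVg -conjgC -mulgA -conjgE.
  by rewrite def_b conjJg vw 2!conjMg wtJ !mulgA.
pose A := Q :|: H1 :|: [set wt].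
have stepA a g : a \in S0 -> g \in A -> a * g \in S0.
  case/setUP=> [Ba | /mulsgP[x y /rcosetP[b Bb ->] Qy ->]].
    case/setUP=> [/setUP[Qg|H1g] | /set1P->].
    - by rewrite inE (groupM Ba (subsetP sQB g Qg)).
    - by rewrite inE (groupM Ba (subsetP sHB g H1g)).
    by rewrite -[a * wt]mulg1 cell.
  case/setUP=> [/setUP[Qg|H1g] | /set1P->].
  - by rewrite -mulgA cell ?groupM.
  - rewrite -mulgA (conjgC y g) (mulgA (b * wt)) -(mulgA b wt g) wtC (mulgA b) cell //.
      exact: groupM Bb (subsetP sHB _ (H1w g H1g)).
    by rewrite memJ_norm // (subsetP nQH1).
  rewrite -mulgA (conjgC y wt) (mulgA (b * wt)) wtK.
  have [-> | nty] := eqVneq y 1; first by rewrite conj1g mulg1 inE Bb.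
  have [c [e [Qc [H1e ->]]]] := cellw y Qy nty.
  rewrite 2!(mulgA b) cell //.
  exact: groupM Bb (groupM (subsetP sQB c Qc) (subsetP sHB e H1e)).
have sAL: A \subset L.
  by rewrite !subUset sQL sub1set Lwt (subset_trans sH1).
(* The squares of the elements of [H] exhaust [H], so [H1] maps onto [H]. *)
have defL: <<A>> = L.
  apply: (minL (M := <<A>>%G)); first by rewrite gen_subG.
  apply/eqP; rewrite eqEsubset -{1}phiL morphimS ?gen_subG //=.
  have sUA: U \subset phi @* <<A>> by rewrite -phiQ morphimS // sub_gen // /A -setUA subsetUl.
  have sHA: H \subset phi @* <<A>>.
    apply/subsetP=> k Hk; have co2: coprime #|H| 2 by rewrite coprimen2; apply: sl_oddH slT.
    have: k ^+ expg_invn H 2 \in phi @* Ht by rewrite phiHt groupX.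
    case/morphimP=> g _ Hg phi_g; rewrite -(expgK co2 Hk) -expgM mulnC expgM phi_g -phi_delta //.
    rewrite mem_morphim ?LH ?Hdelta // mem_gen // 2!inE orbC inE.
    by rewrite -[delta _]/(Morphism deltaM _) mem_morphim ?orbT.
  have wA: w \in phi @* <<A>> by rewrite -phi_wt mem_morphim // mem_gen // !inE eqxx orbT.
  have sUHA: U * H \subset phi @* <<A>> by rewrite mul_subG.
  apply/subsetP=> x Tx; have [Bx | /(bn_bruhat bnT Tx)[b Bb [y Uy ->]]] := boolP (x \in U * H).
    exact: subsetP sUHA x Bx.
  exact: groupM (groupM (subsetP sUHA b Bb) wA) (subsetP sUA y Uy).
have sLS0: L \subset S0.
  rewrite -defL; apply/subsetP=> _ /gen_prodgP[n [c Ac ->]].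
  elim: n c Ac => [|n IHn] c Ac; first by rewrite big_ord0 inE group1.
  by rewrite big_ord_recr /= stepA // IHn.
apply/trivgP/subsetP=> k Kk; have Lk := subsetP sKL k Kk; have phik := mker Kk.
have := subsetP sLS0 k Lk; case/setUP.
  rewrite B1E => /mulsgP[a g Qa H1g def_k]; have Lg := LH (subsetP sH1 g H1g).
  have: (phi g)^-1 \in U :&: H.
    have: phi a * phi g = 1 by rewrite -phik def_k (morphM _ (LQ Qa) Lg).
    move/(canRL (mulgK _)); rewrite mul1g => phiag.
    rewrite inE -{1}phiag -phiQ mem_morphim ?LQ //=.
    by rewrite groupV phiE // (subsetP sH1).
  rewrite (bn_tiUH bnT (sl_oddH slT)) => /set1gP/eqP; rewrite eq_invg1 => /eqP phig1.
  have g1 := tiH1K g H1g phig1; rewrite def_k g1 mulg1 inE.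
  by apply/eqP/injQ; rewrite // morph1 -phik def_k g1 mulg1.
case/mulsgP=> x y /rcosetP[b Bb ->] Qy def_k.
case/negP: (bn_w_notinB bnT); rewrite -(bn_joing bnT).
have Ub c : c \in Q -> phi c \in U <*> H.
  by move=> Qc; rewrite (subsetP (joing_subl U H)) // -phiQ mem_morphim ?LQ.
move: Bb; rewrite B1E => /mulsgP[a g Qa H1g def_b].
have Lg := LH (subsetP sH1 g H1g); have Hg: phi g \in U <*> H.
  by rewrite (subsetP (joing_subr U H)) // phiE // (subsetP sH1).
have Lb: b \in L by rewrite def_b (groupM (LQ Qa) Lg).
have: phi b * w * phi y = 1.
  by rewrite -phik def_k (morphM _ (groupM Lb Lwt) (LQ Qy)) (morphM _ Lb Lwt) phi_wt.
move/(canRL (mulgK _)); rewrite mul1g => /(canRL (mulKg _)) ->.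
apply: groupM (groupVr _) (groupVr (Ub y Qy)).
by rewrite def_b (morphM _ (LQ Qa) Lg) (groupM (Ub a Qa) Hg).
Qed.

End LiftBN.

(** [h] is a lift, of odd order, of an element [k] of prime order dividing
    [2 ^ f - 1].  The order of [2] modulo this prime is [f], so [<[k]>] acts
    irreducibly on [U], and the [2]-group [[~: P, <[h]>]] is an isomorphic lift
    of [U]. *)
Lemma injective_phi : 'injm phi.
Proof.
have [pr_f f_ge5] := (sl_f_prime slT, sl_f_ge5 slT).
pose q := pdiv (2 ^ f - 1).
have gt1: 1 < 2 ^ f - 1.
  by rewrite ltn_subRL addn1 (@ltn_exp2l 2 1) // ltnW // (ltn_trans _ f_ge5).
have pr_q: prime q by apply: pdiv_prime.
have dv_q: q %| (2 ^ f - 1)%N by apply: pdiv_dvd.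
have [|k Hk ok] := @Cauchy _ q H pr_q; first by rewrite (sl_oH slT).
have q_odd: odd q by apply: dvdn_odd dv_q _; rewrite -(sl_oH slT) (sl_oddH slT).
have ntk: k != 1 by rewrite -order_gt1 ok prime_gt1.
have: k \in phi @* Ht by rewrite phiHt.
case/morphimP=> g Lg Hg def_k; pose h := g.`_q.
have phih: phi h = k by rewrite morph_constt // -def_k constt_p_elt // /p_elt ok pnat_id.
have Hh: h \in Ht by rewrite groupX.
have odd_h: 2^'.-elt h.
  apply: sub_p_elt (p_elt_constt q g) => r /eqP->; rewrite !inE; apply: contraTneq q_odd => -> //.
(* [k] has no fixed points on [A^#], so [q] divides [2 ^ j - 1] with [|A| = 2 ^ j]. *)
have irrU (A : {group tT}) : A \subset U -> phi h \in 'N(A) -> A :=: 1 \/ A :=: U.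
  rewrite phih => sAU nAk; have [j oA] := p_natP (pgroupS sAU (sl_2group_U slT)).
  have qk: q.-group <[k]> by rewrite /pgroup -orderE ok pnat_id.
  have cAk: 'C_A[k] = 1.
    apply/trivgP; rewrite -(sl_CU slT (_ : k \in H^#)) ?setSI //.
    by rewrite !inE ntk.
  have := pgroup_fix_mod (to := 'J) qk (_ : [acts <[k]>, on A | 'J]).
  rewrite astabsJ cycle_subG nAk afixJ cent_cycle cAk cards1 oA => /(_ isT)/eqP.
  rewrite eqn_mod_dvd ?expn_gt0 // => dvj.
  have le_jf: j <= f.
    by rewrite -(leq_exp2l _ _ (ltnSn 1)) -oA -(sl_oU slT) subset_leq_card.
  have [lt_jf | le_fj] := ltnP j f.
    left; apply/card1_trivg; rewrite oA.
    by rewrite (sl_small_2power slT pr_q dv_q lt_jf dvj).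
  by right; apply/eqP; rewrite eqEcard sAU oA (sl_oU slT) leq_exp2l.
have ntph: phi h != 1 by rewrite phih.
have sQL: [~: P, <[h]>] \subset L.
  by apply: subset_trans sPL; rewrite commg_subl cycle_subG (subsetP preH_norm_P).
have phiQ := morphim_Q Hh odd_h ntph.
have injQ := inj_Q Hh odd_h irrU ntph.
by rewrite (trivial_ker sQL phiQ injQ (preH_norm_Q Hh)).
Qed.

(** Now [L] is a copy of [T].  If [z] divides [2 ^ f - 1], then an element
    of order [z] of [H] normalizes [U] without fixed points, and [U] would act
    trivially; if [z] divides [2 ^ f + 1], then [BN_fixed_vector] applies.  The bound
    [z <= 2 ^ f] required there holds because [3] divides [2 ^ f + 1]. *)
Lemma minimal_extension_absurd : False.
Proof.
have injphi := injective_phi; pose rTf y := rL (invm injphi y).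
have invL y : y \in T -> invm injphi y \in L.
  by rewrite -phiL => /morphimP[g _ Lg ->]; rewrite invmE.
have rT_repr : mx_repr T rTf.
  split=> [|y1 y2 Ty1 Ty2]; first by rewrite /rTf morph1 repr_mx1.
  by rewrite /rTf morphM ?phiL // repr_mxM ?invL.
pose rT := MxRepresentation rT_repr.
have oTL: #|T| = #|L| by rewrite -phiL card_injm.
have pcharT: [pchar F]%R^'.-group T by rewrite /pgroup oTL.
have nofixT y : y \in T -> #[y] = z -> ~~ eigenvalue (rT y) 1%R.
  move=> Ty oy; apply: nofix; first exact: invL.
  by rewrite (order_injm (injm_invm injphi)) //= phiL.

case: (sl_pi slT zT) => [z2|dvz|dvz].
- by have := prime_odd; rewrite z2.
- have [|x Hx ox] := @Cauchy _ z H pr_z; first by rewrite (sl_oH slT).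
  have Tx := subsetP (bn_sHT bnT) x Hx.
  have Uu: u \in U by case/setD1P: (bn_Uu bnT).
  have Tu := subsetP (bn_sUT bnT) u Uu.
  have: rT u = 1%:M%R.
    apply: (Frobenius_kernel_trivial pcharT (bn_sUT bnT) Tx _ _ _ (nofixT x Tx ox) Uu).
    - exact: subsetP (bn_nUH bnT) x Hx.
    - by rewrite ox.
    by apply: (sl_CU slT); rewrite !inE Hx andbT -order_gt1 ox prime_gt1.
  rewrite -(repr_mx1 rL) => /(mx_faithful_inj faithL (invL u Tu) (group1 L)) u1.
  have := bn_Uu bnT; rewrite !inE -[u in u != 1](invmK injphi) ?phiL //.
  by rewrite u1 morph1 eqxx.
have [x [Tx ox xw tiX]] := sl_torus slT pr_z dvz.
case/negP: (nofixT x Tx ox).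
apply: (BN_fixed_vector bnT (sl_oddH slT) (esym (bn_joing bnT)) rT pcharT) => //.
- rewrite ox; exact: prime_odd.
- by rewrite /= (bn_joing bnT).
rewrite ox (sl_oU slT) -ltnS ltn_neqAle -[(2 ^ f).+1%N]addn1 (dvdn_leq _ dvz) ?addn1 // andbT.
apply/eqP=> def_z.
have dv3: 3 %| z by have := sl_dvd3 slT; rewrite addn1 -def_z.
have z3: z = 3 by have /(prime_nt_dvdP pr_z) <- := dv3.
have : 2 ^ 1 < 2 ^ f by rewrite ltn_exp2l // (ltn_trans _ (sl_f_ge5 slT)).
by rewrite expn1 -ltnS -def_z z3.
Qed.

End MinimalExtension.

(** * Fixed vectors in representations of extensions *)

(** Minimality, irreducibility and faithfulness are free: pass to a smaller
    subgroup onto [T], to a simple submodule, or to the quotient by the kernel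
    of the representation.  Each passage lifts elements of order [z] with a
    nonzero fixed vector. *)
Theorem extension_fixed_vector (tT : finGroupType) (T U H : {group tT})
    (w u : tT) (f : nat) (gT : finGroupType) (L : {group gT})
    (phi : {morphism L >-> tT}) (F : closedFieldType) (d : nat)
    (rL : mx_representation F L d) (z : nat) :
    sl2_like T U H w u f -> phi @* L = T ->
    [pchar F]%R^'.-group L -> 0 < d -> prime z -> z \in \pi(T) ->
  [exists x in L, (#[x] == z) && eigenvalue (rL x) 1%R].
Proof.
move=> slT; have [m] := ubnP #|L|; elim: m gT L phi d rL => // m IHm gT L phi d rL.
rewrite ltnS => leLm phiL pcharL d_gt0 pr_z zT.
have [[M /and3P[sML ltM /eqP phiM]]|minL] :=
  altP (@existsP _ (fun M : {group gT} => [&& M \subset L, #|M| < #|L| & phi @* M == T])).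
  have := IHm _ M [morphism of restrm sML phi] d (subg_repr rL sML) (leq_trans ltM leLm).
  rewrite morphim_restrm setIid (pgroupS sML pcharL) => /(_ phiM isT d_gt0 pr_z zT) /exists_inP[x Mx evx].
  by apply/exists_inP; exists x; rewrite ?(subsetP sML).
have {}minL (M : {group gT}) : M \subset L -> phi @* M = T -> M :=: L.
  move=> sML phiM; apply/eqP; rewrite eqEcard sML /= leqNgt; apply: contra minL => ltM.
  by apply/existsP; exists M; rewrite sML ltM phiM /=.
have nz1: (1%:M != 0 :> 'M[F]_d)%R by rewrite -mxrank_eq0 mxrank1 -lt0n.
apply: (mxsimple_exists (mxmodule1 rL) nz1) => -[V simV _].
have modV := mxsimple_module simV; pose rV := submod_repr modV.
have irrV: mx_irreducible rV by apply/submod_mx_irr.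
suffices /exists_inP[x Lx /andP[ox /eigenvalueP[v fixv nzv]]]:
    [exists x in L, (#[x] == z) && eigenvalue (rV x) 1%R].
  apply/exists_inP; exists x; rewrite // ox /=.
  apply/eigenvalueP; exists (val_submod v); rewrite ?val_submod_eq0 //.
  by rewrite scale1r -(val_submodJ modV) // [submod_mx _ _]/(rV x) fixv scale1r.
have [faithV | /subsetPn[y kery /set1P nty]] := boolP (mx_faithful rV).
  apply: contraT => /exists_inPn nofix; exfalso.
  apply: (minimal_extension_absurd slT phiL minL pcharL irrV faithV pr_z zT) => x Lx ox.
  by have := nofix x Lx; rewrite ox eqxx.
have nsR := rker_normal rV; have [sRL nRL] := andP nsR.
have [_ simT] := simpleP _ (sl_simple slT).
have [|kerR|phiR] := simT (phi @* rker rV)%G; first by rewrite -phiL morphim_normal.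
- have sRK: rker rV \subset 'ker phi by rewrite -sub_morphim_pre ?kerR.
  have sKQ: 'ker (coset (rker rV)) \subset 'ker phi by rewrite ker_coset.
  have ntR: rker rV != 1 by apply/trivgPn; exists y => //; apply/eqP.
  have ltQ: #|L / rker rV| < m by apply: leq_trans leLm; rewrite ltn_quotient.
  have := IHm _ (L / rker rV)%G [morphism of factm sKQ nRL] _ (kquo_repr rV) ltQ.
  rewrite /= morphim_factm phiL quotient_pgroup //.
  have: 0 < \rank V by rewrite lt0n mxrank_eq0; case: simV.
  move=> rV_gt0 /(_ erefl isT rV_gt0 pr_z zT)/exists_inP[_ /morphimP[x nRx Lx ->]].
  case/andP=> /eqP ox evq; have evx: eigenvalue (rV x) 1%R by rewrite -kquo_repr_coset.
  have dv_z: z %| #[x] by rewrite -ox morph_order.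
  apply/exists_inP; exists (x ^+ (#[x] %/ z)); first exact: groupX.
  rewrite eigenvalue1_expg // andbT orderXdiv ?dvdn_div // divnA // mulKn //.
have: z %| #|rker rV|.
  apply: dvdn_trans (dvdn_morphim phi _); rewrite phiR.
  by move: zT; rewrite mem_primes => /and3P[].
case/(Cauchy pr_z) => x Rx ox; have [Lx rx1] := rkerP Rx.
apply/exists_inP; exists x; rewrite // ox eqxx rx1.
have: 0 < \rank V by rewrite lt0n mxrank_eq0; case: simV.
case: (\rank V) => // k _; apply/eigenvalueP; exists (const_mx 1%R).
  by rewrite scale1r mulmx1.
by apply/eqP=> /rowP/(_ ord0)/eqP; rewrite !mxE oner_eq0.
Qed.

(** * Matrices of SL(2, 2 ^ f) *)

Lemma prod_of_order (gT : finGroupType) (G : {group gT}) (y h : gT) n :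
    y \in G -> h \in G -> #[y] = n -> #[y * h] = n ->
  exists x1 x2, [/\ x1 \in G, x2 \in G, #[x1] = n, #[x2] = n & h = x1 * x2].
Proof.
by move=> Gy Gh oy oyh; exists y^-1, (y * h); rewrite groupV groupM ?orderV ?mulKg.
Qed.

Section SpecialLinear2.

Variables (F : finFieldType) (f : nat).
Hypotheses (pr_f : prime f) (f_ge5 : 4 < f) (oF : #|F| = (2 ^ f)%N).

Local Open Scope ring_scope.

Let pchar2 : 2 \in [pchar F]. Proof. exact: card_finPcharP oF _. Qed.
Let two0 : 2%:R = 0 :> F. Proof. by case/andP: pchar2 => _ /eqP. Qed.


Definition mx2 (a b c d : F) : 'M[F]_2 :=
  \matrix_(i < 2, j < 2) if i == 0 then if j == 0 then a else b
                          else if j == 0 then c else d.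

Lemma mx2P (A B : 'M[F]_2) : A 0 0 = B 0 0 -> A 0 1 = B 0 1 -> A 1 0 = B 1 0 ->
  A 1 1 = B 1 1 -> A = B.
Proof.
move=> e00 e01 e10 e11; apply/matrixP=> i j.
have ord2 (k : 'I_2) : k = 0 \/ k = 1.
  by case: k => [[|[|k]] lt_k2] //; [left | right]; apply: val_inj.
by case: (ord2 i) => ->; case: (ord2 j) => ->.
Qed.

Lemma mx2M a b c d a' b' c' d' : mx2 a b c d *m mx2 a' b' c' d' =
  mx2 (a * a' + b * c') (a * b' + b * d') (c * a' + d * c') (c * b' + d * d').
Proof. by apply: mx2P; rewrite !mxE !big_ord_recl big_ord0 !mxE /= addr0. Qed.

Lemma mx2_det a b c d : \det (mx2 a b c d) = a * d + b * c.
Proof.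
rewrite (expand_det_row _ 0) !big_ord_recl big_ord0 /cofactor !det_mx11 !mxE /=.
by rewrite expr0 expr1 (oppr_pchar2 pchar2); ring.
Qed.

(** The value is the intended one when [a * d + b * c = 1]; in characteristic
    two this is the condition that the determinant be [1]. *)
Definition sl2 a b c d : {'GL_2[F]} := insubd (1%g : {'GL_2[F]}) (mx2 a b c d).

Lemma sl2_val a b c d : a * d + b * c = 1 -> GLval (sl2 a b c d) = mx2 a b c d.
Proof.
move=> det1; have uM: mx2 a b c d \in unitmx by rewrite unitmxE mx2_det det1 unitr1.
by rewrite /sl2; apply: insubdK.
Qed.

Lemma mem_SL2 a b c d : a * d + b * c = 1 -> sl2 a b c d \in SL 2 F.
Proof. by move=> det1; rewrite inE sl2_val // mx2_det det1. Qed.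

Lemma SL2P g : g \in SL 2 F ->
  exists a b c d : F, a * d + b * c = 1 /\ g = sl2 a b c d.
Proof.
rewrite inE => /eqP det1; pose A : 'M[F]_2 := GLval g.
have defA: A = mx2 (A 0 0) (A 0 1) (A 1 0) (A 1 1) by apply: mx2P; rewrite !mxE.
have detA: A 0 0 * A 1 1 + A 0 1 * A 1 0 = 1 by rewrite -mx2_det -defA.
exists (A 0 0), (A 0 1), (A 1 0), (A 1 1); split=> //.
by apply: (val_inj : injective (@GLval 2 F)); rewrite sl2_val -?defA.
Qed.

Lemma sl2M a b c d a' b' c' d' : a * d + b * c = 1 -> a' * d' + b' * c' = 1 ->
  (sl2 a b c d * sl2 a' b' c' d')%g =
  sl2 (a * a' + b * c') (a * b' + b * d') (c * a' + d * c') (c * b' + d * d').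
Proof.
move=> det1 det1'; apply: (val_inj : injective (@GLval 2 F)).
rewrite GL_MxE !sl2_val ?mx2M // -[RHS]mulr1 -{1}det1 -det1'; ring: two0.
Qed.

Lemma sl2_1 : sl2 1 0 0 1 = 1%g.
Proof.
apply: (val_inj : injective (@GLval 2 F)); rewrite sl2_val ?mulr1 ?mulr0 ?addr0 //.
by rewrite -[RHS]/(1%:M); apply: mx2P; rewrite !mxE.
Qed.

Lemma sl2V a b c d : a * d + b * c = 1 -> ((sl2 a b c d)^-1)%g = sl2 d b c a.
Proof.
move=> det1; apply: (mulgI (sl2 a b c d)); rewrite mulgV -sl2_1.
rewrite sl2M ?[d * a]mulrC //.
by congr sl2; rewrite -?det1; ring: two0.
Qed.

Lemma sl2_inj a b c d a' b' c' d' : a * d + b * c = 1 -> a' * d' + b' * c' = 1 ->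
  sl2 a b c d = sl2 a' b' c' d' -> [/\ a = a', b = b', c = c' & d = d'].
Proof.
move=> det1 det1' /(congr1 GLval); rewrite !sl2_val // => /matrixP eqM.
split; [have := eqM 0 0 | have := eqM 0 1 | have := eqM 1 0 | have := eqM 1 1];
  by rewrite !mxE.
Qed.

Definition unip t := sl2 1 t 0 1.
Definition torus a := sl2 a 0 0 a^-1.
Definition weyl := sl2 0 1 1 0.

Let unip_det t : 1 * 1 + t * 0 = 1 :> F. Proof. by ring. Qed.
Let torus_det (a : F) : a != 0 -> a * a^-1 + 0 * 0 = 1. Proof. by move=> a0; field. Qed.
Let weyl_det : 0 * 0 + 1 * 1 = 1 :> F. Proof. by ring. Qed.

Lemma unipM s t : (unip s * unip t)%g = unip (s + t).
Proof. by rewrite /unip sl2M //; congr sl2; ring. Qed.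

Lemma torusM (a b : F) : a != 0 -> b != 0 -> (torus a * torus b)%g = torus (a * b).
Proof. by move=> a0 b0; rewrite /torus sl2M ?torus_det //; congr sl2; field; rewrite ?a0 ?b0. Qed.

Lemma unip_inj : injective unip.
Proof. by move=> s t /sl2_inj[]. Qed.

Lemma torus_inj (a b : F) : a != 0 -> b != 0 -> torus a = torus b -> a = b.
Proof. by move=> a0 b0 /sl2_inj[]; rewrite ?torus_det. Qed.

Lemma torusV (a : F) : a != 0 -> ((torus a)^-1)%g = torus a^-1.
Proof. by move=> a0; rewrite /torus sl2V ?torus_det ?invrK. Qed.

Lemma unipJ (a t : F) : a != 0 -> (unip t ^ torus a)%g = unip (t / a ^+ 2).
Proof.
move=> a0; have a0' : a^-1 != 0 by rewrite invr_eq0.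
rewrite conjgE torusV // /torus /unip !sl2M ?invrK //; try (field; rewrite ?a0 //).
by congr sl2; field.
Qed.

Definition unip_set := [set unip t | t : F].
Definition torus_set := [set torus a | a in [set a : F | a != 0]].

Lemma unip_group_set : group_set unip_set.
Proof.
apply/group_setP; split; first by apply/imsetP; exists 0; rewrite // -sl2_1.
by move=> _ _ /imsetP[s _ ->] /imsetP[t _ ->]; rewrite unipM imset_f.
Qed.
Canonical unip_group := Group unip_group_set.

Lemma torus_group_set : group_set torus_set.
Proof.
apply/group_setP; split.
  by apply/imsetP; exists 1; rewrite ?inE ?oner_neq0 // -sl2_1 /torus invr1.
move=> _ _ /imsetP[a a0 ->] /imsetP[b b0 ->]; rewrite !inE in a0 b0.
by rewrite torusM ?imset_f // inE mulf_neq0.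
Qed.
Canonical torus_group := Group torus_group_set.

Lemma weyl2 : (weyl * weyl)%g = 1%g.
Proof. by rewrite -sl2_1 /weyl sl2M //; congr sl2; ring. Qed.

Lemma weylV : (weyl^-1)%g = weyl.
Proof. by rewrite /weyl sl2V. Qed.

Lemma sl2Jw a b c d : a * d + b * c = 1 -> (sl2 a b c d ^ weyl)%g = sl2 d c b a.
Proof.
move=> det1; rewrite conjgE weylV /weyl !sl2M //; first by congr sl2; ring.
by rewrite -[RHS]det1; ring.
Qed.

Lemma borelP a b c d : a * d + b * c = 1 ->
  reflect (c = 0) (sl2 a b c d \in unip_set * torus_set)%g.
Proof.
move=> det1; apply: (iffP idP) => [/mulsgP[_ _ /imsetP[t _ ->] /imsetP[e e0 ->]]|c0].
  rewrite !inE in e0; rewrite sl2M ?torus_det // => /sl2_inj[] //.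
    by field.
  by move=> _ _ -> _; ring.
have ad1: a * d = 1 by rewrite -det1 c0; ring.
have a0: a != 0 by apply: contra_eq_neq ad1 => ->; rewrite mul0r eq_sym oner_eq0.
apply/mulsgP; exists (unip (b * a)) (torus a); rewrite ?imset_f ?inE //.
rewrite sl2M ?torus_det //; congr sl2; rewrite ?c0; try field => //; try by ring.
by apply: (mulfI a0); rewrite ad1; field.
Qed.

Lemma bruhat g : g \in SL 2 F -> g \notin (unip_set * torus_set)%g ->
  exists2 b, b \in (unip_set * torus_set)%g & exists2 y, y \in unip_set & g = (b * weyl * y)%g.
Proof.
case/SL2P=> a [b [c [d [det1 ->]]]] /borelP; move/(_ det1)/eqP => c0.
exists (unip (a / c)%R * torus c^-1%R)%g.
  by rewrite mem_mulg // imset_f // inE invr_eq0.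
exists (unip (d / c)); first exact: imset_f.
have def_b : b = (a * d + 1) / c.
  by apply: (mulIf c0); rewrite divfK // -det1; ring: two0.
rewrite !sl2M ?torus_det ?invr_eq0 //.
- by congr sl2; rewrite ?def_b; field; rewrite c0 ?oner_neq0.
all: by field; rewrite c0 ?oner_neq0.
Qed.

Lemma card_unip : #|unip_group| = (2 ^ f)%N.
Proof. by rewrite card_imset ?oF //; apply: unip_inj. Qed.

Lemma card_torus : #|torus_group| = (2 ^ f - 1)%N.
Proof.
rewrite card_in_imset => [|a b]; last by rewrite !inE; apply: torus_inj.
by rewrite -oF subn1 -(cardC1 0); apply: eq_card => a; rewrite !inE.
Qed.

Lemma cyclic_torus : cyclic torus_group.
Proof.
pose ev (g : {'GL_2[F]}) : F := GLval g 0 0.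
have evE a : a != 0 -> ev (torus a) = a.
  by move=> a0; rewrite /ev sl2_val ?torus_det ?mxE.
apply: (@field_mul_group_cyclic _ _ _ ev) => [_ _ /imsetP[a a0 ->] /imsetP[b b0 ->]|].
  by rewrite !inE in a0 b0; rewrite torusM // !evE ?mulf_neq0.
move=> _ /imsetP[a a0 ->]; rewrite inE in a0; rewrite evE //.
split=> [-> | eq1]; first by rewrite /torus invr1 sl2_1.
by rewrite -(evE a) // eq1 /ev GL_1E mxE.
Qed.

(** The Frobenius endomorphism of a finite field of characteristic two is
    bijective. *)
Lemma sqr_root (a : F) : exists b : F, b ^+ 2 = a.
Proof.
exists (a ^+ (2 ^ f.-1)); rewrite -exprM -expnSr prednK ?prime_gt0 //.
by rewrite -oF expf_card.
Qed.

Lemma SL2_split_BN_pair :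
  split_BN_pair (SL_group 2 F) unip_group torus_group weyl (unip 1).
Proof.
have sUT : unip_set \subset SL 2 F.
  by apply/subsetP=> _ /imsetP[t _ ->]; apply: mem_SL2.
have sHT : torus_set \subset SL 2 F.
  by apply/subsetP=> _ /imsetP[a a0 ->]; apply: mem_SL2; rewrite inE in a0; apply: torus_det.
have unip_neq1 t : (unip t != 1%g) = (t != 0).
  by rewrite -sl2_1 -/(unip 0) (inj_eq unip_inj).
split=> //.
- exact: mem_SL2.
- by rewrite !inE unip_neq1 oner_neq0 imset_f.
- apply/subsetP=> _ /imsetP[a a0 ->]; rewrite inE in a0; rewrite inE.
  by apply/subsetP=> _ /imsetP[_ /imsetP[t _ ->] ->]; rewrite unipJ // imset_f.
- exact: cyclic_torus.
- by rewrite card_unip card_torus -subSn ?subSS ?subn0 ?expn_gt0.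
- move=> _ /imsetP[t _ ->]; rewrite unipM -sl2_1 -/(unip 0); congr unip; ring: two0.
- exact: weyl2.
- move=> _ /imsetP[a a0 ->]; rewrite inE in a0.
  by rewrite torusV // /torus sl2Jw ?torus_det // invrK.
- pose simp := (mul0r, mulr0, mul1r, mulr1, addr0, add0r, addrr_pchar2 pchar2).
  by rewrite {2}/unip sl2Jw // /unip !sl2M ?simp.
- move=> y /setD1P[nt1 /imsetP[t _ def_t]]; move: nt1; rewrite {}def_t unip_neq1 => t0.
  have [b def_b] := sqr_root t^-1; have b0: b != 0.
    by apply: contraNneq t0 => b0; rewrite -invr_eq0 -def_b b0 expr0n.
  exists (torus b); first by rewrite imset_f ?inE.
  by rewrite unipJ // def_b invrK mul1r.
- by move=> g; apply: bruhat.
move=> _ /imsetP[t _ ->]; rewrite {1}/unip sl2Jw // => /borelP-> //; last by ring.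
by rewrite -sl2_1.
Qed.

Lemma card_GL2 : #|'GL_2[F]%g| = (2 ^ f * ((2 ^ f - 1) * ((2 ^ f - 1) * (2 ^ f + 1))))%N.
Proof.
have sqr1: ((2 ^ f - 1) * (2 ^ f + 1) = (2 ^ f) ^ 2 - 1)%N by rewrite -subn_sqr exp1n.
by rewrite (card_GL F (isT : 0 < 2)%N) oF big_ltn // big_nat1 !expn1 sqr1.
Qed.

Lemma SL2_prime_divisors z : z \in \pi(SL 2 F) ->
  [\/ z = 2, z %| 2 ^ f - 1 | z %| 2 ^ f + 1]%N.
Proof.
rewrite mem_primes cardG_gt0 /= => /andP[pr_z /dvdn_trans/(_ (cardSg (subsetT _)))].
rewrite card_GL2 !Euclid_dvdM // Euclid_dvdX // dvdn_prime2 //.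
case/orP=> [/andP[/eqP]|/orP[|/orP[]]];
  by [constructor 1 | constructor 2 | constructor 3].
Qed.

Lemma card_borel : #|unip_set * torus_set|%g = (2 ^ f * (2 ^ f - 1))%N.
Proof.
have bn := SL2_split_BN_pair; have oddH : odd #|torus_group|.
  by rewrite card_torus oddB ?expn_gt0 // oddX orbF; case: (f) f_ge5.
by rewrite TI_cardMg ?(bn_tiUH bn) // card_unip card_torus.
Qed.

(** An element [x0] of order [z] of [GL(2, F)] has determinant [1], as the orders
    of [x0] and of [F^*] are coprime, and neither off-diagonal entry vanishes,
    as the Borel subgroup has no elements of order [z].  Conjugation by a
    diagonal matrix makes [x0] symmetric, and [weyl] inverts the symmetric
    matrices of determinant [1]. *)
Lemma SL2_inverted z : prime z -> (z %| 2 ^ f + 1)%N -> exists x : {'GL_2[F]},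
  [/\ x \in SL 2 F, #[x]%g = z, (x ^ weyl)%g = (x^-1)%g
    & (<[x]> :&: (unip_set * torus_set) = 1)%g].
Proof.
move=> pr_z dvz; have odd_z : odd z.
  by apply: dvdn_odd dvz _; rewrite oddD oddX; case: (f) f_ge5.
have z_dvdq1 : ~~ (z %| 2 ^ f - 1)%N.
  apply: contraL odd_z => dvz1; have: (z %| 2)%N.
    by rewrite -(dvdn_addr _ dvz1); apply: dvdn_trans dvz _; rewrite addnBAC ?expn_gt0 // addn2 subn1 addn1.
  by rewrite dvdn_prime2 // => /eqP->.
have [|x0 _ ox0] := @Cauchy _ z 'GL_2[F] pr_z.
  by rewrite card_GL2 !dvdn_mull.
have det_x0 : \det (GLval x0) = 1.
  have detX n : \det (GLval (x0 ^+ n)%g) = \det (GLval x0) ^+ n.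
    by elim: n => [|n IHn]; rewrite ?det1 // expgS GL_MxE det_mulmx IHn exprS.
  have exp_q1 (e : F) : e != 0 -> e ^+ (2 ^ f - 1) = 1.
    move=> e0; apply: (mulfI e0).
    by rewrite -exprS subn1 prednK ?expn_gt0 // -oF expf_card mulr1.
  have co_zq : coprime z (2 ^ f - 1) by rewrite prime_coprime.
  have [[c e] /= bezout] := coprimeP _ (prime_gt0 pr_z) co_zq.
  have def_cz : (c * z = 1 + e * (2 ^ f - 1))%N.
    by rewrite -[X in (X + _)%N]bezout subnK // ltnW // -subn_gt0 bezout.
  have := detX (z * c)%N; rewrite expgM -ox0 expg_order expg1n det1 ox0.
  by rewrite mulnC def_cz exprD expr1 mulnC exprM exp_q1 ?GL_det // expr1n mulr1.
have SLx0 : x0 \in SL 2 F by rewrite inE det_x0.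
have bn := SL2_split_BN_pair; have notB (x : {'GL_2[F]}) : #[x]%g = z ->
    x \notin (unip_set * torus_set)%g.
  move=> ox; apply: contra z_dvdq1 => Bx.
  have: (z %| 2 ^ f * (2 ^ f - 1))%N.
    by rewrite -card_borel -ox -(bn_joing bn) order_dvdG //= (bn_joing bn).
  rewrite Euclid_dvdM // Euclid_dvdX // dvdn_prime2 //.
  by case/orP=> // /andP[/eqP z2]; rewrite z2 in odd_z.
case/SL2P: SLx0 => a [b [c [d [detg def_x0]]]].
have c0 : c != 0 by have := notB _ ox0; rewrite def_x0 => /(borelP detg)/eqP.
have b0 : b != 0.
  have := notB (x0 ^ weyl)%g; rewrite orderJ def_x0 sl2Jw // => /(_ (etrans _ ox0)).
  by rewrite def_x0 => /(_ erefl)/borelP/eqP; apply; rewrite -detg; ring.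
have [e2 def_e2] := sqr_root (b / c); have [e def_e] := sqr_root e2.
have e0 : e != 0.
  apply: contraTneq (mulf_neq0 b0 (invr_neq0 c0)) => e0.
  by rewrite -def_e2 -def_e e0 !expr0n eqxx.
exists (x0 ^ torus e)%g.
have symm : b / e ^+ 2 = c * e ^+ 2.
  rewrite def_e; have e20 : e2 != 0 by rewrite -def_e expf_neq0.
  by apply: (mulIf e20); rewrite divfK // -mulrA -expr2 def_e2; field.
have def_x : (x0 ^ torus e)%g = sl2 a (b / e ^+ 2) (c * e ^+ 2) d.
  have e0' := invr_neq0 e0; rewrite conjgE torusV // def_x0 /torus !sl2M ?torus_det //.
    by congr sl2; field; rewrite ?e0 ?oner_neq0.
  by rewrite -[RHS]detg; field; rewrite ?e0 ?oner_neq0.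
have detx : a * d + b / e ^+ 2 * (c * e ^+ 2) = 1 by rewrite -[RHS]detg; field.
have SLx : (x0 ^ torus e)%g \in SL 2 F by rewrite def_x mem_SL2.
have ox : #[x0 ^ torus e]%g = z by rewrite orderJ.
split=> //; first by rewrite def_x sl2Jw // sl2V // symm.
rewrite -(bn_joing bn); apply: prime_TIg; first by rewrite -orderE ox.
by rewrite cycle_subG /= (bn_joing bn) notB.
Qed.

(** The minimal polynomial divides ['X^2 + 'X + 1]. *)
Lemma order3_trace1 a b c : a * (a + 1) + b * c = 1 -> #[sl2 a b c (a + 1)]%g = 3.
Proof.
move=> det1; set x := sl2 _ _ _ _.
have x2 : (x * x)%g = (x^-1)%g.
  rewrite /x sl2V // sl2M //; congr sl2; try ring: two0.
    by rewrite -[X in _ = _ + X]det1; ring: two0.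
  have -> : c * b + (a + 1) * (a + 1) = (a * (a + 1) + b * c) + (a + 1) by ring.
  by rewrite det1; ring: two0.
have x3 : (x ^+ 3 = 1)%g by rewrite !expgS expg0 mulg1 x2 mulgV.
apply: (nt_prime_order (isT : prime 3) x3); apply/eqP; rewrite -sl2_1 => /sl2_inj[] //; try by ring.
by move=> -> _ _ /eqP; rewrite eq_sym addrr_pchar2 // oner_eq0.
Qed.

(** [y] is chosen such that both [y] and [y * h] have trace [1]. *)
Lemma SL2_prod_order3 h : h \in (torus_group^#)%g -> exists x1 x2 : {'GL_2[F]},
  [/\ x1 \in SL 2 F, x2 \in SL 2 F, #[x1]%g = 3, #[x2]%g = 3 & h = (x1 * x2)%g].
Proof.
case/setD1P=> nth /imsetP[a a0 def_h]; rewrite inE in a0.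
have a2_neq1 : a + a^-1 != 0.
  apply: contraNneq nth => /eqP; rewrite addr_eq0 (oppr_pchar2 pchar2) => /eqP aV.
  have : a ^+ 2 == 1 by rewrite expr2 {2}aV mulfV.
  rewrite sqrf_eq1 (oppr_pchar2 pchar2) orbb => /eqP a1.
  by rewrite def_h a1 /torus invr1 sl2_1.
(* The solution [p] of [p * a + (p + 1) * a^-1 = 1], the trace of [y * h]. *)
pose p := (1 + a^-1) / (a + a^-1).
have tr2: (p + 1) * a^-1 = p * a + 1.
  have: p * (a + a^-1) = 1 + a^-1 by rewrite divfK.
  move=> eqp; have ->: (p + 1) * a^-1 = p * (a + a^-1) + a^-1 + p * a by rewrite mulrDr; ring: two0.
  rewrite eqp; ring: two0.
have detp: p * (p + 1) + 1 * (p * (p + 1) + 1) = 1 by ring: two0.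
have [y def_y] : exists y, y = sl2 p 1 (p * (p + 1) + 1) (p + 1) by eexists.
have SLy : y \in SL_group 2 F by rewrite def_y; apply: mem_SL2.
have SLh : h \in SL_group 2 F by rewrite def_h; apply/mem_SL2/torus_det.
have def_yh : (y * h)%g = sl2 (p * a) a^-1 ((p * (p + 1) + 1) * a) (p * a + 1).
  by rewrite def_h def_y /torus sl2M ?torus_det // -tr2; congr sl2; ring.
have oy : #[y]%g = 3 by rewrite def_y; apply: order3_trace1.
apply: (prod_of_order SLy SLh oy).
rewrite def_yh; apply: order3_trace1; rewrite -tr2.
by rewrite -[RHS]detp; field.
Qed.

Lemma SL2_center : 'Z(SL 2 F)%g = 1%g.
Proof.
apply/trivgP/subsetP=> g /setIP[SLg /centP cg].
have [a [b [c [d [det1 def_g]]]]] := SL2P SLg.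
have /conjg_fixP : [~ g, weyl]%g == 1%g by apply/commgP/cg/mem_SL2.
rewrite def_g sl2Jw // => /sl2_inj[||def_d def_c _ _]; rewrite // ?[d * a]mulrC ?[c * b]mulrC //.
have: (g * unip 1%R = unip 1%R * g)%g by apply/cg/mem_SL2.
rewrite def_g !sl2M // => /sl2_inj[||+ _ _ _].
- by rewrite -[RHS]det1; ring: two0.
- by rewrite -[RHS]det1; ring: two0.
rewrite !(mulr1, mul1r, mulr0, mul0r, addr0, add0r) => eq_a.
have c0 : c = 0 by apply: (addrI a); rewrite addr0 -eq_a.
have b0 : b = 0 by rewrite -def_c.
have: a ^+ 2 == 1 by rewrite -det1 b0 def_d mul0r addr0 expr2.
rewrite sqrf_eq1 (oppr_pchar2 pchar2) orbb => /eqP a1.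
by rewrite def_d a1 c0 b0 sl2_1 inE.
Qed.

Lemma SL2_isog_PSL : (SL_group 2 F \isog PSL_group 2 F)%g.
Proof.
have isog_quo (gT : finGroupType) (G : {group gT}) N : (N = 1 -> G \isog G / N)%g.
  by move=> ->; apply: quotient1_isog.
exact: isog_quo SL2_center.
Qed.

Lemma SL2_like : simple (PSL_group 2 F) ->
  sl2_like (SL_group 2 F) unip_group torus_group weyl (unip 1) f.
Proof.
move=> simPSL; split=> //.
- exact: SL2_split_BN_pair.
- by rewrite (isog_simple SL2_isog_PSL).
- exact: card_unip.
- exact: SL2_prime_divisors.
- exact: SL2_inverted.
exact: SL2_prod_order3.
Qed.

End SpecialLinear2.

(** * Simple sections of subnormal subgroups *)

Section CompositionSeries.

Variables (gT rT : finGroupType) (T : {group rT}).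
Implicit Types G H K L M N : {group gT}.

(** A proper normal subgroup of [G] that contains [K] as a subnormal subgroup
    extends to a maximal normal one. *)
Lemma subnormal_maxnormal_path G K : K <|<| G ->
  exists2 s, path [rel x y : {group gT} | maxnormal y x x] G s & last G s = K.
Proof.
have [m] := ubnP #|G|; elim: m G => // m IHm G /ltnSE-leGm snK.
case: (subnormalEr snK) => [defK | [M [snKM nsMG prMG]]].
  by exists [::]; last exact/val_inj/esym.
have [N maxN sMN] : {N : {group gT} | maxnormal N G G & M \subset N}.
  by apply: maxgroup_exists; rewrite prMG normal_norm.
have prNG := maxnormal_proper maxN.
have snKN : K <|<| N.
  by apply: subnormal_trans snKM _; rewrite normal_subnormal // (normalS sMN (proper_sub prNG)).
have [s Ns defK] := IHm N (leq_trans (proper_card prNG) leGm) snKN.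
by exists (N :: s); rewrite //= maxN.
Qed.

Lemma composition_factor_subnormal G K L :
  K <|<| G -> maxnormal L K K -> composition_factor G (K / L)%sec.
Proof.
move=> snK maxL; have [s1 Gs1 defK] := subnormal_maxnormal_path snK.
have [s2 /andP[last_s2 Ls2]] := exists_comps L.
exists (s1 ++ L :: s2).
  by rewrite /comps last_cat /= last_s2 cat_path Gs1 defK /= maxL.
rewrite pairmap_cat mem_cat; apply/orP; right.
by rewrite /= defK mem_head.
Qed.

Lemma subnormal_composition_factor G (X : section gT) : composition_factor G X ->
  exists K, exists L, [/\ X = (K / L)%sec, K <|<| G & maxnormal L K K].
Proof.
case=> s /andP[_ cs]; elim: s G cs => //= H s IHs G /andP[maxH cs].
rewrite inE => /orP[/eqP-> | Xs]; first by exists G, H; rewrite subnormal_refl.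
have [K [L [defX snK maxL]]] := IHs H cs Xs; exists K, L; split=> //.
by apply: subnormal_trans snK _; rewrite normal_subnormal // maxnormal_normal.
Qed.

End CompositionSeries.

(** Unlike [rel_solvable], this property refers to no composition series, so it
    passes to subnormal subgroups and to quotients. *)
Definition simple_sections (gT rT : finGroupType) (G : {group gT}) (T : {group rT}) :=
  forall K L : {group gT}, K <|<| G -> maxnormal L K K ->
    cyclic (K / L) \/ K / L \isog T.

Lemma rel_solvable_sections (gT rT : finGroupType) (T : {group rT}) (G : {group gT}) :
  rel_solvable T G -> simple_sections G T.
Proof. by move=> relG K L snK maxL; exact: (relG (K / L)%sec (composition_factor_subnormal snK maxL)). Qed.

Lemma cosetpre_subnormal (gT : finGroupType) (N : {group gT}) (G K : {group coset_of N}) :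
  K <|<| G -> coset N @*^-1 K <|<| coset N @*^-1 G.
Proof.
case/subnormalP=> s; elim: s K => [|H s IHs] K /=; first by move=> _ <-; apply: subnormal_refl.
case/andP=> nsKH Hs defG; apply: subnormal_trans (IHs _ Hs defG).
by rewrite normal_subnormal // cosetpre_normal.
Qed.

Lemma simple_sections_quotient (gT rT : finGroupType) (T : {group rT})
    (G N : {group gT}) :
  N <| G -> simple_sections G T -> simple_sections (G / N) T.
Proof.
move=> nsNG secG K L snK maxL; have [sNG nNG] := andP nsNG.
have sKG := subnormal_sub snK; have [sLK nLK] := andP (maxnormal_normal maxL).
have preimage (A : {group coset_of N}) : A \subset G / N ->
    exists B : {group gT}, [/\ N <| B, B \subset G & A = (B / N)%G].
  case/(inv_quotientS nsNG)=> B defA sNB sBG; exists B; split=> //.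
    exact: normalS nsNG.
  exact: val_inj.
have [L0 [nsNL0 sL0G defL]] := preimage L (subset_trans sLK sKG).
have [K0 [nsNK0 sK0G defK]] := preimage K sKG.
subst K L; have nsL0K0 : L0 <| K0.
  by rewrite -(quotientGK nsNL0) -(quotientGK nsNK0) cosetpre_normal maxnormal_normal.
have iso : (K0 / N) / (L0 / N) \isog K0 / L0.
  by apply: third_isog; rewrite ?normal_sub.
have snK0 : K0 <|<| G.
  rewrite -(quotientGK nsNK0) -(quotientGK nsNG).
  exact: cosetpre_subnormal.
have maxL0 : maxnormal L0 K0 K0.
  by rewrite -quotient_simple // -(isog_simple iso) quotient_simple ?quotient_normal.
case: (secG K0 L0 snK0 maxL0) => [cycX | isoX]; [left | right].
  by rewrite (isog_cyclic iso).
exact: isog_trans isoX.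
Qed.

(** * Elements of composite order *)

Lemma exists_order (gT : finGroupType) (G : {group gT}) x m :
  x \in G -> m %| #[x] -> exists2 y, y \in G & #[y] = m.
Proof.
move=> Gx dv_m; exists (x ^+ (#[x] %/ m)); first exact: groupX.
by rewrite orderXdiv ?dvdn_div // divnA // mulKn.
Qed.

Lemma order_mul_primes (gT : finGroupType) (x y : gT) p q :
  prime p -> prime q -> p != q -> #[x] = p -> #[y] = q -> commute x y ->
  #[x * y] = (p * q)%N.
Proof.
move=> pr_p pr_q neq_pq ox oy cxy; rewrite orderM // ox oy //.
by rewrite prime_coprime // dvdn_prime2.
Qed.

(** The automorphism of [A] induced by [x] has order [1] or [n]. *)
Lemma cent_of_Aut_prime (gT : finGroupType) (A : {group gT}) x n :
  prime n -> ~~ (n %| #|Aut A|) -> x \in 'N(A) -> #[x] = n -> x \in 'C(A).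
Proof.
move=> pr_n nAut nAx ox; rewrite -ker_conj_aut; apply/kerP => //.
apply/eqP; rewrite -order_eq1; apply: contraR nAut => nt_x.
have <- : #[conj_aut A x] = n.
  by apply/(prime_nt_dvdP pr_n); rewrite // -ox morph_order.
by apply: order_dvdG; apply: (subsetP (Aut_conj_aut A 'N(A))); rewrite mem_morphim.
Qed.

Lemma isog_card_Aut (aT rT : finGroupType) (A : {group aT}) (B : {group rT}) :
  A \isog B -> #|Aut A| = #|Aut B|.
Proof. by case/isogP=> g injg <-; rewrite (card_isog (injm_Aut injg (subxx _))). Qed.

(** The [n]-th power of [y * x^-1] is the product [c n] of the conjugates of [y] by
    the powers of [x].  They lie in commuting subgroups, so [c n] has exponent
    [z]; and [c n] is not [1], since otherwise [y] would be a product of elements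
    of the centralizer of [A].  The factor [n] of the order comes from the image
    of [x] modulo [N]. *)
Lemma order_wreath (gT : finGroupType) (N A : {group gT}) x y n z :
    prime n -> prime z -> #[x] = n -> #[y] = z -> x \in 'N(N) -> x \notin N ->
    A \subset N -> y \in A -> 'Z(A) = 1 ->
    (forall k, 0 < k < n -> A :^ (x ^+ k) \subset 'C(A)) ->
  #[y * x^-1] = (z * n)%N.
Proof.
move=> pr_n pr_z ox oy nNx N'x sAN Ay ZA1 cAx; set g := y * x^-1.
pose c k := \prod_(i < k) y ^ (x ^+ i).
have gX k : g ^+ k = c k * x ^- k.
  elim: k => [|k IHk]; first by rewrite /c big_ord0 expg0 invg1 mulg1.
  rewrite expgSr IHk /c big_ord_recr /= conjgE [in RHS]expgS invMg -!mulgA.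
  by rewrite mulKVg.
have gn : g ^+ n = c n by rewrite gX -ox expg_order invg1 mulg1.
have yX k : (y ^ (x ^+ k)) ^+ z = 1 by rewrite -conjXg -oy expg_order conj1g.
have comm_y i k : i < k < n -> commute (y ^ (x ^+ k)) (y ^ (x ^+ i)).
  case/andP=> lt_ik lt_kn; rewrite -(subnK (ltnW lt_ik)) expgD conjgM.
  rewrite /commute -!conjMg; congr (_ ^ _).
  have ki_ok : 0 < k - i < n by rewrite subn_gt0 lt_ik (leq_ltn_trans (leq_subr _ _)).
  have cA : y ^ (x ^+ (k - i)) \in 'C(A) by rewrite (subsetP (cAx _ ki_ok)) ?memJ_conjg.
  exact: (centP cA).
have cz k : k <= n -> c k ^+ z = 1.
  elim: k => [|k IHk] lt_kn; first by rewrite /c big_ord0 expg1n.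
  have cyk : commute (y ^ (x ^+ k)) (c k).
    apply: (big_ind (commute _)) => [|v1 v2|i _]; [exact: commute1 | exact: commuteM |].
    by apply: comm_y; rewrite ltn_ord.
  by rewrite /c big_ord_recr /= -/(c k) expgMn ?(IHk (ltnW lt_kn)) ?yX ?mulg1 //.
have y_neq1 : y != 1 by rewrite -order_gt1 oy prime_gt1.
have ntc : c n != 1.
  apply: contra y_neq1 => /eqP; rewrite /c -(prednK (prime_gt0 pr_n)) big_ord_recl.
  rewrite expg0 conjg1 => /(canRL (mulgK _)); rewrite mul1g => def_y.
  rewrite -in_set1 -[[set 1]]ZA1 inE Ay def_y groupV group_prod // => i _ /=.
  have i1_ok : 0 < i.+1 < n by have := ltn_ord i; rewrite -ltnS (prednK (prime_gt0 pr_n)).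
  by rewrite (subsetP (cAx _ i1_ok)) ?memJ_conjg.
have dv_g : n %| #[g].
  have nNxV : x^-1 \in 'N(N) by rewrite groupV.
  have nNy : y \in 'N(N) by rewrite (subsetP (normG N)) // (subsetP sAN).
  have gN : coset N g = coset N x^-1.
    have y1 : coset N y = 1 by apply/coset_id/(subsetP sAN).
    by have := morphM (coset_morphism N) nNy nNxV; rewrite /= y1 mul1g.
  have <- : #[coset N x^-1] = n.
    apply: (prime_nt_dvdP pr_n); last by rewrite -ox -(orderV x) morph_order.
    by rewrite order_eq1; apply: contra N'x => /eqP/(coset_idr nNxV); rewrite groupV.
  by rewrite -gN morph_order // groupM.
have [k def_k] := dvdnP dv_g.
have : #[g] %| (z * n)%N by rewrite order_dvdn mulnC expgM gn cz.
rewrite def_k dvdn_pmul2r ?prime_gt0 // => dv_kz.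
rewrite (prime_nt_dvdP pr_z _ dv_kz) //.
by apply: contra ntc => /eqP k1; rewrite -gn -order_dvdn def_k k1 mul1n.
Qed.

Section Reduction.

Variables (tT : finGroupType) (T U H : {group tT}) (w u : tT) (f : nat).
Hypothesis slT : sl2_like T U H w u f.
Variables z n : nat.
Hypotheses (zT : z \in \pi(T)) (pr_n : prime n) (nAut : ~~ (n %| #|Aut T|)).

Let pr_z : prime z. Proof. by move: zT; rewrite mem_primes => /andP[]. Qed.
Let simT := sl_simple slT.

Lemma simple_center1 (gT : finGroupType) (A : {group gT}) : A \isog T -> 'Z(A) = 1.
Proof.
move=> isoA; have simA: simple A by rewrite (isog_simple isoA).
have [_ /(_ 'Z(A)%G (center_normal A))[] // ZA] := simpleP _ simA.
case/negP: (sl_nonabelian slT); rewrite -(isog_abelian isoA) -ZA; exact: center_abelian.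
Qed.

Lemma isog_nonsolvable (gT : finGroupType) (A : {group gT}) : A \isog T -> ~~ solvable A.
Proof.
move=> isoA; rewrite (isog_sol isoA); apply: contra (sl_nonabelian slT) => solT.
by rewrite cyclic_abelian // prime_cyclic // (simple_sol_prime solT).
Qed.

Let T_n' : ~~ (n %| #|T|).
Proof.
apply/negP=> /(Cauchy pr_n)[y Ty oy].
have: y \in 'Z(T).
  by rewrite inE Ty (cent_of_Aut_prime pr_n nAut) // (subsetP (normG T)).
rewrite (simple_center1 (isog_refl T)) => /set1P y1.
by have := prime_gt1 pr_n; rewrite -oy y1 order1.
Qed.

Let neq_zn : z != n.
Proof.
by apply: contraNneq T_n' => <-; move: zT; rewrite mem_primes => /and3P[].
Qed.

(** [N] is a direct product of isomorphic simple groups, and one of the factors,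
    [K], is a subnormal simple subgroup, hence isomorphic to [T].  Distinct
    conjugates of [K] are normal simple subgroups of [N], hence commute. *)
Lemma nonsolvable_minnormal_order (gT : finGroupType) (G N : {group gT}) :
    simple_sections G T -> minnormal N G -> N <| G -> ~~ solvable N -> n %| #|G| ->
  exists2 x, x \in G & #[x] = (z * n)%N.
Proof.
move=> secG minN nsNG nsolN dv_n; have [sNG nNG] := andP nsNG.
have [H0 [sH0N simH0 [I sIA defN]]] := charsimple_dprod (minnormal_charsimple minN).
have nabH0 : ~~ abelian H0.
  apply: contra nsolN => abH0; apply: abelian_sol.
  elim/big_rec: _ (N) defN => [_ <-|g B Ig IHB M defM]; first exact: abelian1.
  have Ag := subsetP sIA g Ig; have [[A0 B0 defA defB] <- cBA _] := dprodP defM.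
  rewrite defA defB abelianM -{1}defA (IHB _ defB) -defB -{1}defA cBA !andbT.
  by rewrite -(autmE Ag) -morphimEsub // morphim_abelian.
have [g Ig] : exists g, g \in I.
  apply/set0Pn; apply: contraNneq nsolN => I0.
  by rewrite -defN I0 big_set0 solvable1.
have Ag := subsetP sIA g Ig; pose K := (autm Ag @* H0)%G.
have nsKN : K <| N.
  have := defN; rewrite (big_setD1 g Ig) /= -(autmE Ag) -morphimEsub //.
  by case/dprod_normal2.
have isoK1 : K \isog K / 1 := quotient1_isog K.
have isoH0K : H0 \isog K by rewrite sub_isog ?injm_autm.
have isoK : K \isog T.
  have maxK : maxnormal 1%G K K by rewrite -simple_maxnormal -(isog_simple isoH0K).
  have snK : K <|<| G.
    by apply: subnormal_trans (normal_subnormal nsKN) (normal_subnormal nsNG).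
  case: (secG K 1%G snK maxK) => [cycK | ]; last exact: isog_trans.
  case/negP: nabH0; rewrite (isog_abelian isoH0K) (isog_abelian isoK1).
  exact: cyclic_abelian.
have ZK1 := simple_center1 isoK.
have nAutK : ~~ (n %| #|Aut K|) by rewrite (isog_card_Aut isoK).
have [sKN nKN] := andP nsKN; have sKG := subset_trans sKN sNG.
have [|y Ky oy] := @Cauchy _ z K pr_z.
  by rewrite (card_isog isoK); move: zT; rewrite mem_primes => /and3P[].
have [x Gx ox] := Cauchy pr_n dv_n.
have [nKx | nKx'] := boolP (x \in 'N(K)).
  exists (y * x); first by rewrite groupM // (subsetP sKG).
  apply: order_mul_primes => //; apply/esym.
  exact: (centP (cent_of_Aut_prime pr_n nAutK nKx ox)).
have N'x : x \notin N by apply: contra nKx'; apply: subsetP nKN x.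
exists (y * x^-1); first by rewrite groupM ?groupV // (subsetP sKG).
apply: (order_wreath pr_n pr_z ox oy _ N'x sKN Ky ZK1) => [|k /andP[k_gt0 lt_kn]].
  exact: subsetP nNG x Gx.
have nsKxN : (K :^ (x ^+ k))%G <| N.
  by rewrite -(normsP nNG (x ^+ k)) ?groupX // normalJ.
have [sKxN nKxN] := andP nsKxN.
suffices tiK : K :&: K :^ (x ^+ k) = 1.
  rewrite (sameP commG1P trivgP) /= -tiK setIC commg_subI //.
    by rewrite subsetI subxx (subset_trans sKxN).
  by rewrite subsetI subxx (subset_trans sKN).
have [_ simK] := simpleP _ (etrans (esym (isog_simple isoH0K)) simH0).
have [|//|KxK] := simK (K :&: K :^ (x ^+ k))%G.
  by rewrite /normal subsetIl normsI ?normG // (subset_trans sKN).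
case/negP: nKx'; have nKxk : x ^+ k \in 'N(K).
  apply/normP/eqP; rewrite eq_sym eqEcard cardJg leqnn andbT.
  by apply/setIidPl.
have : <[x ^+ k]> = <[x]>.
  apply/eqP; rewrite eq_sym -/(generator _ _) generator_coprime ox.
  by rewrite prime_coprime // gtnNdvd.
by move=> defx; rewrite -cycle_subG -defx cycle_subG.
Qed.

(** A minimal subnormal nonsolvable subgroup [J] has a maximal normal subgroup
    [I] with [J / I] isomorphic to [T].  The normal subgroup [J :&: N] of [J] is
    an [n]-group with an [n']-complement [L], which still maps onto [J / I]
    because [T] has no nontrivial abelian normal subgroups.  The fixed vectors
    of the elements of [L] on [N] exist over an algebraic closure of ['F_n],
    hence over ['F_n]. *)
Lemma solvable_normal_order (gT : finGroupType) (G N : {group gT}) :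
    simple_sections G T -> ~~ solvable G -> N <| G -> n.-abelem N -> N :!=: 1 ->
    ~~ (n %| #|G / N|) ->
  exists2 x, x \in G & #[x] = (z * n)%N.
Proof.
move=> secG nsolG nsNG abelN ntN ndv_n; have [sNG nNG] := andP nsNG.
have [J /andP[snJ nsolJ] minJ] := @arg_minnP _ G
  (fun K : {group gT} => (K <|<| G) && ~~ solvable K) (fun K => #|K|)
  (introT andP (conj (subnormal_refl G) nsolG)).
have ntJ : J :!=: 1 by apply: contraNneq nsolJ => ->; apply: solvable1.
have [I maxI] := ex_maxnormal_ntrivg ntJ.
have nsIJ := maxnormal_normal maxI; have [sIJ nIJ] := andP nsIJ.
have solI : solvable I.
  apply: contraT => nsolI; have := proper_card (maxnormal_proper maxI).
  rewrite ltnNge minJ // nsolI andbT.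
  exact: subnormal_trans (normal_subnormal nsIJ) snJ.
have isoJI : J / I \isog T.
  case: (secG J I snJ maxI) => // /cyclic_abelian/abelian_sol solJI.
  by case/negP: nsolJ; rewrite (series_sol nsIJ) solI.
have sJG := subnormal_sub snJ; have nNJ := subset_trans sJG nNG.
pose M := (J :&: N)%G; have nsMJ : M <| J := normalGI sJG nsNG.
have [sMJ nMJ] := andP nsMJ.
have nM : n.-group M by apply: pgroupS (abelem_pgroup abelN); apply: subsetIr.
have n'JM : n^'.-nat #|J : M|.
  rewrite p'natE // -card_quotient //= setIC (card_isog (second_isog nNJ)).
  by apply: contra ndv_n => /dvdn_trans-> //; rewrite cardSg ?quotientS.
have hallM : Hall J M by rewrite /Hall sMJ (pnat_coprime nM).
have /splitsP[L /complP[tiML defJ]] := SchurZassenhaus_split hallM nsMJ.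
have [_ sLJ] := mulG_sub defJ; have sLG := subset_trans sLJ sJG.
have n'L : n^'.-group L.
  by rewrite /pgroup -(mulKn #|L| (cardG_gt0 M)) -TI_cardMg // defJ divgS.
have imL : L / I = J / I.
  have [_ simJI] := simpleP _ (etrans (isog_simple isoJI) simT).
  have [|MI1|MIJ] := simJI (M / I)%G; first exact: quotient_normal.
    by rewrite -defJ quotientMl ?(subset_trans sMJ) // MI1 mul1g.
  case/negP: (isog_nonsolvable isoJI); rewrite -MIJ quotient_sol //.
  exact: abelian_sol (abelianS (subsetIr _ _) (abelem_abelian abelN)).
have [g injg img] := isogP isoJI.
have sLD : L \subset coset I @*^-1 (J / I).
  by rewrite -sub_quotient_pre ?quotientS // (subset_trans sLJ).
pose phi := [morphism of restrm sLD (g \o coset I)].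
have phiL : phi @* L = T by rewrite morphim_restrm setIid morphim_comp -[coset I @* L]/(L / I) imL.
have nNL := subset_trans sLG nNG; pose rN := abelem_repr abelN ntN nNL.
have [C [iota _]] := countable_algebraic_closure 'F_n.
have pcharL : [pchar C]%R^'.-group L.
  apply: sub_pgroup n'L => r; rewrite !inE; apply: contra => /andP[pr_r r0].
  have: r \in [pchar 'F_n]%R by rewrite -(fmorph_pchar iota) inE pr_r.
  by rewrite (pcharf_eq (pchar_Fp pr_n)) inE.
have /exists_inP[x Lx /andP[/eqP ox]] :=
  extension_fixed_vector (map_repr iota rN) slT phiL pcharL isT pr_z zT.
rewrite map_reprE -(rmorph1 iota) eigenvalue_map.
case/eigenvalueP=> v; rewrite scale1r => fixv nzv.
pose y := rVabelem abelN ntN v; have Ny : y \in N by apply: mem_rVabelem.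
have yx : y ^ x = y := etrans (esym (rVabelemJ abelN ntN nNL v Lx)) (congr1 _ fixv).
have oy : #[y] = n.
  apply: (abelem_order_p abelN Ny); apply: contraNneq nzv => y1.
  by apply/eqP/(@rVabelem_inj _ _ _ abelN ntN); rewrite rVabelem0.
exists (x * y); first exact: groupM (subsetP sLG x Lx) (subsetP sNG y Ny).
by apply: order_mul_primes => //; apply/esym/commgP/conjg_fixP.
Qed.


Theorem simple_sections_order (gT : finGroupType) (G : {group gT}) :
    simple_sections G T -> ~~ solvable G -> n %| #|G| ->
  exists2 x, x \in G & #[x] = (z * n)%N.
Proof.
have [m] := ubnP #|G|; elim: m gT G => // m IHm gT G /ltnSE-leGm secG nsolG dv_n.
have ntG : G :!=: 1 by apply: contraNneq nsolG => ->; apply: solvable1.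
have [N minN sNG] := minnormal_exists ntG (normG G).
have [ntN nNG] := andP (mingroupp minN); have nsNG : N <| G by apply/andP.
have [solN | nsolN] := boolP (solvable N); last first.
  exact: (nonsolvable_minnormal_order secG minN).
have nsolGN : ~~ solvable (G / N) by apply: contra nsolG => solGN; rewrite (series_sol nsNG) solN.
have [dv_nGN | ndv_n] := boolP (n %| #|G / N|).
  have [||_ /morphimP[x nNx Gx ->] ox] := IHm _ (G / N)%G _ _ nsolGN dv_nGN.
  - by apply: leq_trans leGm; rewrite ltn_quotient.
  - exact: simple_sections_quotient.
  by apply: (exists_order Gx); rewrite -ox morph_order.
have [p pr_p abelN] := is_abelemP (charsimple_solvable (minnormal_charsimple minN) solN).
have dv_nN : n %| #|N|.
  by move: dv_n; rewrite -(Lagrange sNG) -card_quotient // Euclid_dvdM // (negPf ndv_n) orbF.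
have np: n = p.
  by apply/eqP; have := pgroupP (abelem_pgroup abelN) _ pr_n dv_nN; rewrite !inE.
by apply: (solvable_normal_order secG nsolG nsNG) => //; rewrite np.
Qed.

End Reduction.

Theorem theorem6p5 :
  forall (f : nat) (F : finFieldType) (gT : finGroupType) (G : {group gT}),
    prime f -> (5 <= f)%N -> #|F| = (2 ^ f)%N ->
    size (primes #|PSL 2 F|) = 4 ->
    strictly_rel_solvable (PSL_group 2 F) G ->
    forall z n : nat,
      z \in \pi(PSL 2 F) -> n \in \pi(G) -> n \notin \pi(Aut (PSL 2 F)) ->
      ~~ prime_graph_compl G z n.
Proof.
move=> f F gT G pr_f f_ge5 oF _ [relG [X compX isoX]] z n z_piT n_piG n_piA.
have [K [L [defX snK maxL]]] := subnormal_composition_factor compX.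
have isoKL : K / L \isog PSL_group 2 F by rewrite defX in isoX.
have simPSL : simple (PSL_group 2 F).
  by rewrite -(isog_simple isoKL) quotient_simple // maxnormal_normal.
have slT := SL2_like pr_f f_ge5 oF simPSL; have isoT := SL2_isog_PSL oF.
have isoTV : PSL_group 2 F \isog SL_group 2 F by rewrite isog_sym.
have oT : #|PSL 2 F| = #|SL 2 F| := card_isog isoTV.
have zT : z \in \pi(SL_group 2 F) by move: z_piT; rewrite /= oT.
have /andP[pr_n dv_n] : prime n && (n %| #|G|).
  by move: n_piG; rewrite mem_primes cardG_gt0.
have nAut : ~~ (n %| #|Aut (SL_group 2 F)|).
  by move: n_piA; rewrite mem_primes pr_n cardG_gt0 /= (isog_card_Aut isoT).
have secG : simple_sections G (SL_group 2 F).
  move=> K1 L1 snK1 maxL1; have [cycX | isoX1] := rel_solvable_sections relG snK1 maxL1.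
    by left.
  by right; apply: isog_trans isoX1 isoTV.
have nsolG : ~~ solvable G.
  have nsolX := isog_nonsolvable slT (isog_trans isoKL isoTV).
  apply: contra nsolX => solG; apply: quotient_sol.
  exact: solvableS (subnormal_sub snK) solG.
have [x Gx ox] := simple_sections_order slT zT pr_n nAut secG nsolG dv_n.
apply/negP=> /and4P[_ _ _ /exists_inP[]].
by exists x; rewrite ?ox.
Qed.
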